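(* Let $\alpha>2$, let $F(\zeta,\omega,\overline{\zeta},\overline{\omega})$ be a polynomial in $\zeta,\omega,\overline\zeta,\overline\omega$, and let $s\in\mathbb{R}$ satisfy $s>\max\left(\frac{\alpha}{2}+1,\frac52\right)$. Suppose that there exists $\psi\in H^s(\mathbb{T})$ such that $$\int_{\mathbb{T}}\operatorname{Im}F_\omega\big(\psi(x),\partial_x\psi(x),\overline{\psi(x)},\overline{\partial_x\psi(x)}\big)\,dx\neq0.$$ Then there exists $\phi\in H^s(\mathbb{T})$ such that for no $T>0$ the Cauchy problem $$\partial_t u+iD^\alpha u=F(u,\partial_x u,\overline{u},\overline{\partial_x u}),\qquad u|_{t=0}=\phi$$ has a solution in $C([0,T];H^s(\mathbb{T}))$ or in $C([-T,0];H^s(\mathbb{T}))$.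
   Context: $\mathbb{T}=\mathbb{R}/(2\pi\mathbb{Z})$; functions are complex-valued; $\int_{\mathbb{T}}f\,dx:=\frac1{2\pi}\int_{-\pi}^{\pi}f(x)\,dx$ and $\hat f(k)=\int_{\mathbb{T}}f(x)e^{-ikx}dx$. $D^\alpha f(x)=\sum_{k\in\mathbb{Z}}|k|^\alpha\hat f(k)e^{ikx}$. $H^s(\mathbb{T})$ is the $L^2$-based Sobolev space with norm $\|f\|_{H^s}=\big(\sum_k(1+k^2)^s|\hat f(k)|^2\big)^{1/2}$. The coefficients of $F$ are complex, and $F_\omega=\partial F/\partial\omega$ is the Wirtinger derivative (i.e. $\zeta,\omega,\overline\zeta,\overline\omega$ are treated as independent variables). Solution: for $s>\frac32$, $T>0$, $\phi\in H^s(\mathbb{T})$, a solution in $H^s(\mathbb{T})$ on $[0,T]$ is a function $u\in L^\infty([0,T];H^s(\mathbb{T}))$ such that for all $\chi\in C_c^\infty([0,T)\times\mathbb{T})$ $$-\int_0^T\!\!\int_{\mathbb{T}}u\,\partial_t\chi\,dx\,dt-\int_{\mathbb{T}}\phi(x)\chi(0,x)\,dx+i\int_0^T\!\!\int_{\mathbb{T}}u\,D^\alpha\chi\,dx\,dt=\int_0^T\!\!\int_{\mathbb{T}}F(u,\partial_xu,\overline u,\overline{\partial_xu})\,\chi\,dx\,dt.$$ A solution on $[-T,0]$ is defined similarly (test functions in $C_c^\infty((-T,0]\times\mathbb{T})$, time integrals over $[-T,0]$, and the sign of the $\phi$-term reversed). *)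

(* Defs.v *)
From HB Require Import structures.
From mathcomp Require Import all_boot all_order all_algebra.
From mathcomp Require Export complex.
From mathcomp Require Import all_classical all_reals all_analysis.
From mathcomp Require mpoly.

Set Implicit Arguments.
Unset Strict Implicit.
Unset Printing Implicit Defensive.

Import Order.TTheory GRing.Theory Num.Theory.
Import numFieldNormedType.Exports.

Local Open Scope classical_set_scope.
Local Open Scope ring_scope.
Local Open Scope complex_scope.

(* Functions on the torus R / (2 pi Z) are 2 pi-periodic functions R -> R[i].
   The library puts no R-normed-space structure on R[i], so integrals,
   derivatives and limits of complex functions are taken componentwise.
   Classes of functions modulo a.e. equality are handled through Borel
   representatives: everything below depends only on the class. *)

Section Torus.
Context {R : realType}.
Implicit Types (f g : R -> R[i]) (chi : R -> R -> R[i]).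

Local Notation mu := (@lebesgue_measure R).

Definition periodicT f := periodic f (2 * pi).

Definition cexp (y : R) : R[i] := cos y +i* sin y.

Definition cint (a b : R) f : R[i] :=
  (\int[mu]_(x in `[a, b]) complex.Re (f x)) +i* (\int[mu]_(x in `[a, b]) complex.Im (f x)).

Definition intT f : R[i] := ((2 * pi)^-1)%:C * cint (- pi) pi f.

Definition RintT (h : R -> R) : R :=
  (2 * pi)^-1 * \int[mu]_(x in `[- pi, pi]) h x.

Definition fourier f (k : int) : R[i] :=
  intT (fun x => f x * cexp (- (k%:~R * x))).

Definition L2T f : Prop :=
  [/\ periodicT f,
      measurable_fun setT (fun x => complex.Re (f x)),
      measurable_fun setT (fun x => complex.Im (f x)) &
      (\int[mu]_(x in `[(- pi)%R, pi]) ((ComplexField.Normc.normc (f x) ^+ 2)%R)%:E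
         < +oo)%E].

Definition Hs_normsq (s : R) f : \bar R :=
  \esum_(k in [set: int])
    ((1 + (k%:~R : R) ^+ 2) `^ s * ComplexField.Normc.normc (fourier f k) ^+ 2)%:E.

(* H^s(T), as a space of functions: only meant for s >= 0, where H^s is
   contained in L^2. *)
Definition Hs (s : R) f : Prop := L2T f /\ (Hs_normsq s f < +oo)%E.

(* Junk value 0 outside H^s; always used together with membership in H^s. *)
Definition Hs_norm (s : R) f : R := Num.sqrt (fine (Hs_normsq s f)).

Definition cderive f (x : R) : R[i] :=
  (derive1 (fun y => complex.Re (f y)) x) +i*
  (derive1 (fun y => complex.Im (f y)) x).

Definition smoothT f : Prop :=
  periodicT f /\
  forall n x, derivable (derive1n n (fun y => complex.Re (f y))) x 1 /\
              derivable (derive1n n (fun y => complex.Im (f y))) x 1.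

Definition weak_deriv f g : Prop :=
  L2T g /\
  forall eta, smoothT eta ->
    intT (fun x => f x * cderive eta x) = - intT (fun x => g x * eta x).

(* The distributional derivative of f: unique a.e. when it exists (as it does
   on H^s, s >= 1), an arbitrary choice of representative being made. *)
Definition dx f : R -> R[i] := xget (fun=> 0) (weak_deriv f).

Definition Dalpha_partial (alpha : R) f (n : nat) (x : R) : R[i] :=
  \sum_(j < n.*2.+1)
    let k : int := (j : nat)%:Z - n%:Z in
    (`|k%:~R : R| `^ alpha)%:C * fourier f k * cexp (k%:~R * x).

(* The sum over the integers is the limit of the symmetric partial sums; D^alpha
   is only applied to smooth functions, whose series converges absolutely. *)
Definition Dalpha (alpha : R) f (x : R) : R[i] :=
  (limn (fun n => complex.Re (Dalpha_partial alpha f n x))) +i*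
  (limn (fun n => complex.Im (Dalpha_partial alpha f n x))).

Fixpoint class_C (n : nat) (h : R -> R -> R) : Prop :=
  continuous (fun p : R * R => h p.1 p.2) /\
  if n is m.+1 then
    [/\ forall t x, derivable (h ^~ x) t 1 /\ derivable (h t) x 1,
        class_C m (fun t x => derive1 (h ^~ x) t) &
        class_C m (fun t x => derive1 (h t) x)]
  else True.

Definition smooth_periodic2 chi : Prop :=
  (forall t, periodicT (chi t)) /\
  forall n, class_C n (fun t x => complex.Re (chi t x)) /\
            class_C n (fun t x => complex.Im (chi t x)).

Definition dt chi (t x : R) : R[i] := cderive (chi ^~ x) t.

(* Elements of C_c^oo([0, T) x T), given by a smooth extension to R x T whose
   values at negative times are irrelevant. *)
Definition test_fwd (T : R) chi : Prop :=
  smooth_periodic2 chi /\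
  exists2 T' : R, T' < T & forall t x, T' < t -> chi t x = 0.

Definition test_bwd (T : R) chi : Prop :=
  smooth_periodic2 chi /\
  exists2 T' : R, - T < T' & forall t x, t < T' -> chi t x = 0.

(* The variables X_0, X_1, X_2, X_3 of a polynomial in {mpoly R[i][4]} stand
   for zeta, omega, conj zeta, conj omega. *)
Definition jet (z w : R[i]) (j : 'I_4) : R[i] := [:: z; w; z^*; w^*]`_j.

Definition nonlin (F : mpoly.mpoly 4 R[i]) f (x : R) : R[i] :=
  mpoly.meval (jet (f x) (dx f x)) F.

Definition F_omega (F : mpoly.mpoly 4 R[i]) : mpoly.mpoly 4 R[i] :=
  mpoly.mderiv (@Ordinal 4 1 isT) F.

Definition simple_Hs (s : R) (v : R -> R -> R[i]) : Prop :=
  exists (m : nat) (A : 'I_m -> set R) (c : 'I_m -> R -> R[i]),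
    [/\ forall j, measurable (A j),
        forall j, Hs s (c j) &
        forall t x, v t x = \sum_(j < m) (\1_(A j) t)%:C * c j x].

(* L^oo([a, b]; H^s): strong (Bochner) measurability and essential
   boundedness. *)
Definition Linf_Hs (s a b : R) (u : R -> R -> R[i]) : Prop :=
  [/\ exists M : R,
        {ae mu, forall t, t \in `[a, b] -> Hs s (u t) /\ Hs_norm s (u t) <= M} &
      exists2 v : nat -> R -> R -> R[i], forall n, simple_Hs s (v n) &
        {ae mu, forall t, t \in `[a, b] ->
           (fun n => Hs_norm s (v n t \- u t)) @ \oo --> (0 : R)}].

Definition C_Hs (s a b : R) (u : R -> R -> R[i]) : Prop :=
  forall t0, t0 \in `[a, b] ->
    Hs s (u t0) /\
    (fun t => Hs_norm s (u t \- u t0)) @ within [set` `[a, b]] (nbhs t0)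
      --> (0 : R).

(* sg is the sign in front of the datum: 1 forward and -1 backward in time. *)
Definition weak_identity (alpha : R) (F : mpoly.mpoly 4 R[i]) (sg : R[i])
    (a b : R) (phi : R -> R[i]) (u : R -> R -> R[i]) chi : Prop :=
  - cint a b (fun t => intT (fun x => u t x * dt chi t x))
  - sg * intT (fun x => phi x * chi 0 x)
  + 'i * cint a b (fun t => intT (fun x => u t x * Dalpha alpha (chi t) x))
  = cint a b (fun t => intT (fun x => nonlin F (u t) x * chi t x)).

Definition solution_fwd (alpha : R) (F : mpoly.mpoly 4 R[i]) (s T : R)
    (phi : R -> R[i]) (u : R -> R -> R[i]) : Prop :=
  Linf_Hs s 0 T u /\
  forall chi, test_fwd T chi -> weak_identity alpha F 1 0 T phi u chi.

Definition solution_bwd (alpha : R) (F : mpoly.mpoly 4 R[i]) (s T : R)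
    (phi : R -> R[i]) (u : R -> R -> R[i]) : Prop :=
  Linf_Hs s (- T) 0 u /\
  forall chi, test_bwd T chi -> weak_identity alpha F (-1) (- T) 0 phi u chi.

End Torus.

(* Main.v *)
(* Let u be a solution, N = F(u, ...) and m the mean of F_omega along u. Differentiating
   once linearises the equation: i k N_k is, up to O(|k|^(1-s)), a sum over |l| <= |k|/2 of
   Fourier coefficients of F_omega, resp. of the derivative of F in conj omega, times
   (i(k-l))^2 u_(k-l), resp. (i(k-l))^2 conj u_(-(k-l)). All terms but the one with l = 0
   oscillate at frequency >= c |k|^(alpha-1) (1+|l|) relative to u_k, and since alpha > 2 they
   gain a power of |k| after an integration in time. The term with l = 0 contributes the
   growth rate -k Im m, so on the half line of frequencies where u_k would grow like
   e^(|k Im m| t) forwards (resp. backwards) in time, boundedness of u forces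
   phi_k = O(|k|^(-s-eps)). Adding to psi a small multiple of a lacunary series in H^s
   which has no such decay on either half line gives a datum without solutions. *)
Require Import Defs.
From mathcomp Require Import all_boot all_order all_algebra.
From mathcomp Require mpoly.

Set Implicit Arguments.
Unset Strict Implicit.
Unset Printing Implicit Defensive.

Import Order.TTheory GRing.Theory Num.Theory.

Local Open Scope ring_scope.

(** The growth rate is frozen at the initial time, so the linear part is autonomous. The mean of
    F_omega then moves by O(t), and the two derivatives falling on u_k are paid for by the integral
    of t e^(-rt), of order 1/r^2 with r comparable to |k|. The oscillating terms are treated by a
    shift of half a period instead of an integration by parts; this asks only for Lipschitz bounds
    in time. The l-th coefficient of F_omega along u has Lipschitz constant O((1+|l|)^p) for any p
    >= 0 with 1 + alpha - s <= p <= s - 1: a time derivative of u costs alpha derivatives, and such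
    a p exists because s > alpha/2 + 1. The condition s > 5/2 puts second derivatives of u into
    H^(s-2) with s - 2 > 1/2, where Fourier series converge absolutely. Reversing time turns a
    backward solution into a forward one for the equation with sign sg = -1, so one estimate treats
    both. All arguments act on Fourier coefficients, and solutions enter only through the integral
    identities of their coefficients. *)

Module MPolyEval.
Import mpoly.

(** The predicate sees an evaluation function together with the evaluations of all its partial
    derivatives. A property stable under sums and products can thus be checked without handling
    monomials; this serves both the Lipschitz bounds and the chain rule. *)
Lemma meval_ind (K : comNzRingType) (n : nat)
    (Pr : (('I_n -> K) -> K) -> ('I_n -> ('I_n -> K) -> K) -> Prop) :
  (forall c, Pr (fun _ => c) (fun _ _ => 0)) ->
  (forall i, Pr (fun v => v i) (fun j _ => (i == j)%:R)) ->
  (forall f f' g g', Pr f f' -> Pr g g' ->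
     Pr (fun v => f v + g v) (fun j v => f' j v + g' j v)) ->
  (forall f f' g g', Pr f f' -> Pr g g' ->
     Pr (fun v => f v * g v) (fun j v => f' j v * g v + f v * g' j v)) ->
  forall p : {mpoly K[n]}, Pr (fun v => p.@[v]) (fun j v => (p^`M(j)).@[v]).
Proof.
move=> hC hX hD hM.
have ext f f' g g' : f =1 g -> f' =2 g' -> Pr f f' -> Pr g g'.
  move=> /boolp.funext -> h; suff -> : f' = g' by [].
  by apply/boolp.funext => i; apply/boolp.funext => v.
have hC' c : Pr (fun v => (c%:MP_[n]).@[v]) (fun j v => ((c%:MP_[n])^`M(j)).@[v]).
  by apply: ext (hC c) => [v|j v]; rewrite ?mderivC ?mevalC ?raddf0.
have hM' p q : Pr (fun v => p.@[v]) (fun j v => (p^`M(j)).@[v]) ->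
    Pr (fun v => q.@[v]) (fun j v => (q^`M(j)).@[v]) ->
    Pr (fun v => (p * q).@[v]) (fun j v => ((p * q)^`M(j)).@[v]).
  move=> hp hq; apply: ext (hM _ _ _ _ hp hq) => [v|j v]; rewrite ?mevalM//.
  by rewrite mderivM mevalD !mevalM.
have hXU i : Pr (fun v => ('X_i).@[v]) (fun j v => ('X_i^`M(j)).@[v]).
  apply: ext (hX i) => [v|j v]; rewrite ?mevalXU// mderivX mnmE mevalZ eq_sym.
  case: eqP => [->|_]; last by rewrite mul0r.
  have -> a : (U_(a) - U_(a))%MM = 0%MM :> 'X_{1..n} by apply/mnmP => k; rewrite mnmBE subnn mnm0E.
  by rewrite mul1r mpolyX0 mevalC.
have hXm m : Pr (fun v => 'X_[m].@[v]) (fun j v => ('X_[m]^`M(j)).@[v]).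
  rewrite mpolyXE_id; apply: (big_ind (fun p => Pr (fun v => p.@[v]) (fun j v => (p^`M(j)).@[v]))).
  - exact: (hC' 1).
  - exact: hM'.
  - move=> i _; elim: (m i) => [|k IH]; first by rewrite expr0; exact: (hC' 1).
    by rewrite exprS; apply: hM'.
elim/mpolyind => [|c m p _ _ hp]; first exact: (hC' 0).
have hc : Pr (fun v => (c *: 'X_[m]).@[v]) (fun j v => ((c *: 'X_[m])^`M(j)).@[v]).
  by rewrite -mul_mpolyC; apply: hM'.
by apply: ext (hD _ _ _ _ hc hp) => [v|j v]; rewrite ?mderivD mevalD.
Qed.

End MPolyEval.

From mathcomp Require Import all_classical all_reals all_analysis.
From mathcomp Require Import measurable_realfun.
From mathcomp Require Import ring lra zify.

Import numFieldNormedType.Exports.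

Local Open Scope classical_set_scope.
Local Open Scope ring_scope.
Local Open Scope complex_scope.

Local Notation Re := complex.Re.
Local Notation Im := complex.Im.
Local Notation nc := ComplexField.Normc.normc.

(** * Complex integrals and sums over the integers *)

Section ComplexAux.
Context {R : realType}.
Implicit Types (z : R[i]) (x y : R).

Lemma eqW d (T : porderType d) (a b : T) : a = b -> (a <= b)%O.
Proof. by move=> ->. Qed.

Lemma cReD z1 z2 : Re (z1 + z2) = Re z1 + Re z2.
Proof. by case: z1 z2 => [? ?] [? ?]. Qed.
Lemma cImD z1 z2 : Im (z1 + z2) = Im z1 + Im z2.
Proof. by case: z1 z2 => [? ?] [? ?]. Qed.
Lemma cReN z : Re (- z) = - Re z. Proof. by case: z. Qed.
Lemma cImN z : Im (- z) = - Im z. Proof. by case: z. Qed.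
Lemma cReM z1 z2 : Re (z1 * z2) = Re z1 * Re z2 - Im z1 * Im z2.
Proof. by case: z1 z2 => [? ?] [? ?]. Qed.
Lemma cImM z1 z2 : Im (z1 * z2) = Re z1 * Im z2 + Im z1 * Re z2.
Proof. by case: z1 z2 => [? ?] [? ?]. Qed.
Lemma cReJ z : Re z^* = Re z. Proof. by case: z. Qed.
Lemma cImJ z : Im z^* = - Im z. Proof. by case: z. Qed.

Definition reimE := (cReD, cImD, cReN, cImN, cReM, cImM, cReJ, cImJ).

Lemma complexP z1 z2 : Re z1 = Re z2 -> Im z1 = Im z2 -> z1 = z2.
Proof. by case: z1 z2 => [? ?] [? ?] /= -> ->. Qed.

Lemma nc_ge0 z : 0 <= nc z.
Proof. by case: z => a b; exact: sqrtr_ge0. Qed.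
Lemma ncE z : nc z = Num.sqrt (Re z ^+ 2 + Im z ^+ 2).
Proof. by case: z. Qed.
Lemma ncM z1 z2 : nc (z1 * z2) = nc z1 * nc z2.
Proof. exact: ComplexField.Normc.normcM. Qed.
Lemma nc0 : nc (0 : R[i]) = 0.
Proof. exact: ComplexField.Normc.normc0. Qed.
Lemma ncD z1 z2 : nc (z1 + z2) <= nc z1 + nc z2.
Proof. exact: (@le_normcD R z1 z2). Qed.
Lemma ncN z : nc (- z) = nc z.
Proof. by case: z => a b /=; rewrite !sqrrN. Qed.
Lemma ncB z1 z2 : nc (z1 - z2) <= nc z1 + nc z2.
Proof. by rewrite -(ncN z2) ncD. Qed.
Lemma ncJ z : nc z^* = nc z.
Proof. by case: z => a b /=; rewrite !sqrrN. Qed.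
Lemma ncBC z1 z2 : nc (z1 - z2) = nc (z2 - z1).
Proof. by rewrite -ncN opprB. Qed.
Lemma nc_real x : nc x%:C = `|x|.
Proof. by rewrite /= expr0n addr0 sqrtr_sqr. Qed.
Lemma nc_i : nc ('i : R[i]) = 1.
Proof. by rewrite /= expr0n expr1n add0r sqrtr1. Qed.
Lemma nc1 : nc (1 : R[i]) = 1.
Proof. exact: ComplexField.Normc.normc1. Qed.
Lemma nc_eq0 z : nc z = 0 -> z = 0.
Proof. exact: ComplexField.Normc.eq0_normc. Qed.
Lemma nc_sum I (s : seq I) (P : pred I) (F : I -> R[i]) :
  nc (\sum_(i <- s | P i) F i) <= \sum_(i <- s | P i) nc (F i).
Proof.
elim/big_rec2: _ => [|i y x _ h]; first by rewrite nc0.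
by apply: (le_trans (ncD _ _)); rewrite lerD2l.
Qed.
Lemma Re_le_nc z : `|Re z| <= nc z.
Proof.
rewrite ncE -sqrtr_sqr ler_wsqrtr// lerDl sqr_ge0//.
Qed.
Lemma Im_le_nc z : `|Im z| <= nc z.
Proof.
rewrite ncE -sqrtr_sqr ler_wsqrtr// lerDr sqr_ge0//.
Qed.
Lemma nc_le_ReIm z : nc z <= `|Re z| + `|Im z|.
Proof.
have h : 0 <= `|Re z| + `|Im z| by rewrite addr_ge0.
rewrite -(ger0_norm h) -sqrtr_sqr ncE ler_wsqrtr//.
rewrite sqrrD !real_normK ?num_real//.
have : 0 <= `|Re z| * `|Im z| *+ 2 by rewrite mulrn_wge0// mulr_ge0.
lra.
Qed.

Lemma cexpD x y : cexp (x + y) = cexp x * cexp y.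
Proof.
by apply: complexP; rewrite reimE /= ?cosD ?sinD//; ring.
Qed.
Lemma cexp0 : cexp (0 : R) = 1.
Proof. by rewrite /cexp cos0 sin0. Qed.
Lemma nc_cexp x : nc (cexp x) = 1.
Proof. by rewrite ncE /= cos2Dsin2 sqrtr1. Qed.

(** The complex exponential of [l * t], used as integrating factor for a Fourier mode. *)
Definition E (l : R[i]) (t : R) : R[i] := (expR (Re l * t))%:C * cexp (Im l * t).

Lemma E_D l m t : E (l + m) t = E l t * E m t.
Proof.
rewrite /E cReD cImD !mulrDl expRD cexpD rmorphM /=; ring.
Qed.
Lemma E_Dt l t u : E l (t + u) = E l t * E l u.
Proof. by rewrite /E !mulrDr expRD cexpD rmorphM /=; ring. Qed.
Lemma E0 l : E l 0 = 1.
Proof. by rewrite /E !mulr0 expR0 cexp0 mulr1. Qed.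
Lemma E0l t : E 0 t = 1.
Proof. by rewrite /E !mul0r expR0 cexp0 mulr1. Qed.
Lemma nc_E l t : nc (E l t) = expR (Re l * t).
Proof. by rewrite /E ncM nc_real nc_cexp mulr1 ger0_norm// expR_ge0. Qed.
Lemma E_J l t : (E l t)^* = E l^* t.
Proof. by apply: complexP; rewrite /E !reimE /= ?mulNr ?cosN ?sinN//; ring. Qed.

End ComplexAux.

(** * Componentwise integration of complex functions *)

Section ComplexIntegral.
Context {R : realType}.
Implicit Types (f g h : R -> R[i]) (a b t x : R).
Local Notation mu := (@lebesgue_measure R).

Lemma ae_mono (P Q : R -> Prop) : (forall x, P x -> Q x) ->
  {ae mu, forall x, P x} -> {ae mu, forall x, Q x}.
Proof. by move=> PQ; apply: negligibleS; apply: subsetC. Qed.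
Lemma ae_and (P Q : R -> Prop) : {ae mu, forall x, P x} -> {ae mu, forall x, Q x} ->
  {ae mu, forall x, P x /\ Q x}.
Proof.
move=> hP hQ; apply: negligibleS (negligibleU hP hQ) => x /=.
by rewrite not_andE.
Qed.

Definition cmeas f := measurable_fun setT (fun x => Re (f x)) /\
  measurable_fun setT (fun x => Im (f x)).

Definition rintg a b (f : R -> R) := mu.-integrable `[a, b] (EFin \o f).

Definition cintg a b f := rintg a b (fun x => Re (f x)) /\ rintg a b (fun x => Im (f x)).

Lemma rintgD a b (f g : R -> R) : rintg a b f -> rintg a b g -> rintg a b (fun x => f x + g x).
Proof. move=> hf hg; exact: (integrableD _ hf hg). Qed.
Lemma rintgZ a b (c : R) (f : R -> R) : rintg a b f -> rintg a b (fun x => c * f x).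
Proof. move=> hf; exact: (integrableZl _ c hf). Qed.
Lemma eq_rintg a b (f g : R -> R) : (forall x, x \in `[a, b] -> f x = g x) ->
  rintg a b f -> rintg a b g.
Proof.
move=> fg; apply: eq_integrable => // x; rewrite inE /= => xab.
by rewrite fg.
Qed.
Lemma rintgB a b (f g : R -> R) : rintg a b f -> rintg a b g -> rintg a b (fun x => f x - g x).
Proof.
move=> hf hg; have := rintgD hf (rintgZ (-1) hg).
by apply: eq_rintg => x _; rewrite mulN1r.
Qed.
Lemma rintg_abs a b (f : R -> R) : rintg a b f -> rintg a b (fun x => `|f x|).
Proof. by move=> h; exact: (integrable_abse h). Qed.

Lemma rintg_le a b (f g : R -> R) : measurable_fun `[a, b] f -> rintg a b g ->
  (forall x, x \in `[a, b] -> `|f x| <= g x) -> rintg a b f.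
Proof.
move=> mf ig fg; apply: le_integrable ig => //.
- exact/measurable_EFinP.
- move=> x xab /=; rewrite lee_fin (le_trans (fg _ xab))// ler_norm//.
Qed.
Lemma rintg_cst a b (c : R) : rintg a b (fun=> c).
Proof.
apply: measurable_bounded_integrable => //; last exact: bounded_cst.
rewrite /= lebesgue_measure_itv /=; by case: ifP => // _; rewrite -EFinD ltry.
Qed.

Lemma cintgD a b f g : cintg a b f -> cintg a b g -> cintg a b (fun x => f x + g x).
Proof.
move=> [f1 f2] [g1 g2]; split; [move: (rintgD f1 g1)|move: (rintgD f2 g2)];
  by apply: eq_rintg => x _; rewrite reimE.
Qed.
Lemma cintgZ a b (c : R[i]) f : cintg a b f -> cintg a b (fun x => c * f x).
Proof.
move=> [f1 f2]; split.
- move: (rintgB (rintgZ (Re c) f1) (rintgZ (Im c) f2)).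
  by apply: eq_rintg => x _; rewrite reimE.
- move: (rintgD (rintgZ (Re c) f2) (rintgZ (Im c) f1)).
  by apply: eq_rintg => x _; rewrite reimE.
Qed.
Lemma cintgN a b f : cintg a b f -> cintg a b (fun x => - f x).
Proof.
move=> h; have [h1 h2] := cintgZ (-1) h.
split; [apply: eq_rintg h1|apply: eq_rintg h2] => x _; by rewrite mulN1r.
Qed.
Lemma cintgB a b f g : cintg a b f -> cintg a b g -> cintg a b (fun x => f x - g x).
Proof. by move=> hf hg; exact: (cintgD hf (cintgN hg)). Qed.
Lemma cintg_cst a b (c : R[i]) : cintg a b (fun=> c).
Proof. by split; exact: rintg_cst. Qed.
Lemma cintg_sum a b I (s : seq I) (F : I -> R -> R[i]) :
  (forall i, cintg a b (F i)) -> cintg a b (fun x => \sum_(i <- s) F i x).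
Proof.
move=> h; elim: s => [|i s IH].
  have [h1 h2] := cintg_cst a b 0.
  by split; [apply: eq_rintg h1|apply: eq_rintg h2] => x _; rewrite big_nil.
have [h1 h2] := cintgD (h i) IH.
by split; [apply: eq_rintg h1|apply: eq_rintg h2] => x _; rewrite big_cons.
Qed.
Lemma eq_cintg a b f g : (forall x, x \in `[a, b] -> f x = g x) ->
  cintg a b f -> cintg a b g.
Proof.
by move=> fg [h1 h2]; split; [apply: eq_rintg h1|apply: eq_rintg h2] => x /fg ->.
Qed.
Lemma cintg_conj a b f : cintg a b f -> cintg a b (fun x => (f x)^*).
Proof.
move=> [h1 h2]; split; [apply: eq_rintg h1|apply: eq_rintg (rintgZ (-1) h2)] => x _;
  by rewrite reimE ?mulN1r.
Qed.

Lemma cmeasD f g : cmeas f -> cmeas g -> cmeas (fun x => f x + g x).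
Proof.
move=> [f1 f2] [g1 g2]; split.
  by under eq_fun do rewrite cReD; exact: measurable_funD.
by under eq_fun do rewrite cImD; exact: measurable_funD.
Qed.
Lemma cmeasM f g : cmeas f -> cmeas g -> cmeas (fun x => f x * g x).
Proof.
move=> [f1 f2] [g1 g2]; split.
  by under eq_fun do rewrite cReM; apply: measurable_funB; exact: measurable_funM.
by under eq_fun do rewrite cImM; apply: measurable_funD; exact: measurable_funM.
Qed.
Lemma cmeas_cst (c : R[i]) : cmeas (fun=> c).
Proof. by split; exact: measurable_cst. Qed.
Lemma cmeasB f g : cmeas f -> cmeas g -> cmeas (fun x => f x - g x).
Proof.
move=> hf hg; have := cmeasD hf (cmeasM (cmeas_cst (-1)) hg).
by under [X in cmeas X -> _]eq_fun do rewrite mulN1r.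
Qed.
Lemma cmeas_conj f : cmeas f -> cmeas (fun x => (f x)^*).
Proof.
move=> [f1 f2]; split; first by under eq_fun do rewrite cReJ.
by under eq_fun do rewrite cImJ; exact: measurableT_comp.
Qed.
Lemma cmeas_sum I (s : seq I) (F : I -> R -> R[i]) :
  (forall i, cmeas (F i)) -> cmeas (fun x => \sum_(i <- s) F i x).
Proof.
move=> h; elim: s => [|i s IH].
  by under eq_fun do rewrite big_nil; exact: cmeas_cst.
by under eq_fun do rewrite big_cons; exact: cmeasD.
Qed.
Lemma cmeas_cexp (w : R) : cmeas (fun x => cexp (w * x)).
Proof.
split => /=; apply: continuous_measurable_fun => x;
  apply: (@continuous_comp _ _ _ (fun x => w * x)).
- exact: mulrl_continuous.
- exact: continuous_cos.
- exact: mulrl_continuous.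
- exact: continuous_sin.
Qed.
Lemma cmeas_nc f : cmeas f -> measurable_fun setT (fun x => nc (f x)).
Proof.
move=> [f1 f2]; under eq_fun do rewrite ncE.
apply: (@measurableT_comp _ _ _ _ _ _ (@Num.sqrt R)).
  by apply: continuous_measurable_fun; exact: sqrt_continuous.
by apply: measurable_funD; exact: measurable_funX.
Qed.

Lemma cintg_le a b f (g : R -> R) : cmeas f -> rintg a b g ->
  (forall x, x \in `[a, b] -> nc (f x) <= g x) -> cintg a b f.
Proof.
move=> [mf1 mf2] ig fg; split; apply: (rintg_le _ ig) => [|x /fg h].
- exact: measurable_funTS.
- exact: le_trans (Re_le_nc _) h.
- exact: measurable_funTS.
- exact: le_trans (Im_le_nc _) h.
Qed.
Lemma rintg_nc a b f : cmeas f -> cintg a b f -> rintg a b (fun x => nc (f x)).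
Proof.
move=> mf [h1 h2].
apply: (rintg_le _ (rintgD (rintg_abs h1) (rintg_abs h2))).
  by apply: measurable_funTS; exact: cmeas_nc.
by move=> x _; rewrite ger0_norm ?nc_ge0// nc_le_ReIm.
Qed.
Lemma cintgM a b f g (B : R) : cmeas f -> cmeas g ->
  (forall x, x \in `[a, b] -> nc (f x) <= B) -> cintg a b g ->
  cintg a b (fun x => f x * g x).
Proof.
move=> mf mg fB ig; apply: (@cintg_le _ _ _ (fun x => B * nc (g x))).
- exact: cmeasM.
- by apply: rintgZ; exact: rintg_nc.
- by move=> x /fB h; rewrite ncM ler_wpM2r ?nc_ge0.
Qed.

Lemma cintE a b f : cint a b f =
  (\int[mu]_(x in `[a, b]) Re (f x)) +i* (\int[mu]_(x in `[a, b]) Im (f x)).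
Proof. by []. Qed.
Lemma cintD a b f g : cintg a b f -> cintg a b g ->
  cint a b (fun x => f x + g x) = cint a b f + cint a b g.
Proof.
move=> [f1 f2] [g1 g2]; apply: complexP => /=; under eq_Rintegral do rewrite reimE;
  by rewrite RintegralD.
Qed.
Lemma cintZ a b (c : R[i]) f : cintg a b f -> cint a b (fun x => c * f x) = c * cint a b f.
Proof.
move=> [f1 f2]; apply: complexP => /=; under eq_Rintegral do rewrite reimE; rewrite !reimE /=.
  by rewrite RintegralB ?RintegralZl//; exact: rintgZ.
by rewrite RintegralD ?RintegralZl//; exact: rintgZ.
Qed.
Lemma cintN a b f : cintg a b f -> cint a b (fun x => - f x) = - cint a b f.
Proof.
move=> h; rewrite -mulN1r -cintZ//; congr cint; apply/funext => x; by rewrite mulN1r.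
Qed.
Lemma cintB a b f g : cintg a b f -> cintg a b g ->
  cint a b (fun x => f x - g x) = cint a b f - cint a b g.
Proof. by move=> hf hg; rewrite cintD ?cintN//; exact: cintgN. Qed.
Lemma cint_conj a b f : cintg a b f -> cint a b (fun x => (f x)^*) = (cint a b f)^*.
Proof.
move=> [h1 h2]; apply: complexP => /=; under eq_Rintegral do rewrite reimE; first by [].
under eq_Rintegral do rewrite -mulN1r.
by rewrite RintegralZl// mulN1r.
Qed.
Lemma cint_sum a b I (s : seq I) (F : I -> R -> R[i]) :
  (forall i, cintg a b (F i)) ->
  cint a b (fun x => \sum_(i <- s) F i x) = \sum_(i <- s) cint a b (F i).
Proof.
move=> h; elim: s => [|i s IH].
  rewrite big_nil; apply: complexP => /=; under eq_Rintegral do rewrite big_nil;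
  by rewrite Rintegral_cst// mul0r.
rewrite big_cons -IH -cintD//; last exact: cintg_sum.
by congr cint; apply/funext => x; rewrite big_cons.
Qed.
Lemma eq_cint a b f g : (forall x, x \in `[a, b] -> f x = g x) -> cint a b f = cint a b g.
Proof.
by move=> fg; apply: complexP => /=; apply: eq_Rintegral => x;
  rewrite inE /= => xab; rewrite fg.
Qed.
Lemma rint_ae a b (f g : R -> R) : measurable_fun setT f -> measurable_fun setT g ->
  {ae mu, forall x, x \in `[a, b] -> f x = g x} ->
  \int[mu]_(x in `[a, b]) f x = \int[mu]_(x in `[a, b]) g x.
Proof.
move=> mf mg fg; congr fine; apply: ae_eq_integral => //.
- by apply/measurable_EFinP; exact: measurable_funTS.
- by apply/measurable_EFinP; exact: measurable_funTS.
- by apply: ae_mono fg => x h xab; rewrite h.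
Qed.
Lemma cint_ae a b f g : cmeas f -> cmeas g ->
  {ae mu, forall x, x \in `[a, b] -> f x = g x} -> cint a b f = cint a b g.
Proof.
move=> [? ?] [? ?] fg; apply: complexP => /=; apply: rint_ae => //;
  by apply: ae_mono fg => x h /h ->.
Qed.
Lemma rint_le a b (f g : R -> R) : rintg a b f -> rintg a b g ->
  (forall x, x \in `[a, b] -> f x <= g x) ->
  \int[mu]_(x in `[a, b]) f x <= \int[mu]_(x in `[a, b]) g x.
Proof. by move=> hf hg fg; apply: le_Rintegral. Qed.

(** The factor 2 comes from bounding the real and imaginary parts separately; no sharp constant is
    needed anywhere. *)
Lemma nc_cint a b f (G : R -> R) : cintg a b f -> rintg a b G ->
  (forall x, x \in `[a, b] -> nc (f x) <= G x) ->
  nc (cint a b f) <= 2 * \int[mu]_(x in `[a, b]) G x.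
Proof.
move=> [h1 h2] hG fG; apply: (le_trans (nc_le_ReIm _)); rewrite mulr_natl mulr2n /=.
apply: lerD; (apply: le_trans; first exact: le_normr_Rintegral);
  apply: rint_le => //; try exact: rintg_abs; move=> x /fG h.
- exact: le_trans (Re_le_nc _) h.
- exact: le_trans (Im_le_nc _) h.
Qed.
Lemma rint_cst a b (c : R) : a <= b -> \int[mu]_(x in `[a, b]) c = c * (b - a).
Proof.
move=> ab; rewrite Rintegral_cst//= lebesgue_measure_itv/= lte_fin.
by move: ab; rewrite le_eqVlt => /predU1P[->|->] /=; rewrite ?ltxx ?subrr.
Qed.
Lemma nc_cint_cst a b f (B : R) : a <= b -> cintg a b f ->
  (forall x, x \in `[a, b] -> nc (f x) <= B) ->
  nc (cint a b f) <= 2 * B * (b - a).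
Proof.
move=> ab hf fB; apply: (le_trans (nc_cint hf (rintg_cst a b B) fB)).
by rewrite rint_cst// mulrA.
Qed.

Lemma rintg_continuous a b (f : R -> R) : {within `[a, b], continuous f} -> rintg a b f.
Proof. by move=> h; apply: continuous_compact_integrable => //; exact: segment_compact. Qed.

Lemma rintgS a b c d (f : R -> R) : a <= c -> d <= b -> rintg a b f -> rintg c d f.
Proof.
move=> ac db; apply: integrableS => //.
by apply: subset_itv; rewrite bnd_simp.
Qed.
Lemma cintgS a b c d f : a <= c -> d <= b -> cintg a b f -> cintg c d f.
Proof. by move=> ac db [h1 h2]; split; apply: rintgS; eauto. Qed.

Lemma rint_split a b c (f : R -> R) : a <= c -> c <= b -> rintg a b f ->
  \int[mu]_(x in `[a, b]) f x = \int[mu]_(x in `[a, c]) f x + \int[mu]_(x in `[c, b]) f x.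
Proof.
move=> ac cb hf.
have := @Rintegral_itvB R f (BLeft a) (BRight b) c hf; rewrite !bnd_simp => /(_ ac cb).
rewrite Rintegral_itv_obnd_cbnd.
  by move=> <-; rewrite addrC subrK.
apply: integrableS hf => //; apply: subset_itv; rewrite bnd_simp//.
Qed.
Lemma cint_split a b c f : a <= c -> c <= b -> cintg a b f ->
  cint a b f = cint a c f + cint c b f.
Proof. by move=> ac cb [h1 h2]; apply: complexP; rewrite reimE /=; exact: rint_split. Qed.

End ComplexIntegral.

(** * Summable families indexed by the integers *)

Section SumsOverIntegers.
Context {R : realType}.
Implicit Types (u v : nat -> R[i]) (l : R[i]) (F G : int -> R) (c : int -> R[i]).

(** The integers from -n to n, in the order of the symmetric partial sums of [Dalpha_partial]. *)
Definition zl (n : nat) : seq int := [seq j%:Z - n%:Z | j <- iota 0 n.*2.+1].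

Lemma zl_uniq n : uniq (zl n).
Proof. by rewrite map_inj_uniq ?iota_uniq// => i j /addIr [->]. Qed.

Lemma mem_zl n k : (k \in zl n) = (absz k <= n)%N.
Proof.
apply/mapP/idP => [[j]|kn].
  by rewrite mem_iota add0n => /andP[_ jn] ->; lia.
exists (absz (k + n%:Z)); last lia.
by rewrite mem_iota; lia.
Qed.

Lemma big_zl (T : nmodType) n (F : int -> T) :
  \sum_(k <- zl n) F k = \sum_(j < n.*2.+1) F ((j : nat)%:Z - n%:Z).
Proof. by rewrite big_map -[iota _ _]/(index_iota 0 n.*2.+1) big_mkord. Qed.

Definition ztail (N n : nat) := [seq k <- zl n | (N < absz k)%N].

Lemma big_zl_split (T : nmodType) N n (F : int -> T) : (N <= n)%N ->
  \sum_(k <- zl n) F k = \sum_(k <- zl N) F k + \sum_(k <- ztail N n) F k.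
Proof.
move=> Nn; rewrite -big_cat; apply: perm_big; apply: uniq_perm.
- exact: zl_uniq.
- rewrite cat_uniq zl_uniq filter_uniq ?zl_uniq// andbT.
  apply/hasPn => k; rewrite mem_filter !mem_zl => /andP[h _] /=.
  by rewrite -ltnNge.
- move=> k; rewrite mem_cat mem_filter !mem_zl.
  by case: leqP => h1 /=; lia.
Qed.

(** For a nonnegative family this says that its sum is at most [B]. Quantifying over duplicate-free
    lists makes reindexing by an injection and restriction to a subset immediate. *)
Definition sumle F (B : R) := forall s : seq int, uniq s -> \sum_(k <- s) F k <= B.

Lemma sumle_ge0 F B : sumle F B -> 0 <= B.
Proof. by move=> /(_ [::] isT); rewrite big_nil. Qed.
Lemma sumle_mono F G A B : (forall k, F k <= G k) -> A <= B -> sumle G A -> sumle F B.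
Proof.
by move=> FG AB h s us; rewrite (le_trans _ AB)// (le_trans _ (h s us))// ler_sum.
Qed.
Lemma sumleD F G A B : sumle F A -> sumle G B -> sumle (fun k => F k + G k) (A + B).
Proof. by move=> hF hG s us; rewrite big_split lerD ?hF ?hG. Qed.
Lemma sumleZ F A (b : R) : 0 <= b -> sumle F A -> sumle (fun k => b * F k) (b * A).
Proof. by move=> b0 hF s us; rewrite -mulr_sumr ler_wpM2l ?hF. Qed.
Lemma sumle_inj F A (p : int -> int) : injective p -> sumle F A -> sumle (fun k => F (p k)) A.
Proof.
move=> pi hF s us; rewrite -(big_map p xpredT F); apply: hF; by rewrite map_inj_uniq.
Qed.
Lemma sumle_pt F A k : sumle F A -> F k <= A.
Proof. by move=> /(_ [:: k] isT); rewrite big_seq1. Qed.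

(** A finite set whose sum is within e of the supremum leaves at most e for any finite set disjoint
    from it. *)
Lemma sumle_tail F B : (forall k, 0 <= F k) -> sumle F B -> forall e, 0 < e ->
  exists N, forall s, uniq s -> (forall k, k \in s -> (N < absz k)%N) ->
    \sum_(k <- s) F k <= e.
Proof.
move=> F0 hF e e0.
pose X := [set x | exists s : seq int, uniq s /\ x = \sum_(k <- s) F k].
have hX : has_sup X.
  split; first by exists (\sum_(k <- [::]) F k), [::].
  by exists B => x [s [us ->]]; exact: hF.
have [x [s0 [us0 ->]] hx] := sup_adherent e0 hX.
exists (\max_(k <- s0) absz k)%N => s us hs.
have : \sum_(k <- s0 ++ s) F k <= sup X.
  apply: sup_upper_bound => //; exists (s0 ++ s); split => //.
  rewrite cat_uniq us0 us andbT; apply/hasPn => k /hs.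
  by apply: contraL => ks0; rewrite -leqNgt; apply: leq_bigmax_seq.
rewrite big_cat /=; lra.
Qed.

Definition ccvg u l := forall e : R, 0 < e ->
  exists N, forall n, (N <= n)%N -> nc (u n - l) <= e.
Definition clim u : R[i] := limn (fun n => Re (u n)) +i* limn (fun n => Im (u n)).

Lemma ccvgP u l : ccvg u l <-> (fun n => Re (u n)) @ \oo --> Re l /\ (fun n => Im (u n)) @ \oo --> Im l.
Proof.
split.
- move=> h; split; apply/cvgrPdist_le => e /h [N hN]; exists N => // n /= Nn.
  + by rewrite distrC -?cReN -?cReD -?cImN -?cImD (le_trans (Re_le_nc _))// hN.
  + by rewrite distrC -?cReN -?cReD -?cImN -?cImD (le_trans (Im_le_nc _))// hN.
- move=> [/cvgrPdist_le h1 /cvgrPdist_le h2] e e0.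
  have e20 : 0 < e / 2 by rewrite divr_gt0.
  have [N1 _ hN1] := h1 _ e20; have [N2 _ hN2] := h2 _ e20.
  exists (maxn N1 N2) => n; rewrite geq_max => /andP[n1 n2].
  apply: (le_trans (nc_le_ReIm _)); rewrite !reimE.
  have := hN1 _ n1; have := hN2 _ n2; rewrite /= (distrC (Re l)) (distrC (Im l)); lra.
Qed.

Lemma ccauchy u : (forall e : R, 0 < e -> exists N, forall n, (N <= n)%N -> nc (u n - u N) <= e) ->
  ccvg u (clim u).
Proof.
move=> h; apply/ccvgP; split; apply: (@cauchy_cvg R); apply: cauchy_exP => e e0;
  have [|N hN] := h (e / 2); rewrite ?divr_gt0//;
  [exists (Re (u N))|exists (Im (u N))]; exists N => // n /= /hN;
  rewrite /ball /= => hn; rewrite distrC (le_lt_trans _ (_ : e / 2 < e)) ?ltr_pdivrMr ?ltr_pMr ?ltr1n//;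
  apply: le_trans hn; rewrite -?cReN -?cImN -?cReD -?cImD ?Re_le_nc ?Im_le_nc//.
Qed.

Lemma ccvg_lim u l : ccvg u l -> clim u = l.
Proof.
by move=> /ccvgP[a1 a2]; apply: complexP; apply: cvg_lim => //; exact: Rhausdorff.
Qed.
Lemma ccvg_unique u l1 l2 : ccvg u l1 -> ccvg u l2 -> l1 = l2.
Proof. by move=> /ccvg_lim <- /ccvg_lim. Qed.
Lemma ccvgD u v l1 l2 : ccvg u l1 -> ccvg v l2 -> ccvg (fun n => u n + v n) (l1 + l2).
Proof.
move=> h1 h2 e e0; have e20 : 0 < e / 2 by rewrite divr_gt0.
have [N1 hN1] := h1 _ e20; have [N2 hN2] := h2 _ e20.
exists (maxn N1 N2) => n; rewrite geq_max => /andP[n1 n2].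
rewrite opprD addrACA; apply: (le_trans (ncD _ _)).
have := hN1 _ n1; have := hN2 _ n2; lra.
Qed.
Lemma ccvgZ u l (a : R[i]) : ccvg u l -> ccvg (fun n => a * u n) (a * l).
Proof.
move=> h e e0; have d0 : 0 < nc a + 1 by rewrite ltr_wpDl// nc_ge0.
have [N hN] := h _ (divr_gt0 e0 d0); exists N => n /hN hn.
rewrite -mulrBr ncM (le_trans (ler_wpM2l (nc_ge0 _) hn))//.
rewrite mulrA ler_pdivrMr// mulrC ler_wpM2l ?(ltW e0)// lerDl//.
Qed.
Lemma ccvgN u l : ccvg u l -> ccvg (fun n => - u n) (- l).
Proof.
by move=> /(ccvgZ (-1)); rewrite mulN1r; under eq_fun do rewrite mulN1r.
Qed.
Lemma ccvg_near u l N : (forall n, (N <= n)%N -> u n = l) -> ccvg u l.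
Proof. by move=> h e e0; exists N => n /h ->; rewrite subrr nc0 ltW. Qed.
Lemma ccvg_eq u v l N : (forall n, (N <= n)%N -> u n = v n) -> ccvg u l -> ccvg v l.
Proof.
move=> uv h e /h[M hM]; exists (maxn N M) => n; rewrite geq_max => /andP[n1 n2].
by rewrite -uv// hM.
Qed.
Lemma ccvg_dist u l (x : R[i]) (B : R) N : ccvg u l ->
  (forall n, (N <= n)%N -> nc (u n - x) <= B) -> nc (l - x) <= B.
Proof.
move=> h hB; apply/ler_addgt0Pr => e /h[M hM].
have := hM _ (leq_maxr N M); have := hB _ (leq_maxl N M); move: (maxn N M) => n h1 h2.
have -> : l - x = (u n - x) - (u n - l) by ring.
by apply: (le_trans (ncB _ _)); rewrite lerD.
Qed.
Lemma ccvg_le u l (B : R) : ccvg u l -> (forall n, nc (u n) <= B) -> nc l <= B.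
Proof.
move=> h hB; rewrite -(subr0 l); apply: (@ccvg_dist _ _ _ _ 0%N) h _ => n _; rewrite subr0//.
Qed.

Lemma zl_sum_cauchy c B : sumle (fun k => nc (c k)) B ->
  forall e : R, 0 < e -> exists N, forall n, (N <= n)%N ->
    nc (\sum_(k <- zl n) c k - \sum_(k <- zl N) c k) <= e.
Proof.
move=> h e e0; have [N hN] := sumle_tail (fun k => nc_ge0 _) h e0.
exists N => n Nn; rewrite (big_zl_split _ Nn) addrAC subrr add0r.
apply: (le_trans (nc_sum _ _ _)); apply: hN => [|k].
  by rewrite filter_uniq// zl_uniq.
by rewrite mem_filter => /andP[].
Qed.
Lemma zl_sum_ccvg c B : sumle (fun k => nc (c k)) B ->
  ccvg (fun n => \sum_(k <- zl n) c k) (clim (fun n => \sum_(k <- zl n) c k)).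
Proof. move=> h; apply: ccauchy; exact: zl_sum_cauchy h. Qed.

End SumsOverIntegers.

(** * Fourier series *)

Section FourierBasics.
Context {R : realType}.
Implicit Types (f g : R -> R[i]) (k m : int).
Local Notation mu := (@lebesgue_measure R).
Local Notation pi := (@pi R).

Lemma rint_derive (a b : R) (h h' : R -> R) : a < b ->
  (forall x : R, is_derive x (1 : R) h (h' x)) -> continuous h' ->
  \int[mu]_(x in `[a, b]) h' x = h b - h a.
Proof.
move=> ab dh ch'.
have hc x : {for x, continuous h}.
  by apply: differentiable_continuous; apply/derivable1_diffP; have [] := dh x.
rewrite /Rintegral (@continuous_FTC2 _ _ h)//.
- exact: continuous_subspaceT.
- split.
  + by move=> x _; have [] := dh x.
  + by apply: cvg_at_right_filter; exact: hc.
  + by apply: cvg_at_left_filter; exact: hc.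
- by move=> x _; rewrite derive1E; apply: derive_val.
Qed.

Definition L1T f := cmeas f /\ cintg (- pi) pi f.

Lemma L1T_cst (c : R[i]) : L1T (fun=> c).
Proof. by split; [exact: cmeas_cst|exact: cintg_cst]. Qed.
Lemma L1TD f g : L1T f -> L1T g -> L1T (fun x => f x + g x).
Proof. by move=> [? ?] [? ?]; split; [exact: cmeasD|exact: cintgD]. Qed.
Lemma L1TZ (c : R[i]) f : L1T f -> L1T (fun x => c * f x).
Proof.
by move=> [? ?]; split; [apply: cmeasM => //; exact: cmeas_cst|exact: cintgZ].
Qed.
Lemma L1TB f g : L1T f -> L1T g -> L1T (fun x => f x - g x).
Proof. by move=> [? ?] [? ?]; split; [exact: cmeasB|exact: cintgB]. Qed.
Lemma L1T_sum I (s : seq I) (F : I -> R -> R[i]) :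
  (forall i, L1T (F i)) -> L1T (fun x => \sum_(i <- s) F i x).
Proof.
by move=> h; split; [apply: cmeas_sum|apply: cintg_sum] => i; case: (h i).
Qed.
Lemma L1T_conj f : L1T f -> L1T (fun x => (f x)^*).
Proof. by move=> [? ?]; split; [exact: cmeas_conj|exact: cintg_conj]. Qed.
Lemma L1T_bounded f (B : R) : cmeas f -> (forall x, x \in `[- pi, pi] -> nc (f x) <= B) -> L1T f.
Proof. by move=> mf fB; split => //; apply: (cintg_le mf (rintg_cst _ _ B)). Qed.
Lemma L1TM f g (B : R) : cmeas f -> (forall x, x \in `[- pi, pi] -> nc (f x) <= B) -> L1T g ->
  L1T (fun x => f x * g x).
Proof. by move=> mf fB [mg ig]; split; [exact: cmeasM|exact: (cintgM mf mg fB)]. Qed.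
Lemma L1T_cexp (w : R) : L1T (fun x => cexp (w * x)).
Proof. by apply: (@L1T_bounded _ 1) => [|x _]; rewrite ?nc_cexp//; exact: cmeas_cexp. Qed.
Lemma L1TMexp f (w : R) : L1T f -> L1T (fun x => f x * cexp (w * x)).
Proof.
move=> h; under eq_fun do rewrite mulrC; apply: (@L1TM _ _ 1) => //.
  exact: cmeas_cexp.
by move=> x _; rewrite nc_cexp.
Qed.
Lemma L1T_ftest f k : L1T f -> L1T (fun x => f x * cexp (- (k%:~R * x))).
Proof. by move=> /(L1TMexp (- k%:~R)); under eq_fun do rewrite mulNr. Qed.

Lemma rintg_ae (a b : R) (f g : R -> R) : measurable_fun setT g ->
  {ae mu, forall x, x \in `[a, b] -> f x = g x} -> rintg a b f -> rintg a b g.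
Proof.
move=> mg fg hf; have [mf hf'] := integrableP _ _ _ hf.
have mg' : measurable_fun `[a, b] (EFin \o g).
  by apply/measurable_EFinP; exact: measurable_funTS.
apply/integrableP; split => //; apply: le_lt_trans hf'.
apply: eqW; apply: ge0_ae_eq_integral => //.
- exact: measurableT_comp.
- exact: measurableT_comp.
- by apply: ae_mono fg => x h xab /=; rewrite h.
Qed.
Lemma ae_L1T f g : cmeas g -> {ae mu, forall x, x \in `[- pi, pi] -> f x = g x} ->
  L1T f -> L1T g.
Proof.
move=> [m1 m2] fg [mf [h1 h2]]; split => //; split.
- by apply: rintg_ae h1 => //; apply: ae_mono fg => x h /h ->.
- by apply: rintg_ae h2 => //; apply: ae_mono fg => x h /h ->.
Qed.

Lemma L2T_L1T f : L2T f -> L1T f.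
Proof.
move=> [_ m1 m2 h]; have mf : cmeas f by [].
split => //; apply: (@cintg_le _ _ _ _ (fun x => 1 + nc (f x) ^+ 2)) => //.
  apply: rintgD; first exact: rintg_cst.
  apply/integrableP; split.
    apply/measurable_EFinP; apply: measurable_funTS.
    by apply: measurable_funX; exact: cmeas_nc.
  apply: le_lt_trans h; rewrite le_eqVlt; apply/orP; left; apply/eqP.
  apply: eq_integral => x _ /=; rewrite ger0_norm// sqr_ge0//.
move=> x _; have := sqr_ge0 (nc (f x) - 1); have := nc_ge0 (f x); nra.
Qed.

Lemma pi2_gt0 : 0 < 2 * pi :> R. Proof. by rewrite mulr_gt0 ?pi_gt0. Qed.
Lemma Npi_lt_pi : - pi < pi :> R. Proof. by rewrite gt0_cp ?pi_gt0. Qed.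

Lemma intTD f g : L1T f -> L1T g -> intT (fun x => f x + g x) = intT f + intT g.
Proof. by move=> [_ hf] [_ hg]; rewrite /intT cintD// mulrDr. Qed.
Lemma intTZ (c : R[i]) f : L1T f -> intT (fun x => c * f x) = c * intT f.
Proof. by move=> [_ hf]; rewrite /intT cintZ// mulrCA. Qed.
Lemma intTB f g : L1T f -> L1T g -> intT (fun x => f x - g x) = intT f - intT g.
Proof. by move=> [_ hf] [_ hg]; rewrite /intT cintB// mulrBr. Qed.
Lemma intT_sum I (s : seq I) (F : I -> R -> R[i]) : (forall i, L1T (F i)) ->
  intT (fun x => \sum_(i <- s) F i x) = \sum_(i <- s) intT (F i).
Proof. by move=> h; rewrite /intT cint_sum ?mulr_sumr// => i; case: (h i). Qed.
Lemma intT_conj f : L1T f -> intT (fun x => (f x)^*) = (intT f)^*.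
Proof.
move=> [_ hf]; rewrite /intT cint_conj//.
by apply: complexP; rewrite !reimE /= ?oppr0; ring.
Qed.
Lemma intT_ae f g : cmeas f -> cmeas g ->
  {ae mu, forall x, x \in `[- pi, pi] -> f x = g x} -> intT f = intT g.
Proof. by move=> mf mg fg; rewrite /intT (cint_ae mf mg fg). Qed.

Lemma nc_intT f (G : R -> R) : L1T f -> rintg (- pi) pi G ->
  (forall x, x \in `[- pi, pi] -> nc (f x) <= G x) -> nc (intT f) <= 2 * RintT G.
Proof.
move=> [_ hf] hG fG; rewrite /intT /RintT ncM nc_real ger0_norm; last first.
  by rewrite invr_ge0 ltW// pi2_gt0.
rewrite mulrCA ler_wpM2l//; first by rewrite invr_ge0 ltW// pi2_gt0.
exact: nc_cint.
Qed.
Lemma RintT_cst (B : R) : RintT (fun=> B) = B.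
Proof.
rewrite /RintT rint_cst ?(ltW Npi_lt_pi)//.
have -> : pi - - pi = 2 * pi :> R by ring.
have : 2 * pi != 0 :> R by rewrite gt_eqF// pi2_gt0.
by move: (2 * pi) => p p0; rewrite mulrCA mulVf ?mulr1.
Qed.
Lemma RintTZ (c : R) (G : R -> R) : rintg (- pi) pi G -> RintT (fun x => c * G x) = c * RintT G.
Proof. by move=> h; rewrite /RintT RintegralZl// mulrCA. Qed.

Lemma sin_Mpi k : sin (k%:~R * pi) = 0 :> R.
Proof.
have h n : sin (n%:R * pi) = 0 :> R.
  elim: n => [|n IH]; first by rewrite mul0r sin0.
  by rewrite -natr1 mulrDl mul1r sinD IH sinpi; ring.
by case: k => n; rewrite ?NegzE ?mulrNz ?mulNr ?sinN -?pmulrn h ?oppr0.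
Qed.
Lemma cexpZ2pi k (x : R) : cexp (k%:~R * (x + 2 * pi)) = cexp (k%:~R * x).
Proof.
rewrite mulrDr cexpD; suff -> : cexp (k%:~R * (2 * pi)) = 1 :> R[i] by rewrite mulr1.
have -> : k%:~R * (2 * pi) = k%:~R * pi + k%:~R * pi by ring.
rewrite /cexp cosD sinD sin_Mpi !(mul0r, mulr0) addr0 subr0 -expr2.
by have := cos2Dsin2 (k%:~R * pi); rewrite sin_Mpi expr0n addr0 => ->.
Qed.

Lemma is_derive_sinw (w x : R) : is_derive x 1 (fun y => sin (w * y)) (w * cos (w * x)).
Proof.
have h := is_derive1_comp (is_derive_sin (w * x)) (is_deriveZ w (is_derive_id x 1)).
by apply: is_derive_eq; rewrite mulrC; congr (_ * _); rewrite /GRing.scale /= mulr1.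
Qed.
Lemma is_derive_cosw (w x : R) : is_derive x 1 (fun y => cos (w * y)) (- (w * sin (w * x))).
Proof.
have h := is_derive1_comp (is_derive_cos (w * x)) (is_deriveZ w (is_derive_id x 1)).
by apply: is_derive_eq; rewrite /GRing.scale /= mulr1; ring.
Qed.
Lemma continuous_cosw (w : R) : continuous (fun y : R => cos (w * y)).
Proof.
move=> x; apply: (@continuous_comp _ _ _ (fun x => w * x)).
  exact: mulrl_continuous. exact: continuous_cos.
Qed.
Lemma continuous_sinw (w : R) : continuous (fun y : R => sin (w * y)).
Proof.
move=> x; apply: (@continuous_comp _ _ _ (fun x => w * x)).
  exact: mulrl_continuous. exact: continuous_sin.
Qed.

Lemma intT_cexp k : intT (fun x => cexp (k%:~R * x)) = (k == 0)%:R :> R[i].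
Proof.
have [->|k0] := eqVneq k 0.
  have -> : (fun x => cexp (0%:~R * x)) = (fun=> 1) :> (R -> R[i]).
    by apply/funext => x; rewrite mul0r cexp0.
  rewrite /intT; apply: complexP; rewrite !reimE /= ?(mul0r, mulr0); last first.
    by rewrite rint_cst ?(ltW Npi_lt_pi)// mul0r mulr0 add0r.
  by have := RintT_cst 1; rewrite /RintT => ->; rewrite subr0.
have kR : k%:~R != 0 :> R by rewrite intr_eq0.
rewrite /intT; suff -> : cint (- pi) pi (fun x => cexp (k%:~R * x)) = 0 by rewrite mulr0.
have dS (x : R) : is_derive x (1 : R) (fun x => k%:~R^-1 * sin (k%:~R * x)) (cos (k%:~R * x)).
  have h := is_deriveZ (k%:~R^-1) (is_derive_sinw k%:~R x).
  by apply: is_derive_eq; rewrite /GRing.scale /= mulrA mulVf// mul1r.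
have dC (x : R) : is_derive x (1 : R) (fun x => - k%:~R^-1 * cos (k%:~R * x)) (sin (k%:~R * x)).
  have h := is_deriveZ (- k%:~R^-1) (is_derive_cosw k%:~R x).
  by apply: is_derive_eq; rewrite /GRing.scale /= mulrNN mulrA mulVf// mul1r.
apply: complexP => /=.
- have -> := rint_derive Npi_lt_pi dS (@continuous_cosw _).
  by rewrite mulrN sinN sin_Mpi oppr0 mulr0 subrr.
- have -> := rint_derive Npi_lt_pi dC (@continuous_sinw _).
  by rewrite mulrN cosN subrr.
Qed.

Lemma fourierD f g k : L1T f -> L1T g ->
  fourier (fun x => f x + g x) k = fourier f k + fourier g k.
Proof.
move=> hf hg; rewrite /fourier -intTD; try exact: L1T_ftest.
by congr intT; apply/funext => x; rewrite mulrDl.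
Qed.
Lemma fourierB f g k : L1T f -> L1T g ->
  fourier (fun x => f x - g x) k = fourier f k - fourier g k.
Proof.
move=> hf hg; rewrite /fourier -intTB; try exact: L1T_ftest.
by congr intT; apply/funext => x; rewrite mulrBl.
Qed.
Lemma fourierZ (c : R[i]) f k : L1T f -> fourier (fun x => c * f x) k = c * fourier f k.
Proof.
move=> hf; rewrite /fourier -intTZ; last exact: L1T_ftest.
by congr intT; apply/funext => x; rewrite mulrA.
Qed.
Lemma fourier_sum I (s : seq I) (F : I -> R -> R[i]) k : (forall i, L1T (F i)) ->
  fourier (fun x => \sum_(i <- s) F i x) k = \sum_(i <- s) fourier (F i) k.
Proof.
move=> h; rewrite /fourier -intT_sum; last by move=> i; apply: L1T_ftest.
by congr intT; apply/funext => x; rewrite mulr_suml.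
Qed.
Lemma fourier_ae f g k : cmeas f -> cmeas g ->
  {ae mu, forall x, x \in `[- pi, pi] -> f x = g x} -> fourier f k = fourier g k.
Proof.
have mc : cmeas (fun x : R => cexp (- (k%:~R * x))).
  by have := cmeas_cexp (- k%:~R : R); under eq_fun do rewrite mulNr.
move=> mf mg fg; apply: intT_ae; try exact: cmeasM.
by apply: ae_mono fg => x h /h ->.
Qed.
Lemma fourierMexp f m k : fourier (fun x => f x * cexp (m%:~R * x)) k = fourier f (k - m).
Proof.
congr intT; apply/funext => x; rewrite -mulrA -cexpD; congr (_ * cexp _).
by rewrite intrB; ring.
Qed.
Lemma fourier_cexp m k : fourier (fun x => cexp (m%:~R * x)) k = (k == m)%:R :> R[i].
Proof.
rewrite /fourier (_ : intT _ = intT (fun x => cexp ((m - k)%:~R * x))).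
  by rewrite intT_cexp subr_eq0 eq_sym.
congr intT; apply/funext => x; rewrite -cexpD; congr cexp; rewrite intrB; ring.
Qed.
Lemma fourier_cst (c : R[i]) k : fourier (fun=> c) k = c * (k == 0)%:R.
Proof.
rewrite -(fourier_cexp 0 k) -fourierZ; last exact: L1T_cexp.
by congr (fourier _ k); apply/funext => x; rewrite mul0r cexp0 mulr1.
Qed.
Lemma fourier_conj f k : L1T f -> fourier (fun x => (f x)^*) k = (fourier f (- k))^*.
Proof.
move=> hf; rewrite /fourier -intT_conj; last exact: L1T_ftest.
congr intT; apply/funext => x; rewrite mulrNz mulNr opprK.
by apply: complexP; rewrite !reimE /= cosN sinN; ring.
Qed.
Lemma nc_fourier f (G : R -> R) k : L1T f -> rintg (- pi) pi G ->
  (forall x, x \in `[- pi, pi] -> nc (f x) <= G x) -> nc (fourier f k) <= 2 * RintT G.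
Proof.
move=> hf hG fG; apply: nc_intT => //; first exact: L1T_ftest.
by move=> x /fG; rewrite ncM nc_cexp mulr1.
Qed.

Lemma fourier0 f : fourier f 0 = intT f.
Proof.
by congr intT; apply/funext => x; rewrite mul0r oppr0 cexp0 mulr1.
Qed.

End FourierBasics.

(** * Uniqueness of Fourier coefficients *)

Section Uniqueness.
Context {R : realType}.
Implicit Types (f g T : R -> R[i]) (k m : int).
Local Notation mu := (@lebesgue_measure R).
Local Notation pi := (@pi R).

Definition ann f := L1T f /\ forall k, fourier f k = 0.
(** Multipliers that preserve [ann]. They form an algebra containing the exponentials, hence all
    trigonometric polynomials, and no expansion of powers such as those in [step] is ever
    required. *)
Definition trig T := forall f, ann f -> ann (fun x => f x * T x).

Lemma trigM T1 T2 : trig T1 -> trig T2 -> trig (fun x => T1 x * T2 x).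
Proof. by move=> h1 h2 f /h1/h2; under eq_fun do rewrite -mulrA. Qed.
Lemma trigD T1 T2 : trig T1 -> trig T2 -> trig (fun x => T1 x + T2 x).
Proof.
move=> h1 h2 f hf; have [a1 b1] := h1 _ hf; have [a2 b2] := h2 _ hf.
under eq_fun do rewrite mulrDr; split; first exact: L1TD.
by move=> k; rewrite fourierD// b1 b2 addr0.
Qed.
Lemma trigC (c : R[i]) : trig (fun=> c).
Proof.
move=> f [a b]; under eq_fun do rewrite mulrC; split; first exact: L1TZ.
by move=> k; rewrite fourierZ// b mulr0.
Qed.
Lemma trigX T n : trig T -> trig (fun x => T x ^+ n).
Proof.
move=> h; elim: n => [|n IH]; first exact: trigC.
by under eq_fun do rewrite exprS; exact: trigM.
Qed.
Lemma trig_cexp m : trig (fun x => cexp (m%:~R * x)).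
Proof. by move=> f [a b]; split=> [|k]; [exact: L1TMexp|rewrite fourierMexp b]. Qed.

Lemma sinBE (x a : R) : (sin (x - a))%:C =
  (- (2^-1)%:C * 'i * cexp (- a)) * cexp (1%:~R * x) +
  ((2^-1)%:C * 'i * cexp a) * cexp ((-1)%:~R * x).
Proof.
rewrite mul1r mulrNz mulN1r -!mulrA -!cexpD.
apply: complexP; rewrite !reimE /= sinB !sinD !cosD !cosN !sinN; field => //.
Qed.
Lemma sinBE2 (x b : R) : (sin (b - x))%:C = (-1)%:C * (sin (x - b))%:C.
Proof. by rewrite -rmorphM /= mulN1r -sinN opprB. Qed.

Lemma trig_sinB (a : R) : trig (fun x => (sin (x - a))%:C).
Proof.
under eq_fun do rewrite sinBE.
by apply: trigD; apply: trigM; [exact: trigC|exact: trig_cexp|exact: trigC|exact: trig_cexp].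
Qed.
Lemma trig_sinB2 (b : R) : trig (fun x => (sin (b - x))%:C).
Proof. under eq_fun do rewrite sinBE2; apply: trigM; [exact: trigC|exact: trig_sinB]. Qed.

(* An approximate indicator of [y < 1/2] on [0, 1]. With y = (1 + cos) / 2 it gives
   trigonometric polynomials converging boundedly to the indicator of a half circle,
   and products of two of them to the indicator of an arc. *)
Definition step (n : nat) (y : R) : R := (1 - y ^+ n) ^+ (2 ^ n).

Lemma bernoulli_ge (t : R) n : -1 <= t -> 1 + n%:R * t <= (1 + t) ^+ n.
Proof.
move=> t1; elim: n => [|n IH]; first by rewrite mul0r addr0 expr0.
rewrite exprS; apply: (@le_trans _ _ ((1 + t) * (1 + n%:R * t))).
  rewrite -natr1; have : 0 <= n%:R * t ^+ 2 by rewrite mulr_ge0// sqr_ge0.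
  nra.
by apply: ler_wpM2l => //; lra.
Qed.

Lemma step_bound n (y : R) : 0 <= y <= 1 -> 0 <= step n y <= 1.
Proof.
move=> /andP[y0 y1]; have h : 0 <= y ^+ n <= 1 by rewrite exprn_ge0//= exprn_ile1.
by rewrite /step exprn_ge0 ?exprn_ile1; lra.
Qed.

(** Bernoulli's inequality gives [step n y >= 1 - (2 * y) ^+ n], and here 2y < 1. *)
Lemma step_lt (y : R) : 0 <= y < 1/2 -> step ^~ y @ \oo --> (1 : R).
Proof.
move=> /andP[y0 y2].
have : (fun n => 1 - (2 * y) ^+ n) @ \oo --> (1 - 0 : R).
  apply: cvgB; first exact: cvg_cst.
  by apply: cvg_expr; rewrite ger0_norm; lra.
rewrite subr0 => h; apply: (squeeze_cvgr _ h (@cvg_cst _ _ _ _ _)).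
apply: nearW => n; have /andP[_ ->] := @step_bound n y ltac:(lra).
rewrite andbT /step exprMn -natrX -mulrN; apply: bernoulli_ge.
have : y ^+ n <= 1 by rewrite exprn_ile1//; lra.
lra.
Qed.

(** Bernoulli's inequality bounds (1 + y^n)^(2^n) below by (2y)^n, while its product with [step n y]
    is (1 - y^(2n))^(2^n), at most 1. Hence [step n y] is at most (2y)^(-n). *)
Lemma step_gt (y : R) : 1/2 < y <= 1 -> step ^~ y @ \oo --> (0 : R).
Proof.
move=> /andP[y0 y2].
have y2' : 1 < 2 * y by lra.
have : (fun n => (2 * y)^-1 ^+ n) @ \oo --> (0 : R).
  by apply: cvg_expr; rewrite ger0_norm ?invr_ge0 ?invf_lt1; lra.
move=> h; apply: (squeeze_cvgr _ (@cvg_cst _ _ _ _ _) h).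
apply: nearW => n; have /andP[-> _] := @step_bound n y ltac:(lra).
rewrite /= /step exprVn -[leRHS]mul1r ler_pdivlMr; last by rewrite exprn_gt0//; lra.
have h1 : (2 * y) ^+ n <= (1 + y ^+ n) ^+ (2 ^ n).
  apply: (@le_trans _ _ (1 + (2 ^ n)%:R * y ^+ n)).
    by rewrite exprMn -natrX lerDr.
  apply: bernoulli_ge; have : 0 <= y ^+ n by rewrite exprn_ge0//; lra.
  lra.
have yn : 0 <= y ^+ n <= 1 by rewrite exprn_ge0 ?exprn_ile1//; lra.
apply: (@le_trans _ _ ((1 - y ^+ n) ^+ (2 ^ n) * (1 + y ^+ n) ^+ (2 ^ n))).
  by apply: ler_wpM2l => //; rewrite exprn_ge0//; lra.
rewrite -exprMn exprn_ile1//; nra.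
Qed.

(** The first sine is positive on the half circle that follows a, the second on the half circle that
    precedes b; (1 - sin) / 2 is below 1/2 exactly there. *)
Definition arc (a b : R) (n : nat) (x : R) : R :=
  step n ((1 - sin (x - a)) / 2) * step n ((1 - sin (b - x)) / 2).

Lemma trig_step T n : trig (fun x => (T x)) -> trig (fun x => (1 - T x ^+ n) ^+ (2 ^ n)).
Proof.
move=> h; apply: trigX; apply: trigD; first exact: trigC.
under eq_fun do rewrite -mulN1r; apply: trigM; first exact: trigC.
exact: trigX.
Qed.
Lemma trig_arc a b n : trig (fun x => (arc a b n x)%:C).
Proof.
rewrite /arc /step; under eq_fun do rewrite rmorphM /=.
have h (T : R -> R) : trig (fun x => (T x)%:C) -> trig (fun x => ((1 - ((1 - T x) / 2) ^+ n) ^+ (2 ^ n))%:C).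
  move=> hT; under eq_fun do rewrite rmorphXn rmorphB rmorphXn rmorphM rmorphB /=.
  apply: (@trig_step (fun x => (1 - (T x)%:C) * (2^-1)%:C)).
  apply: trigM; last exact: trigC.
  apply: trigD; first exact: trigC.
  by under eq_fun do rewrite -mulN1r; apply: trigM; first exact: trigC.
by apply: trigM; apply: h; [exact: trig_sinB|exact: trig_sinB2].
Qed.

Lemma sinhalf (t : R) : 0 <= (1 - sin t) / 2 <= 1.
Proof. by have := sin_le1 t; have := sin_geN1 t; lra. Qed.

Lemma arc_bound a b n x : 0 <= arc a b n x <= 1.
Proof.
have /andP[h1 h2] := step_bound n (sinhalf (x - a)).
have /andP[h3 h4] := step_bound n (sinhalf (b - x)).
by rewrite /arc mulr_ge0//= mulr_ile1.
Qed.

Lemma arc_in a b x : b - a < pi -> a < x < b -> arc a b ^~ x @ \oo --> (1 : R).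
Proof.
move=> ba /andP[ax xb].
have s1 : 0 < sin (x - a) by apply: sin_gt0_pi; lra.
have s2 : 0 < sin (b - x) by apply: sin_gt0_pi; lra.
rewrite -[1]mulr1; apply: cvgM; apply: step_lt.
  by have := sinhalf (x - a); lra.
by have := sinhalf (b - x); lra.
Qed.

Lemma sin_ltN (t : R) : (- pi < t < 0) || (pi < t < 2 * pi) -> sin t < 0.
Proof.
case/orP => h.
- by rewrite -oppr_gt0 -sinN; apply: sin_gt0_pi; lra.
- have -> : sin t = - sin (t - pi) by rewrite sinB cospi sinpi; ring.
  by rewrite oppr_lt0; apply: sin_gt0_pi; lra.
Qed.

(** Outside [a, b] one of the two sines is negative. If x < a, either x - a lies in ]-pi, 0[, or x
    is so far from a that b - x lies in ]pi, 2 pi[; the case b < x is symmetric. *)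
Lemma arc_out a b x : - pi < a -> a < b -> b < pi -> b - a < pi ->
  - pi <= x <= pi -> x < a \/ b < x -> arc a b ^~ x @ \oo --> (0 : R).
Proof.
move=> pa ab bp ba /andP[xp px] hx; have p0 := pi_gt0 R.
have key (u v : nat -> R) : (forall n, 0 <= u n <= 1) -> (forall n, 0 <= v n <= 1) ->
    u @ \oo --> (0 : R) \/ v @ \oo --> (0 : R) -> (fun n => u n * v n) @ \oo --> (0 : R).
  move=> hu hv [h|h]; apply: (squeeze_cvgr _ (@cvg_cst _ _ _ _ _) h); apply: nearW => n;
    have := hu n; have := hv n; nra.
apply: key => [n|n|]; try by apply: step_bound; exact: sinhalf.
suff [h|h] : sin (x - a) < 0 \/ sin (b - x) < 0.
- by left; apply: step_gt; have := sinhalf (x - a); lra.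
- by right; apply: step_gt; have := sinhalf (b - x); lra.
case: hx => hx.
- have [h|h] := ltP (- pi) (x - a); first by left; apply: sin_ltN; lra.
  by right; apply: sin_ltN; lra.
- have [h|h] := ltP (- pi) (b - x); first by right; apply: sin_ltN; lra.
  by left; apply: sin_ltN; lra.
Qed.

Lemma ann_real_arc f a b n : ann f ->
  \int[mu]_(x in `[- pi, pi]) (Re (f x) * arc a b n x) = 0 /\
  \int[mu]_(x in `[- pi, pi]) (Im (f x) * arc a b n x) = 0.
Proof.
move=> /(trig_arc a b n) [_ /(_ 0)]; rewrite fourier0 /intT => h.
have := congr1 (fun z => (2 * pi)%:C * z) h; rewrite mulr0 mulrA -rmorphM /=.
rewrite divff ?gt_eqF ?pi2_gt0// mul1r => -[h1 h2]; split.
  rewrite -[RHS]h1; apply: eq_Rintegral => x _; rewrite !reimE /=; ring.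
rewrite -[RHS]h2; apply: eq_Rintegral => x _; rewrite !reimE /=; ring.
Qed.

(** Dominated convergence with dominant |h|. The limit of [arc] at the endpoints a and b is not
    known, but these form a null set. *)
Lemma rint_arc_cvg (h : R -> R) a b : measurable_fun setT h -> rintg (- pi) pi h ->
  (forall n, measurable_fun setT (arc a b n)) ->
  - pi < a -> a < b -> b < pi -> b - a < pi ->
  (fun n => \int[mu]_(x in `[- pi, pi]) (h x * arc a b n x)) @ \oo -->
    \int[mu]_(x in `]a, b[) h x.
Proof.
move=> mh ih marc pa ab bp ba.
pose D : set R := `[- pi, pi]%classic; pose P : set R := `]a, b[%classic.
have mD : measurable D by exact: measurable_itv.
have mP : measurable P by exact: measurable_itv.
have DP : `]a, b[%classic = D `&` P.
  apply/seteqP; split => x /=; rewrite /D /P /= !in_itv /=; last by case.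
  by move=> h0; split => //; lra.
have ihP : mu.-integrable D (EFin \o (h \_ P)).
  rewrite -restrict_EFin; apply/integrable_restrict => //.
  apply: integrableS (ih : mu.-integrable D _) => //.
  exact: measurableI.
have ae1 : {ae mu, forall x, x != a /\ x != b}.
  exists [set a; b]; split => //.
  - by apply: measurableU.
  - by apply: countable_lebesgue_measure0; apply: finite_set_countable.
  - move=> x /=; rewrite not_andE => -[] /negP; rewrite negbK => /eqP ->; [by left|by right].
have mf n : measurable_fun D (fun x => (h x * arc a b n x)%:E).
  by apply/measurable_EFinP; apply: measurable_funTS; exact: measurable_funM (marc n).
have cf : {ae mu, forall x, D x ->
    (fun n => (h x * arc a b n x)%:E) @ \oo --> ((EFin \o (h \_ P)) x)}.
  apply: ae_mono ae1 => x [xa xb] Dx; apply/fine_cvgP; split; first exact: nearW.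
  rewrite /= patchE; case: ifPn => [|].
  - rewrite inE /P /= in_itv /= => h1.
    by rewrite -[X in _ --> X]mulr1; apply: cvgM; [exact: cvg_cst|exact: arc_in].
  - rewrite notin_setE /P /= in_itv /= => h1.
    suff : (fun n => h x * arc a b n x) @ \oo --> h x * 0 by rewrite mulr0.
    apply: cvgM; [exact: cvg_cst|].
    apply: arc_out => //; case: (ltgtP x a) xa => // [|ax] _; first by left.
    case: (ltgtP x b) xb => // [xb|] _; last by right.
    by exfalso; apply: h1; rewrite ax xb.
have df : {ae mu, forall x n, D x -> (`|(h x * arc a b n x)%:E| <= `|(h x)%:E|)%E}.
  apply: aeW => x n Dx; rewrite lee_fin normrM.
  have /andP[p1 p2] := arc_bound a b n x.
  by rewrite (ger0_norm p1) ler_piMr.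
have [_ _ cv] := @dominated_convergence _ _ _ mu D mD _ _ _ mf (measurable_int _ ihP) cf (integrable_abse ih) df.
rewrite DP Rintegral_mkcondr.
apply: (@fine_cvg _ _ _ _ (fun n => (\int[mu]_(x in D) (h x * arc a b n x)%:E)%E)).
rewrite fineK//; apply: integrable_fin_num => //.
Qed.

Lemma measurable_arc a b n : measurable_fun setT (arc a b n).
Proof.
have ms (c : R) : measurable_fun setT (fun x : R => sin (x - c)).
  apply: continuous_measurable_fun => x; apply: continuous_comp; last exact: continuous_sin.
  by apply: cvgB; [exact: cvg_id|exact: cvg_cst].
have h (g : R -> R) : measurable_fun setT g -> measurable_fun setT (fun x : R => step n ((1 - g x) / 2)).
  move=> mg; apply: measurable_funX; apply: measurable_funB; first exact: measurable_cst.
  apply: measurable_funX; apply: measurable_funM; last exact: measurable_cst.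
  by apply: measurable_funB => //; exact: measurable_cst.
apply: measurable_funM; apply: h => //.
under eq_fun do rewrite -opprB sinN; apply: measurableT_comp => //.
Qed.

(** The primitive of h, cut off outside the period, is locally constant in the interior, so its
    derivative vanishes there; by Lebesgue differentiation this derivative is h almost everywhere.
    Short intervals suffice because the argument is local. *)
Lemma zero_integrals_ae0 (h : R -> R) : measurable_fun setT h -> rintg (- pi) pi h ->
  (forall a b, - pi < a -> a < b -> b < pi -> b - a < pi ->
     \int[mu]_(x in `]a, b[) h x = 0) ->
  {ae mu, forall x, x \in `[- pi, pi] -> h x = 0}.
Proof.
move=> mh ih h0.
pose D : set R := `[- pi, pi]%classic.
have mD : measurable D by exact: measurable_itv.
pose g := h \_ D.
have ig : mu.-integrable setT (EFin \o g).
  by rewrite -restrict_EFin; apply/integrable_restrict => //; rewrite setTI.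
have igS (A : set R) : measurable A -> mu.-integrable A (EFin \o g).
  by move=> mA; apply: integrableS ig.
have lg : locally_integrable [set: R] g.
  by have := integrable_locally measurableT ig; rewrite patch_setT.
pose F y := \int[mu]_(t in `]-oo, y]) g t.
have hF : {ae mu, forall x, derivable F x 1 /\ derive1 F x = g x}.
  exact: FTC1Ny (fun y => igS _ (measurable_itv _)) lg.
have ae1 : {ae mu, forall x, x != pi /\ x != - pi}.
  exists [set pi; - pi]; split => //.
  - by apply: measurableU.
  - by apply: countable_lebesgue_measure0; apply: finite_set_countable.
  - move=> x /=; rewrite not_andE => -[] /negP; rewrite negbK => /eqP ->; [by left|by right].
have cF u v : - pi < u -> u < v -> v < pi -> v - u < pi -> F v = F u.
  move=> pu uv vp vu; apply/eqP; rewrite -subr_eq0; apply/eqP.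
  rewrite /F Rintegral_itvB ?bnd_simp ?ltW//; last exact: igS.
  rewrite -Rintegral_itv_bndo_bndc; last exact: igS.
  rewrite -(h0 u v)//; apply: eq_Rintegral => z; rewrite inE /= in_itv /= => zuv.
  by rewrite /g patchE mem_set// /D /= in_itv /=; lra.
apply: ae_mono (ae_and hF ae1) => x [[_ dF] [xp1 xp2]] xD.
have {xp1 xp2} xpi : - pi < x < pi.
  by move: xD; rewrite in_itv /= => /andP[h1 h2]; rewrite !lt_neqAle h1 h2 xp1 eq_sym xp2.
have -> : h x = g x by rewrite /g patchE mem_set.
rewrite -dF derive1E (@near_eq_derive _ _ _ F (cst (F x))) ?derive_cst//.
have d1 : 0 < x + pi by lra.
have d2 : 0 < pi - x by lra.
near=> y; rewrite /cst.
have : `|x - y| < x + pi by near: y; apply/nbhs_normP; exists (x + pi).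
have : `|x - y| < pi - x by near: y; apply/nbhs_normP; exists (pi - x).
rewrite !ltr_norml => y2 y1.
case: (ltgtP x y) => [xy|yx|->//].
  by apply: cF => //; lra.
by apply/esym; apply: cF => //; lra.
Unshelve. all: by end_near.
Qed.

Lemma fourier_eq0 f : L1T f -> (forall k, fourier f k = 0) ->
  {ae mu, forall x, x \in `[- pi, pi] -> f x = 0}.
Proof.
move=> [[m1 m2] [i1 i2]] h.
have hf : ann f by [].
have key (u : R -> R) : measurable_fun setT u -> rintg (- pi) pi u ->
    (forall a b n, \int[mu]_(x in `[- pi, pi]) (u x * arc a b n x) = 0) ->
    {ae mu, forall x, x \in `[- pi, pi] -> u x = 0}.
  move=> mu' iu hu; apply: zero_integrals_ae0 => // a b pa ab bp ba.
  have := rint_arc_cvg mu' iu (measurable_arc a b) pa ab bp ba.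
  under eq_fun do rewrite hu.
  by move/cvg_lim => <- //; rewrite lim_cst.
have r1 := key _ m1 i1 (fun a b n => (ann_real_arc a b n hf).1).
have r2 := key _ m2 i2 (fun a b n => (ann_real_arc a b n hf).2).
apply: ae_mono (ae_and r1 r2) => x [h1 h2] xD.
by apply: complexP; rewrite ?h1 ?h2.
Qed.

End Uniqueness.

(** * Absolutely convergent Fourier series, products and weak derivatives *)

Section FourierSeries.
Context {R : realType}.
Implicit Types (f g eta : R -> R[i]) (k m : int) (c : int -> R[i]).
Local Notation mu := (@lebesgue_measure R).
Local Notation pi := (@pi R).

Definition asum c (B : R) := sumle (fun k => nc (c k)) B.
Definition fpart c n (x : R) := \sum_(k <- zl n) c k * cexp (k%:~R * x).
Definition fser c (x : R) : R[i] := clim (fun n => fpart c n x).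

Lemma asum_exp c B x : asum c B -> asum (fun k => c k * cexp (k%:~R * x)) B.
Proof. by apply: sumle_mono => // k; rewrite ncM nc_cexp mulr1. Qed.
Lemma fser_cvg c B x : asum c B -> ccvg (fun n => fpart c n x) (fser c x).
Proof. by move=> /(asum_exp x) /zl_sum_ccvg. Qed.
Lemma fser_tail c B : asum c B -> forall e : R, 0 < e -> exists N, forall n x, (N <= n)%N ->
  nc (fser c x - fpart c n x) <= e.
Proof.
move=> h e e0; have [N hN] := sumle_tail (fun k => nc_ge0 _) h e0.
exists N => n x Nn; apply: (ccvg_dist (N := n) (fser_cvg x h)) => m nm.
rewrite /fpart (big_zl_split _ nm) addrAC subrr add0r.
apply: (le_trans (nc_sum _ _ _)); under eq_bigr do rewrite ncM nc_cexp mulr1.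
apply: hN => [|k]; first by rewrite filter_uniq// zl_uniq.
by rewrite mem_filter => /andP[h1 _]; apply: leq_ltn_trans h1.
Qed.
Lemma fser_bound c B x : asum c B -> nc (fser c x) <= B.
Proof.
move=> h; apply: (ccvg_le (fser_cvg x h)) => n; apply: (le_trans (nc_sum _ _ _)).
by apply: (asum_exp x h); exact: zl_uniq.
Qed.
Lemma L1T_fpart c n : L1T (fpart c n).
Proof. by apply: L1T_sum => k; apply: L1TZ; exact: L1T_cexp. Qed.
Lemma cmeas_fser c B : asum c B -> cmeas (fser c).
Proof.
move=> h; split.
- apply: (measurable_fun_cvg (h := fun n x => Re (fpart c n x))) => [n|x _].
    by have [[]] := L1T_fpart c n.
  by have /ccvgP[] := fser_cvg x h.
- apply: (measurable_fun_cvg (h := fun n x => Im (fpart c n x))) => [n|x _].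
    by have [[]] := L1T_fpart c n.
  by have /ccvgP[] := fser_cvg x h.
Qed.
Lemma L1T_fser c B : asum c B -> L1T (fser c).
Proof.
move=> h; apply: (L1T_bounded (B := B)); first exact: cmeas_fser h.
by move=> x _; exact: fser_bound.
Qed.
Lemma fourier_fpart c n k : fourier (fpart c n) k = if (absz k <= n)%N then c k else 0.
Proof.
rewrite fourier_sum; last by move=> l; apply: L1TZ; exact: L1T_cexp.
have e l : fourier (fun x => c l * cexp (l%:~R * x)) k = c l * (k == l)%:R.
  by rewrite fourierZ ?fourier_cexp//; exact: L1T_cexp.
under eq_bigr do rewrite e.
rewrite -mem_zl; case: ifPn => kz.
  rewrite (bigD1_seq k) ?zl_uniq//= eqxx mulr1 big1 ?addr0// => l lk.
  by rewrite eq_sym (negbTE lk) mulr0.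
rewrite big_seq big1// => l lz; case: eqP => [kl|]; last by rewrite mulr0.
by move: kz; rewrite kl lz.
Qed.
Lemma fourier_fser c B k : asum c B -> fourier (fser c) k = c k.
Proof.
move=> h; apply: (@ccvg_unique _ (fun n => fourier (fpart c n) k)).
  move=> e e0; have [N hN] := fser_tail h (divr_gt0 e0 (ltr0Sn R 1)).
  exists N => n Nn; rewrite -fourierB; [|exact: L1T_fpart|exact: L1T_fser h].
  apply: (le_trans (@nc_fourier _ _ (fun=> e / 2) _ _ _ _)).
  - by apply: L1TB; [exact: L1T_fpart|exact: L1T_fser h].
  - exact: rintg_cst.
  - by move=> x _; rewrite ncBC hN.
  - by rewrite RintT_cst; lra.
apply: (@ccvg_near _ _ _ (absz k)) => n kn.
by rewrite fourier_fpart kn.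
Qed.
Lemma fser_periodic c : periodicT (fser c).
Proof.
move=> x; rewrite /fser; congr clim; apply/funext => n; apply: eq_bigr => k _.
by rewrite cexpZ2pi.
Qed.
Lemma L2T_bounded f (B : R) : periodicT f -> cmeas f -> (forall x, nc (f x) <= B) -> L2T f.
Proof.
move=> pf [m1 m2] fB; split => //.
have : rintg (- pi) pi (fun x => nc (f x) ^+ 2).
  apply: (rintg_le _ (rintg_cst _ _ (B ^+ 2))).
    by apply: measurable_funTS; apply: measurable_funX; exact: cmeas_nc.
  move=> x _; rewrite ger0_norm ?sqr_ge0// ler_pXn2r ?nnegrE ?nc_ge0//.
  by apply: le_trans (fB 0); exact: nc_ge0.
move=> /integrableP[_]; apply: le_lt_trans; rewrite le_eqVlt; apply/orP; left; apply/eqP.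
by apply: eq_integral => x _ /=; rewrite ger0_norm// sqr_ge0.
Qed.
Lemma L2T_fser c B : asum c B -> L2T (fser c).
Proof.
move=> h; apply: (L2T_bounded (B := B)); first exact: fser_periodic.
- exact: cmeas_fser h.
- by move=> x; exact: fser_bound.
Qed.

(** The Wiener algebra, up to modification on null sets: by [Wien_ae] such a function agrees a.e.
    with its absolutely convergent series. *)
Definition Wien f := L1T f /\ exists B, asum (fourier f) B.

Lemma Wien_fser c B : asum c B -> Wien (fser c).
Proof.
move=> h; split; first exact: L1T_fser h.
by exists B; have -> : fourier (fser c) = c by apply/funext => k; exact: fourier_fser h.
Qed.
Lemma Wien_ae f : Wien f -> {ae mu, forall x, x \in `[- pi, pi] -> f x = fser (fourier f) x}.
Proof.
move=> [hf [B hB]]; have hs := L1T_fser hB.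
have : {ae mu, forall x, x \in `[- pi, pi] -> f x - fser (fourier f) x = 0}.
  apply: fourier_eq0; first exact: L1TB.
  by move=> k; rewrite fourierB// (fourier_fser _ hB) subrr.
by apply: ae_mono => x h /h /eqP; rewrite subr_eq0 => /eqP.
Qed.

Lemma WienM_L1T f g : Wien f -> L1T g -> L1T (fun x => f x * g x).
Proof.
move=> hf hg; have [[mf _] [B hB]] := hf; have [mg _] := hg.
have h : L1T (fun x => fser (fourier f) x * g x).
  apply: (L1TM (B := B)) => //; first exact: cmeas_fser hB.
  by move=> x _; exact: fser_bound.
apply: ae_L1T h; first exact: cmeasM.
by apply: ae_mono (Wien_ae hf) => x h /h ->.
Qed.
(** The convolution theorem, with only one factor in the Wiener algebra. The partial sums of that
    factor converge uniformly, so multiplication by an integrable g and passage to the limit are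
    both harmless. *)
Lemma fourierM_cvg f g k : Wien f -> L1T g ->
  ccvg (fun n => \sum_(l <- zl n) fourier f l * fourier g (k - l)) (fourier (fun x => f x * g x) k).
Proof.
move=> hf hg; have [[mf _] [B hB]] := hf; have [mg ig] := hg.
have hfg := WienM_L1T hf hg.
have hP n : L1T (fun x => fpart (fourier f) n x * g x).
  apply: (L1TM (B := B)) => //; first by have [] := L1T_fpart (fourier f) n.
  move=> x _; apply: (le_trans (nc_sum _ _ _)).
  by apply: (asum_exp x hB); exact: zl_uniq.
have -> : (fun n => \sum_(l <- zl n) fourier f l * fourier g (k - l)) =
          (fun n => fourier (fun x => fpart (fourier f) n x * g x) k).
  apply/funext => n.
  have -> : (fun x => fpart (fourier f) n x * g x) =
      (fun x => \sum_(l <- zl n) fourier f l * (g x * cexp (l%:~R * x))).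
    apply/funext => x; rewrite /fpart mulr_suml; apply: eq_bigr => l _.
    by rewrite -!mulrA [cexp _ * _]mulrC.
  have hl l : L1T (fun x => g x * cexp (l%:~R * x)) by exact: L1TMexp.
  rewrite fourier_sum => [|l]; last exact: L1TZ.
  by apply: eq_bigr => l _; rewrite fourierZ// fourierMexp.
move=> e e0.
pose G := RintT (fun x => nc (g x)).
have G0 : 0 <= G.
  rewrite /G /RintT mulr_ge0 ?invr_ge0 ?(ltW pi2_gt0)//.
  by apply: Rintegral_ge0 => x _; exact: nc_ge0.
have d0 : 0 < e / (2 * G + 1) by rewrite divr_gt0//; lra.
have [N hN] := fser_tail hB d0.
have ign : rintg (- pi) pi (fun x => nc (g x)) by exact: rintg_nc.
exists N => n Nn; rewrite -fourierB//.
have -> : fourier (fun x => fpart (fourier f) n x * g x - f x * g x) k =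
   fourier (fun x => (fpart (fourier f) n x - fser (fourier f) x) * g x) k.
  apply: fourier_ae.
  - by have [] := L1TB (hP n) hfg.
  - apply: cmeasM => //; apply: cmeasB; last exact: cmeas_fser hB.
    by have [] := L1T_fpart (fourier f) n.
  - by apply: ae_mono (Wien_ae hf) => x h /h ->; rewrite mulrBl.
apply: (le_trans (@nc_fourier _ _ (fun x => e / (2 * G + 1) * nc (g x)) _ _ _ _)).
- apply: (L1TM (B := e / (2 * G + 1))) => //.
    apply: cmeasB; last exact: cmeas_fser hB.
    by have [] := L1T_fpart (fourier f) n.
  by move=> x _; rewrite ncBC hN.
- exact: rintgZ.
- by move=> x _; rewrite ncM ler_wpM2r ?nc_ge0// ncBC hN.
- rewrite RintTZ// -/G mulrCA mulrAC ler_pdivrMr; nra.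
Qed.

Lemma is_derive_cder (u : R -> R) x : derivable u x 1 -> is_derive x (1 : R) u (derive1 u x).
Proof. by move=> du; rewrite derive1E; exact: derivableP. Qed.

Lemma smoothT_cont eta : smoothT eta ->
  [/\ continuous (fun y => Re (eta y)), continuous (fun y => Im (eta y)),
      continuous (derive1 (fun y => Re (eta y))) & continuous (derive1 (fun y => Im (eta y)))].
Proof.
move=> [_ h]; split => x; apply: differentiable_continuous; apply/derivable1_diffP.
- exact: (h 0%N x).1.
- exact: (h 0%N x).2.
- exact: (h 1%N x).1.
- exact: (h 1%N x).2.
Qed.
Lemma L1T_continuous f : continuous (fun y => Re (f y)) -> continuous (fun y => Im (f y)) -> L1T f.
Proof.
move=> c1 c2; split; first by split; exact: continuous_measurable_fun.
by split; apply: rintg_continuous; exact: continuous_subspaceT.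
Qed.
Lemma L1T_smooth eta : smoothT eta -> L1T eta /\ L1T (cderive eta).
Proof.
by move=> /smoothT_cont [? ? ? ?]; split; exact: L1T_continuous.
Qed.

(** Integration by parts. [D1] and [D2] differentiate the real and imaginary parts of eta(x)
    e^(-ikx), whose values at pi and -pi agree by periodicity. *)
Lemma fourier_cderive eta k : smoothT eta -> fourier (cderive eta) k = 'i * k%:~R * fourier eta k.
Proof.
move=> hs; have [c1 c2 d1 d2] := smoothT_cont hs; have [ie id] := L1T_smooth hs.
have [pe h] := hs.
pose a y := Re (eta y); pose b y := Im (eta y).
have da x : is_derive x (1 : R) a (derive1 a x) by apply: is_derive_cder; exact: (h 0%N x).1.
have db x : is_derive x (1 : R) b (derive1 b x) by apply: is_derive_cder; exact: (h 0%N x).2.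
pose w : R := k%:~R.
have D1 x : is_derive x (1 : R) (fun y => a y * cos (w * y) + b y * sin (w * y))
   (derive1 a x * cos (w * x) - w * a x * sin (w * x) + derive1 b x * sin (w * x) + w * b x * cos (w * x)).
  have p1 := is_deriveM (da x) (is_derive_cosw w x).
  have p2 := is_deriveM (db x) (is_derive_sinw w x).
  have p3 := is_deriveD p1 p2.
  by apply: is_derive_eq; rewrite /GRing.scale /=; ring.
have D2 x : is_derive x (1 : R) (fun y => b y * cos (w * y) - a y * sin (w * y))
   (derive1 b x * cos (w * x) - w * b x * sin (w * x) - derive1 a x * sin (w * x) - w * a x * cos (w * x)).
  have p1 := is_deriveM (db x) (is_derive_cosw w x).
  have p2 := is_deriveM (da x) (is_derive_sinw w x).
  have p3 := is_deriveB p1 p2.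
  by apply: is_derive_eq; rewrite /GRing.scale /=; ring.
have cw1 := @continuous_cosw R w; have cw2 := @continuous_sinw R w.
have cM (u v : R -> R) : continuous u -> continuous v -> continuous (fun x => u x * v x).
  by move=> hu hv x; apply: cvgM; [exact: hu|exact: hv].
have cD (u v : R -> R) : continuous u -> continuous v -> continuous (fun x => u x + v x).
  by move=> hu hv x; apply: cvgD; [exact: hu|exact: hv].
have cB (u v : R -> R) : continuous u -> continuous v -> continuous (fun x => u x - v x).
  by move=> hu hv x; apply: cvgB; [exact: hu|exact: hv].
have cc : continuous (fun _ : R => w) by move=> x; exact: cvg_cst.
have pp : a pi = a (- pi) /\ b pi = b (- pi).
  have := pe (- pi); have -> : - pi + 2 * pi = pi by ring.
  by move=> e; rewrite /a /b e.
have ca : continuous (fun x => a x) := c1.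
have cb : continuous (fun x => b x) := c2.
have ca' : continuous (fun x => derive1 a x) := d1.
have cb' : continuous (fun x => derive1 b x) := d2.
have e1 := rint_derive Npi_lt_pi D1 (cD _ _ (cD _ _ (cB _ _ (cM _ _ ca' cw1)
  (cM _ _ (cM _ _ cc ca) cw2)) (cM _ _ cb' cw2)) (cM _ _ (cM _ _ cc cb) cw1)).
have e2 := rint_derive Npi_lt_pi D2 (cB _ _ (cB _ _ (cB _ _ (cM _ _ cb' cw1)
  (cM _ _ (cM _ _ cc cb) cw2)) (cM _ _ ca' cw2)) (cM _ _ (cM _ _ cc ca) cw1)).
apply/eqP; rewrite -subr_eq0 -fourierZ// -fourierB//; last exact: L1TZ.
rewrite /fourier /intT; apply/eqP.
suff -> : cint (- pi) pi (fun x => (cderive eta x - 'i * k%:~R * eta x) * cexp (- (k%:~R * x))) = 0.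
  by rewrite mulr0.
have rk : k%:~R = w%:C :> R[i] by rewrite /w rmorph_int.
apply: complexP; rewrite cintE /=.
- rewrite -[RHS](subrr (a pi * cos (w * pi) + b pi * sin (w * pi))).
  have -> : a pi * cos (w * pi) + b pi * sin (w * pi) - (a pi * cos (w * pi) + b pi * sin (w * pi)) =
     a pi * cos (w * pi) + b pi * sin (w * pi) - (a (- pi) * cos (w * - pi) + b (- pi) * sin (w * - pi)).
    by rewrite !mulrN cosN sinN !pp.1 !pp.2 sin_Mpi; ring.
  rewrite -e1; apply: eq_Rintegral => x _; rewrite rk !reimE /= -/w cosN sinN -/(a x) -/(b x); ring.
- rewrite -[RHS](subrr (b pi * cos (w * pi) - a pi * sin (w * pi))).
  have -> : b pi * cos (w * pi) - a pi * sin (w * pi) - (b pi * cos (w * pi) - a pi * sin (w * pi)) =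
     b pi * cos (w * pi) - a pi * sin (w * pi) - (b (- pi) * cos (w * - pi) - a (- pi) * sin (w * - pi)).
    by rewrite !mulrN cosN sinN !pp.1 !pp.2 sin_Mpi; ring.
  rewrite -e2; apply: eq_Rintegral => x _; rewrite rk !reimE /= -/w cosN sinN -/(a x) -/(b x); ring.
Qed.

Lemma derive1n_trig (w a b : R) n : exists a' b' : R,
  derive1n n (fun y : R => a * cos (w * y) + b * sin (w * y)) =
  (fun y => a' * cos (w * y) + b' * sin (w * y)).
Proof.
elim: n => [|n [a' [b' IH]]]; first by exists a, b.
exists (b' * w), (- (a' * w)); rewrite derive1nS IH; apply/funext => x; rewrite derive1E.
have p1 := is_deriveZ a' (is_derive_cosw w x).
have p2 := is_deriveZ b' (is_derive_sinw w x).
have p3 := is_deriveD p1 p2.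
have /@derive_val -> := p3.
by rewrite /GRing.scale /=; ring.
Qed.
Lemma derivable_trig (w a b : R) n x :
  derivable (derive1n n (fun y : R => a * cos (w * y) + b * sin (w * y))) x 1.
Proof.
have [a' [b' ->]] := derive1n_trig w a b n.
have p1 := is_deriveZ a' (is_derive_cosw w x).
have p2 := is_deriveZ b' (is_derive_sinw w x).
by have [] := is_deriveD p1 p2.
Qed.
Lemma smoothT_cexp k : smoothT (fun x : R => cexp (- (k%:~R * x))).
Proof.
split => [x|n x]; first by rewrite -!mulNr -mulrNz cexpZ2pi.
rewrite /cexp /=; split.
- rewrite (_ : (fun y : R => _) = (fun y => 1 * cos (k%:~R * y) + 0 * sin (k%:~R * y))).
    exact: derivable_trig.
  by apply/funext => y; rewrite cosN; ring.
- rewrite (_ : (fun y : R => _) = (fun y => 0 * cos (k%:~R * y) + (-1) * sin (k%:~R * y))).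
    exact: derivable_trig.
  by apply/funext => y; rewrite sinN; ring.
Qed.
Lemma cderive_cexp k (x : R) : cderive (fun x : R => cexp (- (k%:~R * x))) x =
  - ('i * k%:~R) * cexp (- (k%:~R * x)).
Proof.
have rk : k%:~R = (k%:~R : R)%:C :> R[i] by rewrite rmorph_int.
rewrite /cderive /cexp /=; apply: complexP; rewrite rk !reimE /= cosN sinN.
- under eq_fun do rewrite cosN.
  rewrite derive1E; have /@derive_val -> := is_derive_cosw k%:~R x; ring.
- under eq_fun do rewrite sinN.
  rewrite derive1E; have /@derive_val -> := is_deriveN (is_derive_sinw k%:~R x); ring.
Qed.

(** Both integrals are zeroth coefficients of products, that is, limits of convolution sums; these
    agree term by term since passing from l to -l changes the sign of the factor il. *)
Lemma weak_deriv_fser f B1 B : L1T f -> asum (fourier f) B1 ->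
  asum (fun k => 'i * k%:~R * fourier f k) B ->
  weak_deriv f (fser (fun k => 'i * k%:~R * fourier f k)).
Proof.
move=> hf h1 h; split; first exact: L2T_fser h.
move=> eta heta; have [ie id] := L1T_smooth heta.
have Wf : Wien f by split => //; exists B1.
have Wg := Wien_fser h.
have e1 := fourierM_cvg 0 Wf id; have e2 := fourierM_cvg 0 Wg ie.
rewrite !fourier0 in e1 e2.
apply: (ccvg_unique e1); have := ccvgN e2; apply: (ccvg_eq (N := 0%N)) => n _.
rewrite -sumrN; apply: eq_bigr => l _; rewrite fourier_cderive// (fourier_fser _ h) sub0r.
by rewrite mulrNz; ring.
Qed.

Lemma weak_deriv_fourier f g k : L1T f -> weak_deriv f g -> fourier g k = 'i * k%:~R * fourier f k.
Proof.
move=> hf [hg h]; have := h _ (smoothT_cexp k).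
move=> /(congr1 (fun z => - z)); rewrite opprK => e; rewrite [LHS]/fourier -e.
rewrite -fourierZ// /fourier -mulN1r -intTZ; last first.
  under eq_fun do rewrite cderive_cexp mulrCA; apply: L1TZ; exact: L1T_ftest.
by congr intT; apply/funext => x; rewrite cderive_cexp; ring.
Qed.

(** [dx] is a choice among weak derivatives, so one must be exhibited; the differentiated Fourier
    series is one. *)
Lemma dx_weak f B1 B : L1T f -> asum (fourier f) B1 ->
  asum (fun k => 'i * k%:~R * fourier f k) B -> weak_deriv f (dx f).
Proof.
by move=> hf h1 h2; apply: (xgetPex (fun=> 0)); eexists; exact: weak_deriv_fser h1 h2.
Qed.

End FourierSeries.

Arguments fourier {R} f k : simpl never.
Arguments ComplexField.Normc.normc {R} x : simpl never.

(** * Sobolev spaces and the nonlinearity *)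

Section Sobolev.
Context {R : realType}.
Implicit Types (f g : R -> R[i]) (j k l m : int) (c : int -> R[i]) (s t : R).
Local Notation mu := (@lebesgue_measure R).
Local Notation pi := (@pi R).

(** Equivalent to the square root of 1 + k^2, by [w_sqr_le] and [le_w_sqr], but submultiplicative
    without a constant. *)
Definition w k : R := 1 + `|k%:~R|.

Lemma w_ge1 k : 1 <= w k. Proof. by rewrite /w lerDl. Qed.
Lemma w_gt0 k : 0 < w k. Proof. exact: lt_le_trans ltr01 (w_ge1 k). Qed.
Lemma wN k : w (- k) = w k. Proof. by rewrite /w mulrNz normrN. Qed.
Lemma wD k l : w (k + l) <= w k + w l.
Proof. by rewrite /w intrD; have := ler_normD (k%:~R : R) l%:~R; lra. Qed.
Lemma wM k l : w (k + l) <= w k * w l.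
Proof.
rewrite /w intrD; have := ler_normD (k%:~R : R) l%:~R.
have := normr_ge0 (k%:~R : R); have := normr_ge0 (l%:~R : R); nra.
Qed.
Lemma abs_w k : `|k%:~R| <= w k. Proof. by rewrite /w lerDr. Qed.
Lemma w_nat (n : nat) : w n%:Z = n.+1%:R.
Proof. by rewrite /w -pmulrn ger0_norm// nat1r. Qed.
Lemma wX_gt0 k s : 0 < w k `^ s. Proof. exact: powR_gt0 (w_gt0 k). Qed.
Lemma wX_ge0 k s : 0 <= w k `^ s. Proof. exact: powR_ge0. Qed.
Lemma wXD k s t : w k `^ (s + t) = w k `^ s * w k `^ t.
Proof. by rewrite powRD//; apply/implyP => _; rewrite gt_eqF// w_gt0. Qed.
Lemma wXN k s : w k `^ (- s) * w k `^ s = 1.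
Proof. by rewrite -wXD addNr powRr0. Qed.
Lemma wX1 k : w k `^ 1 = w k. Proof. by rewrite powRr1// ltW// w_gt0. Qed.
Lemma wX_mono k s t : s <= t -> w k `^ s <= w k `^ t.
Proof. exact: (ler_powR (w_ge1 k)). Qed.
Lemma wX_sqr k s : (w k `^ s) ^+ 2 = w k `^ (2 * s).
Proof. by rewrite -powR_mulrn ?powR_ge0// -powRrM mulrC. Qed.
Lemma wX_ge1 k s : 0 <= s -> 1 <= w k `^ s.
Proof. by move=> s0; rewrite -(powRr0 (w k)); apply: wX_mono. Qed.
Lemma wX_peetre k l s : 0 <= s -> w k `^ s <= w (k - l) `^ s * w l `^ s.
Proof.
move=> s0; rewrite -powRM ?(ltW (w_gt0 _))//.
apply: ge0_ler_powR; rewrite ?nnegrE ?mulr_ge0 ?(ltW (w_gt0 _))//.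
by rewrite -{1}(subrK l k); exact: wM.
Qed.

Lemma sum_sub_zl (F : int -> R) (r : seq int) n : (forall k, 0 <= F k) -> uniq r ->
  (forall k, k \in r -> (absz k <= n)%N) -> \sum_(k <- r) F k <= \sum_(k <- zl n) F k.
Proof.
move=> F0 ur hr.
rewrite [leRHS](bigID (mem r)) /= -[leLHS]addr0 lerD ?sumr_ge0//.
rewrite -[leRHS]big_filter le_eqVlt; apply/orP; left; apply/eqP.
apply: perm_big; apply: uniq_perm => //; first by rewrite filter_uniq// zl_uniq.
by move=> k; rewrite mem_filter mem_zl; case: (boolP (k \in r)) => [/hr ->|].
Qed.
Lemma sumle_zl (F : int -> R) B : (forall k, 0 <= F k) ->
  (forall n, \sum_(k <- zl n) F k <= B) -> sumle F B.
Proof.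
move=> F0 h r ur; apply: le_trans (h (\max_(k <- r) absz k)%N).
by apply: sum_sub_zl => // k kr; apply: leq_bigmax_seq.
Qed.
Lemma big_zlS (F : int -> R) n :
  \sum_(k <- zl n.+1) F k = \sum_(k <- zl n) F k + (F n.+1%:Z + F (- n.+1%:Z)).
Proof.
rewrite (big_zl_split _ (leqnSn n)); congr (_ + _).
have -> : F n.+1%:Z + F (- n.+1%:Z) = \sum_(k <- [:: n.+1%:Z; - n.+1%:Z]) F k.
  by rewrite !big_cons big_nil addr0.
apply: perm_big; apply: uniq_perm; first by rewrite filter_uniq// zl_uniq.
  by rewrite cons_uniq mem_seq1 /=; lia.
by move=> k; rewrite mem_filter mem_zl !inE; lia.
Qed.

(** This replaces the integral test for the sum of y^(-1-e). It follows from ln(1 - 1/y) <= -1/y and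
    exp x >= 1 + x. *)
Lemma powRN_telescope (e y : R) : 0 < e -> 1 < y ->
  e * y `^ (- (1 + e)) <= (y - 1) `^ (- e) - y `^ (- e).
Proof.
move=> e0 y1; have y0 : 0 < y by lra.
have y10 : 0 < y - 1 by lra.
have -> : y `^ (- (1 + e)) = y^-1 * y `^ (- e).
  rewrite opprD powRD ?powR_inv1 ?(ltW y0)//.
  by apply/implyP => _; rewrite gt_eqF.
have -> : (y - 1) `^ (- e) = expR (- e * (ln (y - 1) - ln y)) * y `^ (- e).
  by rewrite /powR !gt_eqF// -expRD; congr expR; ring.
rewrite mulrA -[X in _ <= _ - X]mul1r -mulrBl ler_wpM2r ?powR_ge0//.
apply: (@le_trans _ _ (- e * (ln (y - 1) - ln y))); last first.
  by rewrite lerBrDl expR_ge1Dx.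
have : ln ((y - 1) / y) <= - y^-1.
  have -> : (y - 1) / y = 1 + - y^-1 by rewrite mulrBl divff ?gt_eqF// mul1r.
  by apply: le_ln1Dx; rewrite ltrN2 invf_lt1.
rewrite ln_div ?posrE// => h; rewrite mulNr -mulrN ler_pM2l//; lra.
Qed.

Lemma sumle_w t : 1 < t -> exists Z, sumle (fun k => w k `^ (- t)) Z.
Proof.
move=> t1; pose e := t - 1; have e0 : 0 < e by rewrite /e; lra.
exists (1 + 2 / e); apply: sumle_zl => [k|n]; first exact: wX_ge0.
(* The bound is strengthened by the term that telescopes, so that the induction on n closes; the
   factor 2 accounts for the two signs of k. *)
apply: (@le_trans _ _ (1 + 2 / e * (1 - n.+1%:R `^ (- e)))); last first.
  by rewrite lerD2l ler_piMr ?divr_ge0 ?(ltW e0)// lerBlDr lerDl powR_ge0.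
elim: n => [|n IH].
  by rewrite powR1 subrr mulr0 addr0 (_ : zl 0 = [:: 0])// big_seq1 /w normr0 addr0 powR1.
rewrite big_zlS wN w_nat.
have := @powRN_telescope e n.+2%:R e0 ltac:(by rewrite ltr1n).
have -> : n.+2%:R - 1 = n.+1%:R :> R by rewrite -natr1 addrK.
have -> : 1 + e = t by rewrite /e; ring.
move: IH; move: (n.+2%:R `^ (- t)) (n.+2%:R `^ (- e)) (n.+1%:R `^ (- e)) (\sum_(_ <- _) _).
move=> a b c' S IH h.
have h2 : 2 * a <= 2 / e * (c' - b).
  rewrite mulrAC ler_pdivlMr//; move: h; nra.
have -> : 1 + 2 / e * (1 - b) = 1 + 2 / e * (1 - c') + 2 / e * (c' - b) by ring.
lra.
Qed.

Lemma sum_CS I (r : seq I) (a b : I -> R) : (forall i, 0 <= a i) -> (forall i, 0 <= b i) ->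
  (\sum_(i <- r) a i * b i) ^+ 2 <= (\sum_(i <- r) a i ^+ 2) * (\sum_(i <- r) b i ^+ 2).
Proof.
move=> a0 b0; elim: r => [|i r]; first by rewrite !big_nil expr0n mul0r.
rewrite !big_cons.
have : 0 <= \sum_(j <- r) a j * b j by apply: sumr_ge0 => j _; rewrite mulr_ge0.
have : 0 <= \sum_(j <- r) a j ^+ 2 by apply: sumr_ge0 => j _; rewrite sqr_ge0.
have : 0 <= \sum_(j <- r) b j ^+ 2 by apply: sumr_ge0 => j _; rewrite sqr_ge0.
move: (a i) (b i) (a0 i) (b0 i) => x y x0 y0.
set X := \sum_(j <- r) b j ^+ 2; set C := \sum_(j <- r) a j ^+ 2.
set S := \sum_(j <- r) a j * b j => X0 C0 S0 IH.
(* The cross term of the expanded square: by induction S^2 <= C X, and the claim is the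
   arithmetic-geometric inequality for C y^2 and x^2 X. *)
have h : 2 * (S * (x * y)) <= C * y ^+ 2 + x ^+ 2 * X.
  rewrite -ler_sqr ?nnegrE; last 2 first.
  - by rewrite !mulr_ge0.
  - by rewrite addr_ge0 ?mulr_ge0 ?sqr_ge0.
  have h1 : 0 <= (C * y ^+ 2 - x ^+ 2 * X) ^+ 2 by exact: sqr_ge0.
  have h2 : 0 <= (C * X - S ^+ 2) * (x * y) ^+ 2.
    by apply: mulr_ge0; [rewrite subr_ge0|exact: sqr_ge0].
  lra.
lra.
Qed.

(** Integrability and an H^s bound on the coefficients, with neither periodicity nor a chosen norm:
    a quantitative form of [Hs] that is convenient for sums, products and limits. *)
Definition Hbd s f (M : R) := [/\ L1T f, 0 <= M &
  sumle (fun k => (w k `^ s * nc (fourier f k)) ^+ 2) (M ^+ 2)].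

Lemma Hbd_mono s t f M N : s <= t -> M <= N -> Hbd t f M -> Hbd s f N.
Proof.
move=> st MN [h1 h2 h3]; split=> //; first exact: le_trans MN.
apply: sumle_mono h3 => [k|]; last by rewrite ler_pXn2r ?nnegrE// (le_trans h2).
rewrite ler_pXn2r ?nnegrE ?mulr_ge0 ?nc_ge0 ?wX_ge0//.
by rewrite ler_wpM2r ?nc_ge0// wX_mono.
Qed.
Lemma Hbd_wpt s f M k : Hbd s f M -> w k `^ s * nc (fourier f k) <= M.
Proof.
move=> [_ M0 /sumle_pt h]; by rewrite -ler_sqr ?nnegrE ?mulr_ge0 ?nc_ge0 ?wX_ge0.
Qed.
Lemma Hbd_pt s f M k : Hbd s f M -> nc (fourier f k) <= M * w k `^ (- s).
Proof.
move=> /(Hbd_wpt k) h; rewrite powRN ler_pdivlMr ?wX_gt0// mulrC//.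
Qed.
Lemma AMGM (x y : R) : x * y <= x ^+ 2 + y ^+ 2.
Proof. by have := sqr_ge0 (x - y); have := sqr_ge0 (x + y); lra. Qed.

(** With xy <= x^2 + y^2 in place of Cauchy-Schwarz the bound is a sum instead of a product; all
    that matters is that Z does not depend on f. *)
Lemma Hbd_asum s t : t + 1/2 < s -> exists Z, forall f M, Hbd s f M ->
  sumle (fun k => w k `^ t * nc (fourier f k)) (Z + M ^+ 2).
Proof.
move=> st; have [Z hZ] := @sumle_w (2 * (s - t)) ltac:(lra).
exists Z => f M [_ _ h]; apply: sumle_mono (sumleD hZ h) => // k.
have -> : - (2 * (s - t)) = 2 * (t - s) by ring.
rewrite -wX_sqr; apply: le_trans (AMGM _ _); rewrite mulrA -wXD.
by apply: eqW; congr (w k `^ _ * _); ring.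
Qed.
Lemma Hbd_Wien s f M : 1/2 < s -> Hbd s f M -> Wien f.
Proof.
move=> s2 hf; have [Z hZ] := @Hbd_asum s 0 ltac:(lra); have [h1 _ _] := hf.
split=> //; exists (Z + M ^+ 2); apply: sumle_mono (hZ _ _ hf) => // k.
by rewrite powRr0 mul1r.
Qed.

Lemma ccvg_nc (u : nat -> R[i]) (l : R[i]) : ccvg u l -> (fun n => nc (u n)) @ \oo --> nc l.
Proof.
move=> h; apply/cvgrPdist_le => e /h [N hN]; exists N => // n /= /hN hn.
rewrite ler_distl; have := ncD (u n) (l - u n); have := ncD l (u n - l).
have -> : u n + (l - u n) = l by ring.
have -> : l + (u n - l) = u n by ring.
rewrite (ncBC l (u n)) => h1 h2; apply/andP; split; lra.
Qed.

(** A Fatou-type statement on finite lists: it transfers bounds uniform in the truncation of a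
    convolution to its limit. *)
Lemma sum_ccvg_le (r : seq int) (a : int -> R) (u : int -> nat -> R[i]) (l : int -> R[i]) B :
  (forall k, ccvg (u k) (l k)) ->
  (forall n, \sum_(k <- r) (a k * nc (u k n)) ^+ 2 <= B) ->
  \sum_(k <- r) (a k * nc (l k)) ^+ 2 <= B.
Proof.
move=> hu hB.
have cv : (fun n => \sum_(k <- r) (a k * nc (u k n)) ^+ 2) @ \oo --> \sum_(k <- r) (a k * nc (l k)) ^+ 2.
  elim: r {hB} => [|k r IH].
    by rewrite big_nil; under eq_fun do rewrite big_nil; exact: cvg_cst.
  rewrite big_cons; under eq_fun do rewrite big_cons; apply: cvgD => //.
  have h : (fun n => a k * nc (u k n)) @ \oo --> a k * nc (l k).
    by apply: cvgM; [exact: cvg_cst|exact: ccvg_nc].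
  by rewrite expr2; under eq_fun do rewrite expr2; exact: cvgM.
by apply: (cvgr_to_le cv); apply: nearW.
Qed.

Lemma wX_sum k l s : 0 <= s -> w k `^ s <= 2 `^ s * (w (k - l) `^ s + w l `^ s).
Proof.
move=> s0.
have h : w k <= 2 * Num.max (w (k - l)) (w l).
  have := wD (k - l) l; rewrite subrK => h; apply: (le_trans h).
  have : w (k - l) <= Num.max (w (k - l)) (w l) by rewrite le_max lexx.
  have : w l <= Num.max (w (k - l)) (w l) by rewrite le_max lexx orbT.
  lra.
have m0 : 0 <= Num.max (w (k - l)) (w l) by rewrite le_max ltW ?w_gt0.
have k0 := ltW (w_gt0 k).
apply: (@le_trans _ _ ((2 * Num.max (w (k - l)) (w l)) `^ s)).
  by apply: ge0_ler_powR; rewrite ?nnegrE ?mulr_ge0.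
rewrite powRM// ler_wpM2l ?powR_ge0//.
have := wX_ge0 (k - l) s; have := wX_ge0 l s.
by rewrite /Num.max; case: ifP => _; lra.
Qed.

(** H^s is an algebra for s > 1/2. The weight w(k)^s is split over the two factors by [wX_sum], and
    Cauchy-Schwarz is applied with the weights w^(-s), which are square summable. *)
Lemma Hbd_mul s : 1/2 < s -> exists2 K, 0 <= K & forall f g M N, Hbd s f M -> Hbd s g N ->
  Hbd s (fun x => f x * g x) (K * M * N).
Proof.
move=> s2; have s0 : 0 <= s by lra.
have [Z hZ] := @sumle_w (2 * s) ltac:(lra).
have Z0 := sumle_ge0 hZ.
have hZ2 : sumle (fun k => (w k `^ (- s)) ^+ 2) Z.
  by apply: sumle_mono hZ => // k; rewrite wX_sqr mulrN.
exists (2 * 2 `^ s * (1 + Z)); first by rewrite !mulr_ge0 ?powR_ge0//; lra.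
move=> f g M N hf hg.
have Wf := Hbd_Wien s2 hf; have [lf M0 Sf] := hf; have [lg N0 Sg] := hg.
split; first exact: WienM_L1T.
  by rewrite !mulr_ge0 ?powR_ge0//; lra.
move=> r ur.
apply: (sum_ccvg_le (fun k => fourierM_cvg k Wf lg)) => n.
pose F l := nc (fourier f l); pose G l := nc (fourier g l).
pose A l := w l `^ s * F l; pose B l := w l `^ s * G l.
have A0 l : 0 <= A l by rewrite mulr_ge0 ?nc_ge0 ?wX_ge0.
have B0 l : 0 <= B l by rewrite mulr_ge0 ?nc_ge0 ?wX_ge0.
have pt k : (w k `^ s * nc (\sum_(l <- zl n) fourier f l * fourier g (k - l))) ^+ 2 <=
    (2 `^ s) ^+ 2 * (4 * Z) * \sum_(l <- zl n) (A l ^+ 2 * B (k - l) ^+ 2).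
  have h1 : w k `^ s * nc (\sum_(l <- zl n) fourier f l * fourier g (k - l)) <=
     2 `^ s * \sum_(l <- zl n) (w (k - l) `^ (- s) + w l `^ (- s)) * (A l * B (k - l)).
    apply: (@le_trans _ _ (w k `^ s * \sum_(l <- zl n) F l * G (k - l))).
      rewrite ler_wpM2l ?wX_ge0//; apply: (le_trans (nc_sum _ _ _)).
      by apply: ler_sum => l _; rewrite ncM.
    rewrite !mulr_sumr; apply: ler_sum => l _.
    apply: (@le_trans _ _ (2 `^ s * (w (k - l) `^ s + w l `^ s) * (F l * G (k - l)))).
      by rewrite ler_wpM2r ?mulr_ge0 ?nc_ge0// wX_sum.
    rewrite -mulrA ler_wpM2l ?powR_ge0//.
    apply: eqW; rewrite /A /B.
    have e1 := wXN (k - l) s; have e2 := wXN l s.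
    move: e1 e2; move: (w (k - l) `^ s) (w l `^ s) (w (k - l) `^ (- s)) (w l `^ (- s)).
    move=> p q p' q' e1 e2.
    have -> : (p' + q') * (q * F l * (p * G (k - l))) =
      (p' * p) * q * (F l * G (k - l)) + (q' * q) * p * (F l * G (k - l)) by ring.
    rewrite e1 e2; ring.
  have h0 : 0 <= \sum_(l <- zl n) (w (k - l) `^ (- s) + w l `^ (- s)) * (A l * B (k - l)).
    by apply: sumr_ge0 => l _; apply: mulr_ge0; [rewrite addr_ge0 ?wX_ge0|exact: mulr_ge0].
  apply: (@le_trans _ _ ((2 `^ s * \sum_(l <- zl n) (w (k - l) `^ (- s) + w l `^ (- s)) * (A l * B (k - l))) ^+ 2)).
    by rewrite ler_pXn2r ?nnegrE ?mulr_ge0 ?nc_ge0 ?wX_ge0 ?powR_ge0.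
  rewrite exprMn -mulrA ler_wpM2l ?sqr_ge0//.
  apply: (le_trans (sum_CS _ _ _)) => [l|l|]; [by rewrite addr_ge0 ?wX_ge0|by rewrite mulr_ge0|].
  have -> : \sum_(l <- zl n) (A l * B (k - l)) ^+ 2 = \sum_(l <- zl n) (A l ^+ 2 * B (k - l) ^+ 2).
    by apply: eq_bigr => l _; rewrite exprMn.
  rewrite ler_wpM2r//; first by apply: sumr_ge0 => l _; rewrite mulr_ge0 ?sqr_ge0.
  apply: (@le_trans _ _ (\sum_(l <- zl n) (2 * (w (k - l) `^ (- s)) ^+ 2 + 2 * (w l `^ (- s)) ^+ 2))).
    by apply: ler_sum => l _; have := sqr_ge0 (w (k - l) `^ (- s) - w l `^ (- s)); lra.
  rewrite big_split /= -!mulr_sumr.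
  have i1 : \sum_(l <- zl n) (w (k - l) `^ (- s)) ^+ 2 <= Z.
    apply: (@sumle_inj _ _ _ (fun l => k - l) _ hZ2); last exact: zl_uniq.
    by move=> a b /addrI /oppr_inj.
  have i2 := hZ2 _ (zl_uniq n).
  lra.
apply: (@le_trans _ _ (\sum_(k <- r) (2 `^ s) ^+ 2 * (4 * Z) * \sum_(l <- zl n) (A l ^+ 2 * B (k - l) ^+ 2))).
  by apply: ler_sum => k _.
rewrite -mulr_sumr exchange_big /=.
apply: (@le_trans _ _ ((2 `^ s) ^+ 2 * (4 * Z) * (M ^+ 2 * N ^+ 2))).
  rewrite ler_wpM2l ?mulr_ge0 ?sqr_ge0//.
  apply: (@le_trans _ _ (\sum_(l <- zl n) A l ^+ 2 * N ^+ 2)).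
    apply: ler_sum => l _; rewrite -mulr_sumr ler_wpM2l ?sqr_ge0//.
    apply: (@sumle_inj _ _ _ (fun k => k - l) _ Sg); last exact: ur.
    by move=> a b /addIr.
  by rewrite -mulr_suml ler_wpM2r ?sqr_ge0//; apply: Sf; exact: zl_uniq.
have -> : (2 * 2 `^ s * (1 + Z) * M * N) ^+ 2 = (2 `^ s) ^+ 2 * (4 * (1 + Z) ^+ 2) * (M ^+ 2 * N ^+ 2) by ring.
rewrite ler_wpM2r ?mulr_ge0 ?sqr_ge0// ler_wpM2l ?sqr_ge0//.
nra.
Qed.

(** The constant comes from (a + b)^2 <= 2 a^2 + 2 b^2 applied termwise, which avoids Minkowski's
    inequality. *)
Lemma HbdD s f g M N : Hbd s f M -> Hbd s g N -> Hbd s (fun x => f x + g x) (2 * (M + N)).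
Proof.
move=> [lf M0 Sf] [lg N0 Sg]; split; [exact: L1TD|by rewrite mulr_ge0 ?addr_ge0|].
apply: sumle_mono (sumleD (sumleZ (ltac:(lra) : 0 <= 2 :> R) Sf) (sumleZ (ltac:(lra) : 0 <= 2 :> R) Sg)) => [k|]; last nra.
rewrite fourierD//.
apply: (@le_trans _ _ ((w k `^ s * nc (fourier f k) + w k `^ s * nc (fourier g k)) ^+ 2)).
  have h : w k `^ s * nc (fourier f k + fourier g k) <=
      w k `^ s * nc (fourier f k) + w k `^ s * nc (fourier g k).
    by rewrite -[leRHS]mulrDr ler_wpM2l ?wX_ge0// ncD.
  by rewrite ler_pXn2r ?nnegrE ?addr_ge0 ?mulr_ge0 ?nc_ge0 ?wX_ge0.
by have := sqr_ge0 (w k `^ s * nc (fourier f k) - w k `^ s * nc (fourier g k)); lra.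
Qed.
Lemma HbdZ s f M (a : R[i]) : Hbd s f M -> Hbd s (fun x => a * f x) (nc a * M).
Proof.
move=> [lf M0 Sf]; split; [exact: L1TZ|by rewrite mulr_ge0 ?nc_ge0|].
rewrite exprMn; apply: sumle_mono (sumleZ (sqr_ge0 (nc a)) Sf) => // k.
by rewrite fourierZ// ncM -exprMn mulrCA.
Qed.
Lemma Hbd_cst s (a : R[i]) : Hbd s (fun=> a) (nc a).
Proof.
split; [exact: L1T_cst|exact: nc_ge0|] => r ur.
have z k : k != 0 -> (w k `^ s * nc (fourier (fun=> a) k)) ^+ 2 = 0.
  by move=> k0; rewrite fourier_cst (negbTE k0) mulr0 nc0 mulr0 expr0n.
have e0 : fourier (fun=> a) 0 = a by rewrite fourier_cst eqxx mulr1.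
have [r0|r0] := boolP (0 \in r); last first.
  rewrite big_seq big1 ?sqr_ge0// => k kr; apply: z.
  by apply: contraNneq r0 => <-.
rewrite (bigD1_seq 0)//= big1 => [|k]; last exact: z.
by rewrite addr0 e0 /w normr0 addr0 powR1 mul1r.
Qed.
Lemma eq_Hbd s f g M : (forall k, fourier g k = fourier f k) -> L1T g -> Hbd s f M -> Hbd s g M.
Proof. by move=> fg lg [_ M0 Sf]; split => //; apply: sumle_mono Sf => // k; rewrite fg. Qed.

Lemma sumle_esum (F : int -> R) : (forall k, 0 <= F k) ->
  (\esum_(k in [set: int]) (F k)%:E < +oo)%E ->
  sumle F (fine (\esum_(k in [set: int]) (F k)%:E)).
Proof.
move=> F0 h r ur; rewrite -lee_fin fineK; last first.
  by rewrite ge0_fin_numE// esum_ge0// => k _; rewrite lee_fin.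
apply: esum_ge; exists [set` r]; first by split => //; exact: finite_seq.
by rewrite -fsbig_seq// -sumEFin.
Qed.
Lemma esum_sumle (F : int -> R) B : sumle F B -> (\esum_(k in [set: int]) (F k)%:E <= B%:E)%E.
Proof.
move=> h; apply: ge_ereal_sup => _ /= [X [finX _] <-].
have [r ->] := (finite_seqP X).1 finX.
have -> : [set` r] = [set` undup r].
  by apply/seteqP; split => k /=; rewrite mem_undup.
by rewrite -fsbig_seq ?undup_uniq// sumEFin lee_fin h// undup_uniq.
Qed.

Lemma w_sqr_le k : w k ^+ 2 <= 2 * (1 + k%:~R ^+ 2).
Proof.
rewrite /w; have : `|k%:~R| ^+ 2 = k%:~R ^+ 2 :> R by rewrite real_normK ?num_real.
have := sqr_ge0 (1 - `|k%:~R| : R); nra.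
Qed.
Lemma le_w_sqr k : 1 + k%:~R ^+ 2 <= w k ^+ 2.
Proof.
rewrite /w; have : `|k%:~R| ^+ 2 = k%:~R ^+ 2 :> R by rewrite real_normK ?num_real.
have := normr_ge0 (k%:~R : R); nra.
Qed.
Lemma wX_Hs k s : 0 <= s -> (w k `^ s) ^+ 2 <= 2 `^ s * (1 + k%:~R ^+ 2) `^ s.
Proof.
move=> s0; have p : 0 <= 1 + k%:~R ^+ 2 :> R by rewrite addr_ge0 ?sqr_ge0.
rewrite wX_sqr powRrM powR_mulrn ?(ltW (w_gt0 _))// -powRM//.
apply: ge0_ler_powR; rewrite ?nnegrE ?sqr_ge0//; last exact: w_sqr_le.
by rewrite mulr_ge0.
Qed.
Lemma Hs_wX k s : 0 <= s -> (1 + k%:~R ^+ 2) `^ s <= (w k `^ s) ^+ 2.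
Proof.
move=> s0; have p : 0 <= 1 + k%:~R ^+ 2 :> R by rewrite addr_ge0 ?sqr_ge0.
rewrite wX_sqr powRrM powR_mulrn ?(ltW (w_gt0 _))//.
by apply: ge0_ler_powR; rewrite ?nnegrE ?sqr_ge0// le_w_sqr.
Qed.

(** The factor 2^(s/2) is the price of the inequality w(k)^2 <= 2 (1 + k^2). *)
Lemma Hs_Hbd s f : 0 <= s -> Hs s f -> Hbd s f (2 `^ (s / 2) * Hs_norm s f).
Proof.
move=> s0 [hf hn]; have lf := L2T_L1T hf.
split=> //; first by rewrite mulr_ge0 ?powR_ge0 ?sqrtr_ge0.
have F0 k : 0 <= (1 + (k%:~R : R) ^+ 2) `^ s * nc (fourier f k) ^+ 2.
  by rewrite mulr_ge0 ?powR_ge0 ?sqr_ge0.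
have h := sumle_esum F0 hn.
rewrite exprMn -powR_mulrn ?powR_ge0// -powRrM mulfVK// sqr_sqrtr; last first.
  by rewrite fine_ge0// esum_ge0// => k _; rewrite lee_fin.
apply: sumle_mono (sumleZ (powR_ge0 2 s) h) => // k.
by rewrite exprMn mulrA ler_wpM2r ?sqr_ge0// wX_Hs.
Qed.
Lemma Hbd_Hs s f M : 0 <= s -> L2T f -> Hbd s f M -> Hs s f.
Proof.
move=> s0 lf [_ _ h]; split=> //; apply: (@le_lt_trans _ _ (M ^+ 2)%:E); last exact: ltry.
apply: esum_sumle; apply: sumle_mono h => // k.
by rewrite exprMn ler_wpM2r ?sqr_ge0// Hs_wX.
Qed.

End Sobolev.

(** * Polynomials of the jet: chain rule and linearisation *)

Section Nonlinearity.
Context {R : realType}.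
Implicit Types (f g : R -> R[i]) (k l m : int) (c : int -> R[i]) (s t M : R).
Local Notation mu := (@lebesgue_measure R).
Local Notation pi := (@pi R).
Local Notation poly4 := (mpoly.mpoly 4 R[i]).
Local Notation ev p v := (fun x => mpoly.meval (fun i => v i x) p).

(** Hadamard's factorisation p(u) - p(v) = sum of G_i (u_i - v_i), obtained by structural induction;
    on a product, f(u) G2_i + G1_i g(v) works. The algebra property bounds the G_i in terms of p and
    M alone. *)
Lemma poly_lip s : 1/2 < s -> forall (p : poly4) M, exists2 K, 0 <= K &
  (forall v : 'I_4 -> R -> R[i], (forall i, Hbd s (v i) M) -> Hbd s (ev p v) K) /\
  (forall u v : 'I_4 -> R -> R[i], (forall i, Hbd s (u i) M) -> (forall i, Hbd s (v i) M) ->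
    exists2 G : 'I_4 -> R -> R[i], (forall i, Hbd s (G i) K) &
      forall x, ev p u x - ev p v x = \sum_(i < 4) G i x * (u i x - v i x)).
Proof.
move=> s2 p M; have [K0 K00 hmul] := Hbd_mul s2.
pose Pr (f : ('I_4 -> R[i]) -> R[i]) (_ : 'I_4 -> ('I_4 -> R[i]) -> R[i]) := exists2 K, 0 <= K &
  (forall v : 'I_4 -> R -> R[i], (forall i, Hbd s (v i) M) -> Hbd s (fun x => f (fun i => v i x)) K) /\
  (forall u v : 'I_4 -> R -> R[i], (forall i, Hbd s (u i) M) -> (forall i, Hbd s (v i) M) ->
    exists2 G : 'I_4 -> R -> R[i], (forall i, Hbd s (G i) K) &
      forall x, f (fun i => u i x) - f (fun i => v i x) = \sum_(i < 4) G i x * (u i x - v i x)).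
apply: (MPolyEval.meval_ind (Pr := Pr)) => [c|i|f f' g g'|f f' g g'].
- exists (nc c); first exact: nc_ge0.
  split=> [v _|u v _ _]; first exact: Hbd_cst.
  exists (fun _ _ => 0).
    by move=> i; apply: (Hbd_mono (lexx s) _ (Hbd_cst s 0)); rewrite nc0 nc_ge0.
  by move=> x; rewrite subrr big1// => i _; rewrite mul0r.
- exists (1 + `|M|); first by rewrite addr_ge0.
  split=> [v hv|u v hu hv].
    by apply: (Hbd_mono (lexx s) _ (hv i)); rewrite ler_wpDl// ler_norm.
  exists (fun j _ => (i == j)%:R).
    move=> j; apply: (Hbd_mono (lexx s) _ (Hbd_cst s _)); case: (i == j).
      by rewrite nc1 lerDl.
    by rewrite nc0 addr_ge0.
  move=> x; rewrite (bigD1 i)//= eqxx mul1r big1 ?addr0// => j ji.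
  by rewrite eq_sym (negbTE ji) mul0r.
- move=> [K1 K10 [b1 l1]] [K2 K20 [b2 l2]].
  exists (2 * (K1 + K2)); first by rewrite mulr_ge0 ?addr_ge0.
  split=> [v hv|u v hu hv]; first exact: HbdD (b1 _ hv) (b2 _ hv).
  have [G1 g1 e1] := l1 _ _ hu hv; have [G2 g2 e2] := l2 _ _ hu hv.
  exists (fun i x => G1 i x + G2 i x); first by move=> i; exact: HbdD.
  move=> x; under eq_bigr do rewrite mulrDl.
  by rewrite big_split /= -e1 -e2; ring.
- move=> [K1 K10 [b1 l1]] [K2 K20 [b2 l2]].
  have KK : 0 <= K0 * K1 * K2 by rewrite !mulr_ge0.
  exists (2 * (K0 * K1 * K2 + K0 * K1 * K2)); first by rewrite mulr_ge0 ?addr_ge0.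
  split=> [v hv|u v hu hv].
    by apply: (Hbd_mono (lexx s) _ (hmul _ _ _ _ (b1 _ hv) (b2 _ hv))); lra.
  have [G1 g1 e1] := l1 _ _ hu hv; have [G2 g2 e2] := l2 _ _ hu hv.
  exists (fun i x => f (fun i => u i x) * G2 i x + G1 i x * g (fun i => v i x)).
    by move=> i; apply: HbdD; [exact: hmul (b1 _ hu) (g2 i)|exact: hmul (g1 i) (b2 _ hv)].
  move=> x; transitivity (f (fun i => u i x) * (\sum_(i < 4) G2 i x * (u i x - v i x)) +
      (\sum_(i < 4) G1 i x * (u i x - v i x)) * g (fun i => v i x)).
    by rewrite -e1 -e2; ring.
  by rewrite mulr_sumr mulr_suml -big_split; apply: eq_bigr => i _ /=; ring.
Qed.

Definition isD f g := forall k, fourier g k = 'i * k%:~R * fourier f k.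

(** The Leibniz rule on coefficients: under the convolution sum, ik = il + i(k - l). *)
Lemma isD_mul f g f' g' : Wien f -> Wien g -> Wien f' -> Wien g' -> isD f f' -> isD g g' ->
  isD (fun x => f x * g x) (fun x => f' x * g x + f x * g' x).
Proof.
move=> wf wg wf' wg' df dg k; have [lf _] := wf; have [lg _] := wg.
have [lf' _] := wf'; have [lg' _] := wg'.
rewrite fourierD; try exact: WienM_L1T.
have e1 := fourierM_cvg k wf' lg; have e2 := fourierM_cvg k wf lg'.
have e3 := ccvgZ ('i * k%:~R) (fourierM_cvg k wf lg).
apply: (ccvg_unique (ccvgD e1 e2)); apply: (ccvg_eq (N := 0%N)) e3 => n _ /=.
rewrite mulr_sumr -big_split; apply: eq_bigr => l _ /=.
by rewrite df dg -[in LHS](subrK l k) intrD -[X in (X + _)%:~R](addrK l) subrK; ring.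
Qed.

(** The induction must carry H^s bounds along with the derivative relation, since [isD_mul] asks for
    factors in the Wiener algebra. *)
Lemma poly_chain s : 1/2 < s -> forall (p : poly4) (v v' : 'I_4 -> R -> R[i]) M,
  (forall i, Hbd s (v i) M) -> (forall i, Hbd s (v' i) M) -> (forall i, isD (v i) (v' i)) ->
  isD (ev p v) (fun x => \sum_(j < 4) ev (mpoly.mderiv j p) v x * v' j x).
Proof.
move=> s2 p v v' M hv hv' hd; have [K0 K00 hmul] := Hbd_mul s2.
pose Pr (f : ('I_4 -> R[i]) -> R[i]) (f' : 'I_4 -> ('I_4 -> R[i]) -> R[i]) :=
  [/\ exists K, Hbd s (fun x => f (fun i => v i x)) K,
      exists K, Hbd s (fun x => \sum_(j < 4) f' j (fun i => v i x) * v' j x) K &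
      isD (fun x => f (fun i => v i x)) (fun x => \sum_(j < 4) f' j (fun i => v i x) * v' j x)].
suff [] : Pr (fun u => mpoly.meval u p) (fun j u => mpoly.meval u (mpoly.mderiv j p)) by [].
apply: (MPolyEval.meval_ind (Pr := Pr)) => [c|i|f f' g g'|f f' g g'].
- have e : (fun x : R => \sum_(j < 4) 0 * v' j x) = fun=> 0.
    by apply/funext => x; rewrite big1// => i _; rewrite mul0r.
  split; rewrite ?e; try (by eexists; exact: Hbd_cst).
  move=> k; rewrite !fourier_cst mul0r.
  by case: eqP => [->|_]; rewrite ?mulr0 ?mul0r.
- have e : (fun x : R => \sum_(j < 4) (i == j)%:R * v' j x) = v' i.
    apply/funext => x; rewrite (bigD1 i)//= eqxx mul1r big1 ?addr0// => j ji.
    by rewrite eq_sym (negbTE ji) mul0r.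
  split; rewrite ?e; [by exists M; exact: hv|by exists M; exact: hv'|exact: hd].
- move=> [[K1 h1] [K2 h2] d1] [[K3 h3] [K4 h4] d2].
  have e : (fun x : R => \sum_(j < 4) (f' j (v^~ x) + g' j (v^~ x)) * v' j x) =
     fun x => \sum_(j < 4) f' j (v^~ x) * v' j x + \sum_(j < 4) g' j (v^~ x) * v' j x.
    by apply/funext => x; rewrite -big_split; apply: eq_bigr => j _; rewrite mulrDl.
  split; rewrite ?e; try (by eexists; apply: HbdD; eassumption).
  move: h1 h2 h3 h4 => [l1 _ _] [l2 _ _] [l3 _ _] [l4 _ _] k.
  by rewrite !fourierD// d1 d2 mulrDr.
- move=> [[K1 h1] [K2 h2] d1] [[K3 h3] [K4 h4] d2].
  have e : (fun x : R => \sum_(j < 4) (f' j (v^~ x) * g (v^~ x) + f (v^~ x) * g' j (v^~ x)) * v' j x) =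
     fun x => (\sum_(j < 4) f' j (v^~ x) * v' j x) * g (v^~ x) + f (v^~ x) * (\sum_(j < 4) g' j (v^~ x) * v' j x).
    apply/funext => x; rewrite mulr_suml mulr_sumr -big_split; apply: eq_bigr => j _ /=; ring.
  split; rewrite ?e.
  + by eexists; apply: hmul; eassumption.
  + by eexists; apply: HbdD; apply: hmul; eassumption.
  + by apply: isD_mul => //; apply: Hbd_Wien; eassumption.
Qed.

Lemma wX_half k l s : 0 <= s -> w k <= 2 * w l :> R -> w l `^ (- s) <= 2 `^ s * w k `^ (- s) :> R.
Proof.
move=> s0 h; have h1 : w k `^ s <= 2 `^ s * w l `^ s :> R.
  rewrite -powRM ?(ltW (w_gt0 _))//; apply: ge0_ler_powR; rewrite ?nnegrE ?mulr_ge0 ?(ltW (w_gt0 _))//.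
have e1 := @wXN R k s; have e2 := @wXN R l s.
have p1 : 0 < w k `^ (- s) :> R by exact: wX_gt0.
have p2 : 0 < w l `^ (- s) :> R by exact: wX_gt0.
have : (w l `^ (- s) * w k `^ (- s)) * w k `^ s <= (w l `^ (- s) * w k `^ (- s)) * (2 `^ s * w l `^ s) :> R.
  by rewrite ler_wpM2l// mulr_ge0 ?ltW.
rewrite -mulrA e1 mulr1 => /le_trans; apply.
rewrite le_eqVlt; apply/orP; left; apply/eqP.
rewrite -[RHS]mulr1 -e2; ring.
Qed.

(** For |l| > |k|/2 the coefficient of f at l is already O(w(k)^(-s)), and the coefficients of g are
    summable. Hence only low frequencies of f meet high frequencies of g in the main part. *)
Lemma conv_tail s f g M B k : 1/2 < s -> Hbd s f M -> L1T g -> asum (fourier g) B ->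
  nc (fourier (fun x => f x * g x) k -
      \sum_(l <- zl (absz k)./2) fourier f l * fourier g (k - l)) <=
    M * 2 `^ s * B * w k `^ (- s).
Proof.
move=> s2 hf lg hB; have [_ M0 _] := hf.
apply: (ccvg_dist (N := (absz k)./2) (fourierM_cvg k (Hbd_Wien s2 hf) lg)) => n kn.
rewrite (big_zl_split _ kn) addrAC subrr add0r; apply: (le_trans (nc_sum _ _ _)).
apply: (@le_trans _ _ (\sum_(l <- ztail (absz k)./2 n) M * 2 `^ s * w k `^ (- s) * nc (fourier g (k - l)))).
  rewrite big_seq [leRHS]big_seq; apply: ler_sum => l; rewrite mem_filter => /andP[hl _].
  rewrite ncM ler_wpM2r ?nc_ge0//; apply: (le_trans (Hbd_pt l hf)).
  rewrite -mulrA ler_wpM2l//.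
  apply: wX_half; first by lra.
  rewrite /w -!intr_norm -!abszE -!pmulrn.
  have : (absz k <= (absz l) * 2)%N by lia.
  by rewrite -(ler_nat R) natrM; lra.
rewrite -mulr_sumr; have -> : M * 2 `^ s * B * w k `^ (- s) = M * 2 `^ s * w k `^ (- s) * B by ring.
rewrite ler_wpM2l ?mulr_ge0 ?powR_ge0//.
apply: (@sumle_inj _ _ _ (fun l => k - l) _ hB); last by rewrite filter_uniq// zl_uniq.
by move=> a b /addrI /oppr_inj.
Qed.

Definition Jet f (i : 'I_4) (x : R) : R[i] := jet (f x) (dx f x) i.

Lemma nonlinE (F : poly4) f : nonlin F f = ev F (Jet f).
Proof. by []. Qed.

(** If c is the coefficient sequence of f, these are the coefficients of f, of its derivative, and
    of the conjugates of both. The last entry has no minus sign: conjugation and the passage to -k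
    each contribute one. *)
Definition Jhat (c : int -> R[i]) (i : 'I_4) k : R[i] :=
  [:: c k; 'i * k%:~R * c k; (c (- k))^*; 'i * k%:~R * (c (- k))^*]`_i.

Lemma nc_ik k : nc ('i * k%:~R : R[i]) = `|k%:~R|.
Proof.
have -> : k%:~R = (k%:~R : R)%:C :> R[i] by rewrite rmorph_int.
by rewrite ncM nc_i nc_real mul1r.
Qed.
Lemma conj_ik k : ('i * k%:~R : R[i])^* = - ('i * k%:~R).
Proof.
have -> : k%:~R = (k%:~R : R)%:C :> R[i] by rewrite rmorph_int.
by apply: complexP; rewrite !reimE /=; ring.
Qed.

Lemma Hs_dx_weak s M f (s52 : 5/2 < s) (hf : Hbd s f M) : weak_deriv f (dx f).
Proof.
have [lf M0 Sf] := hf.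
have i0 : 0 + 1/2 < s by lra.
have i1 : 1 + 1/2 < s by lra.
have [Z0 h0] := Hbd_asum i0.
have [Z1 h1] := Hbd_asum i1.
apply: (dx_weak lf (B1 := Z0 + M ^+ 2) (B := Z1 + M ^+ 2)).
- by apply: sumle_mono (h0 _ _ hf) => // k; rewrite powRr0 mul1r.
- apply: sumle_mono (h1 _ _ hf) => // k; rewrite wX1 ncM nc_ik.
  by rewrite ler_wpM2r ?nc_ge0// abs_w.
Qed.
Lemma L1T_dx s M f (s52 : 5/2 < s) (hf : Hbd s f M) : L1T (dx f).
Proof. by have [h _] := Hs_dx_weak s52 hf; exact: L2T_L1T. Qed.
Lemma fourier_dx s M f (s52 : 5/2 < s) (hf : Hbd s f M) k : fourier (dx f) k = 'i * k%:~R * fourier f k.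
Proof. by have [lf _ _] := hf; apply: weak_deriv_fourier => //; exact: Hs_dx_weak s52 hf. Qed.
Lemma L1T_Jet s M f (s52 : 5/2 < s) (hf : Hbd s f M) i : L1T (Jet f i).
Proof.
have [lf M0 Sf] := hf; have ld := L1T_dx s52 hf.
rewrite /Jet /jet; case: i => [[|[|[|[|//]]]] hi] /=; [by []|by []|exact: L1T_conj|exact: L1T_conj].
Qed.
Lemma fourier_Jet s M f (s52 : 5/2 < s) (hf : Hbd s f M) i k : fourier (Jet f i) k = Jhat (fourier f) i k.
Proof.
have [lf M0 Sf] := hf; have ld := L1T_dx s52 hf.
rewrite /Jet /jet /Jhat; case: i => [[|[|[|[|//]]]] hi] /=.
- by [].
- exact: (fourier_dx s52 hf).
- exact: fourier_conj.
- rewrite fourier_conj// (fourier_dx s52 hf) rmorphM/= -/(_^*)%C.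
  by rewrite -[X in X * _ = _]/(('i * (- k)%:~R)^*) conj_ik mulrNz mulrN opprK.
Qed.
(** The constant M is unchanged because |k| <= w(k); for the conjugated entries the sum is reindexed
    by k -> -k. *)
Lemma Hbd_Jet s M f (s52 : 5/2 < s) (hf : Hbd s f M) i : Hbd (s - 1) (Jet f i) M.
Proof.
have [lf M0 Sf] := hf; split=> //; first exact: L1T_Jet s52 hf i.
have hw k : w k `^ (s - 1) <= w k `^ s :> R by apply: wX_mono; lra.
have hw1 k : w k `^ (s - 1) * `|k%:~R| <= w k `^ s :> R.
  apply: (@le_trans _ _ (w k `^ (s - 1) * w k)); first by rewrite ler_wpM2l ?wX_ge0 ?abs_w.
  by rewrite -{2}(@wX1 R k) -wXD subrK.
have Sf' := sumle_inj (@oppr_inj int) Sf.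
have sq (a b : R) : 0 <= a -> a <= b -> a ^+ 2 <= b ^+ 2.
  by move=> a0 ab; rewrite ler_pXn2r ?nnegrE// (le_trans a0).
suff [h|h] : (forall k, w k `^ (s - 1) * nc (fourier (Jet f i) k) <= w k `^ s * nc (fourier f k)) \/
    (forall k, w k `^ (s - 1) * nc (fourier (Jet f i) k) <= w (- k) `^ s * nc (fourier f (- k))).
- by apply: sumle_mono Sf => // k; apply: sq => //; rewrite mulr_ge0 ?nc_ge0 ?wX_ge0.
- by apply: sumle_mono Sf' => // k; apply: sq => //; rewrite mulr_ge0 ?nc_ge0 ?wX_ge0.
have e := fourier_Jet s52 hf i; case: i e => [[|[|[|[|//]]]] hi] e; [left|left|right|right] => k;
  rewrite e /Jhat /=.
- by rewrite ler_wpM2r ?nc_ge0.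
- by rewrite ncM nc_ik mulrA ler_wpM2r ?nc_ge0.
- by rewrite ncJ wN ler_wpM2r ?nc_ge0.
- by rewrite ncM ncJ nc_ik mulrA wN ler_wpM2r ?nc_ge0.
Qed.

Lemma sum4 (T : nmodType) (G : 'I_4 -> T) : \sum_(i < 4) G i =
  G (@Ordinal 4 0 isT) + (G (@Ordinal 4 1 isT) + (G (@Ordinal 4 2 isT) + G (@Ordinal 4 3 isT))).
Proof.
rewrite !big_ord_recl big_ord0 addr0.
by congr (G _ + (G _ + (G _ + G _))); apply: val_inj.
Qed.

Lemma nc_split4 (A0 A1 A2 A3 S1 S3 : R[i]) (b0 b1 b2 b3 : R) :
  nc A0 <= b0 -> nc (A1 - S1) <= b1 -> nc A2 <= b2 -> nc (A3 - S3) <= b3 ->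
  nc (A0 + (A1 + (A2 + A3)) - (S1 + S3)) <= b0 + b2 + b1 + b3.
Proof.
move=> e0 e1 e2 e3.
have -> : A0 + (A1 + (A2 + A3)) - (S1 + S3) = A0 + A2 + ((A1 - S1) + (A3 - S3)) by ring.
apply: (le_trans (ncD _ _)); apply: (le_trans (lerD (ncD _ _) (ncD _ _))).
by rewrite -[leRHS]addrA; apply: lerD; apply: lerD.
Qed.

(* Differentiating the equation linearises the nonlinearity exactly; only the terms
   carrying two derivatives of the solution are not one derivative better. *)
Lemma nonlin_linearized s M (F : poly4) : 5/2 < s -> exists2 C, 0 <= C & forall f, Hbd s f M -> forall k,
  nc ('i * k%:~R * fourier (nonlin F f) k -
      (\sum_(l <- zl (absz k)./2) fourier (nonlin (mpoly.mderiv (@Ordinal 4 1 isT) F) f) l *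
         (('i * (k - l)%:~R) * ('i * (k - l)%:~R) * fourier f (k - l)) +
       \sum_(l <- zl (absz k)./2) fourier (nonlin (mpoly.mderiv (@Ordinal 4 3 isT) F) f) l *
         (('i * (k - l)%:~R) * ('i * (k - l)%:~R) * (fourier f (- (k - l)))^*)))
   <= C * w k `^ (- (s - 1)).
Proof.
move=> s52.
have s1 : 1/2 < s - 1 by lra.
have s2 : 1/2 < s - 2 by lra.
have s20 : 0 + 1/2 < s - 2 by lra.
have [K0 K00 hmul] := Hbd_mul s1.
have hb j : exists K, 0 <= K /\ forall f, Hbd s f M -> Hbd (s - 1) (nonlin (mpoly.mderiv j F) f) K.
  have [K K0' [h _]] := poly_lip s1 (mpoly.mderiv j F) M; exists K; split=> // f hf.
  by apply: (h (Jet f)) => i; exact: Hbd_Jet.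
have [K hK'] := choice hb.
have K_ge0 j : 0 <= K j by have [] := hK' j.
have hK j f : Hbd s f M -> Hbd (s - 1) (nonlin (mpoly.mderiv j F) f) (K j) by have [_] := hK' j; apply.
have [Z hZ] := Hbd_asum s20.
have Z0 : 0 <= Z.
  have := sumle_ge0 (hZ _ _ (Hbd_cst (s - 2) 0)); rewrite nc0 expr0n addr0.
  by [].
pose i0 : 'I_4 := @Ordinal 4 0 isT; pose i1 : 'I_4 := @Ordinal 4 1 isT.
pose i2 : 'I_4 := @Ordinal 4 2 isT; pose i3 : 'I_4 := @Ordinal 4 3 isT.
pose M' := `|M|.
pose B := Z + M ^+ 2.
have B0 : 0 <= B by rewrite addr_ge0 ?sqr_ge0.
exists (K0 * K i0 * M' + K0 * K i2 * M' + K i1 * 2 `^ (s - 1) * B + K i3 * 2 `^ (s - 1) * B).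
  by rewrite !addr_ge0 ?mulr_ge0 ?powR_ge0 ?normr_ge0.
move=> f hf k.
have [lf M0 Sf] := hf.
have eM : M' = M by rewrite /M' ger0_norm.
(* The derivatives of the jet lie only in H^(s-2). Since s - 2 > 1/2, their Fourier series converge
   absolutely, and [poly_chain] applies at that regularity. *)
pose v' i := fser (fun k => 'i * k%:~R * fourier (Jet f i) k).
have hJ2 i : sumle (fun k => (w k `^ (s - 2) * nc ('i * k%:~R * fourier (Jet f i) k)) ^+ 2) (M ^+ 2).
  have [_ _ h] := Hbd_Jet s52 hf i; apply: sumle_mono h => // m.
  rewrite ler_pXn2r ?nnegrE ?mulr_ge0 ?nc_ge0 ?wX_ge0// ncM nc_ik mulrA.
  rewrite ler_wpM2r ?nc_ge0//.
  have -> : s - 1 = (s - 2) + 1 by ring.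
  by rewrite (wXD m (s - 2) 1) wX1 ler_wpM2l ?wX_ge0 ?abs_w.
have as' i : exists B, asum (fun k => 'i * k%:~R * fourier (Jet f i) k) B.
  have [Z' hZ'] := @sumle_w R (2 * (s - 2)) ltac:(lra).
  exists (Z' + M ^+ 2); apply: sumle_mono (sumleD hZ' (hJ2 i)) => // m.
  rewrite -mulrN -wX_sqr; apply: le_trans (AMGM _ _).
  by rewrite mulrA wXN mul1r.
have hv' i : Hbd (s - 2) (v' i) M.
  have [B' hB'] := as' i; split=> //; first exact: L1T_fser hB'.
  apply: sumle_mono (hJ2 i) => // m; by rewrite (fourier_fser _ hB').
have fv' i m : fourier (v' i) m = 'i * m%:~R * fourier (Jet f i) m.
  by have [B' hB'] := as' i; rewrite (fourier_fser _ hB').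
have hv i : Hbd (s - 2) (Jet f i) M by apply: (Hbd_mono _ (lexx _) (Hbd_Jet s52 hf i)); lra.
rewrite nonlinE -(poly_chain s2 F hv hv') => [|i m]; last by rewrite fv'.
have Wn j : Wien (nonlin (mpoly.mderiv j F) f) := Hbd_Wien s1 (hK j _ hf).
rewrite fourier_sum => [|j]; last by apply: WienM_L1T; [exact: Wn|have [] := hv' j].
rewrite (sum4 (fun j => fourier (fun x => nonlin (mpoly.mderiv j F) f x * v' j x) k)).
(* The derivatives of the entries zeta and conj zeta are again entries of the jet; these two terms
   stay in H^(s-1) and go entirely into the error. *)
have v0 : Hbd (s - 1) (v' i0) M.
  have lv : L1T (v' i0) by have [] := hv' i0.
  apply: (eq_Hbd _ lv (Hbd_Jet s52 hf i1)) => m.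
  by rewrite fv' !(fourier_Jet s52 hf).
have v2 : Hbd (s - 1) (v' i2) M.
  have lv : L1T (v' i2) by have [] := hv' i2.
  apply: (eq_Hbd _ lv (Hbd_Jet s52 hf i3)) => m.
  by rewrite fv' !(fourier_Jet s52 hf).
have e0 := Hbd_pt k (hmul _ _ _ _ (hK i0 _ hf) v0).
have e2 := Hbd_pt k (hmul _ _ _ _ (hK i2 _ hf) v2).
have asB i : asum (fourier (v' i)) B.
  by apply: sumle_mono (hZ _ _ (hv' i)) => // m; rewrite powRr0 mul1r.
have [l1 _ _] := hv' i1; have [l3 _ _] := hv' i3.
(* The other two terms contain second derivatives of f; only their high-frequency coefficient part,
   |l| > |k|/2, is an error. *)
have e1 := conv_tail k s1 (hK i1 _ hf) l1 (asB i1).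
have e3 := conv_tail k s1 (hK i3 _ hf) l3 (asB i3).
have r1 : \sum_(l <- zl (absz k)./2) fourier (nonlin (mpoly.mderiv i1 F) f) l * fourier (v' i1) (k - l) =
   \sum_(l <- zl (absz k)./2) fourier (nonlin (mpoly.mderiv i1 F) f) l *
         (('i * (k - l)%:~R) * ('i * (k - l)%:~R) * fourier f (k - l)).
  by apply: eq_bigr => l _; rewrite fv' (fourier_Jet s52 hf) /Jhat /= !mulrA.
have r3 : \sum_(l <- zl (absz k)./2) fourier (nonlin (mpoly.mderiv i3 F) f) l * fourier (v' i3) (k - l) =
   \sum_(l <- zl (absz k)./2) fourier (nonlin (mpoly.mderiv i3 F) f) l *
         (('i * (k - l)%:~R) * ('i * (k - l)%:~R) * (fourier f (- (k - l)))^*).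
  by apply: eq_bigr => l _; rewrite fv' (fourier_Jet s52 hf) /Jhat /= !mulrA.
rewrite r1 in e1; rewrite r3 in e3.
apply: (le_trans (nc_split4 e0 e1 e2 e3)).
by rewrite -!mulrDl eM.
Qed.

End Nonlinearity.

(** * Dependence of the nonlinearity on the Fourier coefficients *)

Section NonlinLipschitz.
Context {R : realType}.
Implicit Types (f g : R -> R[i]) (k l m j : int) (s t M : R).
Local Notation poly4 := (mpoly.mpoly 4 R[i]).
Local Notation ev p v := (fun x => mpoly.meval (fun i => v i x) p).

(** Symmetric in j and -j because conjugation exchanges these two frequencies. *)
Definition symdiff f g j : R :=
  nc (fourier f j - fourier g j) + nc (fourier f (- j) - fourier g (- j)).

Lemma symdiff_ge0 f g j : 0 <= symdiff f g j.
Proof. by rewrite addr_ge0 ?nc_ge0. Qed.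

Lemma Jhat_diff f g i j :
  nc (Jhat (fourier f) i j - Jhat (fourier g) i j) <= w j * symdiff f g j.
Proof.
rewrite /symdiff; set a := nc (fourier f j - _); set b := nc (fourier f (- j) - _).
have a0 : 0 <= a by exact: nc_ge0.
have b0 : 0 <= b by exact: nc_ge0.
have w1 := @w_ge1 R j; have aw := @abs_w R j.
rewrite /Jhat; case: i => [[|[|[|[|//]]]] hi] /=.
- by rewrite -/a; nra.
- rewrite -mulrBr ncM nc_ik -/a; nra.
- rewrite -rmorphB /= ncJ -/b; nra.
- rewrite -mulrBr -rmorphB /= ncM ncJ nc_ik -/b; nra.
Qed.

Definition l2w s (x : int -> R) (K : R) :=
  (forall k, 0 <= x k) /\ sumle (fun k => (w k `^ s * x k) ^+ 2) (K ^+ 2).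

(** [gam] collects the moduli of the coefficients of the Hadamard factors of [poly_lip]. It depends
    on f and g, but its bound K does not. The conclusion holds for every B bounding the convolution,
    so the increments can later be estimated in whichever norm is available. *)
Lemma nonlin_lip s M (F : poly4) : 5/2 < s -> exists2 K, 0 <= K &
  forall f g, Hbd s f M -> Hbd s g M -> exists2 gam : int -> R, l2w (s - 1) gam K &
  forall l B, sumle (fun j => gam (l - j) * (w j * symdiff f g j)) B ->
    nc (fourier (nonlin F f) l - fourier (nonlin F g) l) <= B.
Proof.
move=> s52; have s1 : 1/2 < s - 1 by lra.
have [K K0 [bF lF]] := poly_lip s1 F M.
exists (4 * K); first by rewrite mulr_ge0.
move=> f g hf hg.
have hJf i := Hbd_Jet s52 hf i; have hJg i := Hbd_Jet s52 hg i.
have [G hG eG] := lF _ _ hJf hJg.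
exists (fun k => \sum_(i < 4) nc (fourier (G i) k)).
  split=> [k|]; first by apply: sumr_ge0 => i _; exact: nc_ge0.
  have h i := let: And3 _ _ h := hG i in h.
  have := sumleD (sumleD (h (@Ordinal 4 0 isT)) (h (@Ordinal 4 1 isT)))
    (sumleD (h (@Ordinal 4 2 isT)) (h (@Ordinal 4 3 isT))).
  move=> /(sumleZ (ltac:(lra) : 0 <= 4 :> R)); apply: sumle_mono => [k|]; last by lra.
  rewrite (sum4 (fun i => nc (fourier (G i) k))); move: (w k `^ _) => W.
  move: (nc _) (nc _) (nc _) (nc _) => a b c d.
  have := sqr_ge0 (W * a - W * b); have := sqr_ge0 (W * a - W * c).
  have := sqr_ge0 (W * a - W * d); have := sqr_ge0 (W * b - W * c).
  have := sqr_ge0 (W * b - W * d); have := sqr_ge0 (W * c - W * d).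
  lra.
move=> l B hB.
have lJ i : L1T (fun x => Jet f i x - Jet g i x).
  by apply: L1TB; [exact: L1T_Jet hf i|exact: L1T_Jet hg i].
have WG i : Wien (G i) := Hbd_Wien s1 (hG i).
have lFf : L1T (nonlin F f) by have [] := bF _ hJf.
have lFg : L1T (nonlin F g) by have [] := bF _ hJg.
rewrite -fourierB//.
have -> : (fun x => nonlin F f x - nonlin F g x) = (fun x => \sum_(i < 4) G i x * (Jet f i x - Jet g i x)).
  by apply/funext => x; rewrite -eG.
rewrite fourier_sum => [|i]; last exact: WienM_L1T.
have cv : ccvg (fun n => \sum_(i < 4) \sum_(j <- zl n) fourier (G i) j * fourier (fun x => Jet f i x - Jet g i x) (l - j))
   (\sum_(i < 4) fourier (fun x => G i x * (Jet f i x - Jet g i x)) l).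
  have h i := fourierM_cvg l (WG i) (lJ i).
  rewrite (sum4 (fun i => fourier (fun x => G i x * (Jet f i x - Jet g i x)) l)).
  under eq_fun do rewrite sum4.
  by apply: ccvgD => //; apply: ccvgD => //; apply: ccvgD.
apply: (ccvg_le cv) => n.
apply: (@le_trans _ _ (\sum_(j <- zl n) (\sum_(i < 4) nc (fourier (G i) j)) * (w (l - j) * symdiff f g (l - j)))).
  rewrite exchange_big; apply: (le_trans (nc_sum _ _ _)); apply: ler_sum => j _.
  apply: (le_trans (nc_sum _ _ _)); rewrite mulr_suml; apply: ler_sum => i _.
  rewrite ncM ler_wpM2l ?nc_ge0// fourierB; [|exact: L1T_Jet hf i|exact: L1T_Jet hg i].
  by rewrite (fourier_Jet s52 hf) (fourier_Jet s52 hg) Jhat_diff.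
have inj : injective (fun j : int => l - j) by move=> a b /addrI /oppr_inj.
have := sumle_inj inj hB (zl_uniq n).
by under eq_bigr do rewrite opprB addrC subrK.
Qed.

Lemma l2w_pt s x K k : 0 <= K -> 0 <= s -> l2w s x K -> x k <= K.
Proof.
move=> K0 s0 [x0 /sumle_pt h]; apply: (@le_trans _ _ (w k `^ s * x k)).
  by rewrite ler_peMl// wX_ge1.
by rewrite -ler_sqr ?nnegrE ?mulr_ge0 ?wX_ge0.
Qed.

(** Summation of w(j) w(j)^(-s) is possible since s - 1 > 1. Taking d = 0 shows that the
    nonlinearity depends only on the Fourier coefficients. *)
Lemma nonlin_cont s M (F : poly4) : 5/2 < s -> exists2 C, 0 <= C &
  forall f g, Hbd s f M -> Hbd s g M -> forall d, 0 <= d ->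
  (forall j, nc (fourier f j - fourier g j) <= d * w j `^ (- s)) ->
  forall l, nc (fourier (nonlin F f) l - fourier (nonlin F g) l) <= C * d.
Proof.
move=> s52; have [K K0 hK] := nonlin_lip M F s52.
have [Z hZ] := @sumle_w R (s - 1) ltac:(lra).
have Z0 := sumle_ge0 hZ.
exists (K * 2 * Z); first by rewrite !mulr_ge0.
move=> f g hf hg d d0 hd l; have [gam hgam h] := hK f g hf hg.
apply: h; have := sumleZ (ltac:(rewrite !mulr_ge0//) : 0 <= K * 2 * d) hZ.
apply: sumle_mono => [j|]; last by rewrite mulrAC.
have gK := l2w_pt (l - j) K0 (ltac:(lra) : 0 <= s - 1) hgam.
have [g0 _] := hgam.
have -> : - (s - 1) = 1 + - s by ring.
rewrite wXD wX1 -!mulrA; apply: ler_pM => //; first by rewrite mulr_ge0 ?symdiff_ge0// ltW// w_gt0.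
have -> : 2 * (d * (w j * w j `^ (- s))) = w j * (2 * (d * w j `^ (- s))) by ring.
apply: ler_wpM2l; first by rewrite ltW ?w_gt0.
by rewrite mulr_natl mulr2n lerD// -(wN (R := R) j).
Qed.

Lemma eq_nonlin s M (F : poly4) f g : 5/2 < s -> Hbd s f M -> Hbd s g M ->
  (forall k, fourier f k = fourier g k) ->
  forall k, fourier (nonlin F f) k = fourier (nonlin F g) k.
Proof.
move=> s52 hf hg e k; have [C _ /(_ f g hf hg 0 (lexx _))] := nonlin_cont M F s52.
rewrite mulr0 => h; apply/eqP; rewrite -subr_eq0; apply/eqP/nc_eq0/le_anti.
by rewrite nc_ge0 h// => j; rewrite e subrr nc0 mul0r.
Qed.

(** Here 1 <= p + s - a and Peetre's inequality give w(j) <= w(l)^p w(l-j)^p w(j)^(s-a). The factor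
    w(l-j)^p is carried by gam because p <= s - 1, and w(l)^p is the loss in the conclusion. *)
Lemma l2w_conv s a p gam e K B l : 0 <= p -> p <= s - 1 -> 1 + a - s <= p ->
  l2w (s - 1) gam K -> l2w (s - a) e B ->
  sumle (fun j => gam (l - j) * (w j * e j)) ((K ^+ 2 + B ^+ 2) * w l `^ p).
Proof.
move=> p0 ps ap [g0 hg] [e0 he].
have inj : injective (fun j : int => l - j) by move=> x y /addrI /oppr_inj.
rewrite mulrC; apply: sumle_mono (sumleZ (wX_ge0 l p) (sumleD (sumle_inj inj hg) he)) => // j.
apply: (@le_trans _ _ (w l `^ p * ((w (l - j) `^ p * gam (l - j)) * (w j `^ (s - a) * e j)))).
  have h1 : w j <= w l `^ p * w (l - j) `^ p * w j `^ (s - a) :> R.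
    have h2 : w j <= w j `^ p * w j `^ (s - a) :> R.
      rewrite -wXD -[leLHS](wX1 (R := R)); apply: wX_mono; lra.
    apply: (le_trans h2); rewrite ler_wpM2r ?wX_ge0// mulrC.
    by have := @wX_peetre R j l p p0; rewrite -(wN (j - l)) opprB.
  have -> : w l `^ p * (w (l - j) `^ p * gam (l - j) * (w j `^ (s - a) * e j)) =
    gam (l - j) * ((w l `^ p * w (l - j) `^ p * w j `^ (s - a)) * e j) by ring.
  by rewrite ler_wpM2l// ler_wpM2r.
rewrite ler_wpM2l ?wX_ge0//; apply: le_trans (AMGM _ _) _; rewrite lerD2r.
have h3 : w (l - j) `^ p <= w (l - j) `^ (s - 1) :> R by exact: wX_mono.
by rewrite ler_pXn2r ?nnegrE ?mulr_ge0 ?wX_ge0// ler_wpM2r.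
Qed.

End NonlinLipschitz.

(** * The weak formulation tested against exponentials in time *)

Section FlatFunction.
Context {R : realType}.
Implicit Types (P : {poly R}) (x y t c : R) (h g : R -> R).
Local Notation mu := (@lebesgue_measure R).

(** The functions P(1/x) e^(-1/x), extended by 0: a class containing the classical flat function and
    closed under differentiation, so that smoothness follows by induction for all P at once. *)
Definition flat P x : R := if 0 < x then P.[x^-1] * expR (- x^-1) else 0.

Lemma expR_ge_exprn n y : 0 <= y -> y ^+ n <= n`!%:R * expR y.
Proof.
case: n => [|n] y0; first by rewrite expr0 fact0 mul1r; have := expR_ge1Dx y; lra.
have := @expR_ge1Dxn R y n y0; set e := expR y => h.
have f0 : 0 < n.+1`!%:R :> R by rewrite ltr0n fact_gt0.
rewrite mulrC -ler_pdivrMr//; lra.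
Qed.

Lemma poly_expR_bound P : exists2 C : R, 0 <= C & forall y, 0 <= y -> `|P.[y]| <= C * expR y.
Proof.
exists (\sum_(i < size P) `|P`_i| * i`!%:R).
  by apply: sumr_ge0 => i _; rewrite mulr_ge0.
move=> y y0; rewrite horner_coef mulr_suml.
apply: (le_trans (ler_norm_sum _ _ _)); apply: ler_sum => i _.
by rewrite normrM -mulrA ler_wpM2l// normrX (ger0_norm y0) expR_ge_exprn.
Qed.

(** A quadratic bound makes the difference quotient at 0 tend to 0. It follows from y^2 |P(y)| =
    O(e^y) with y = 1/x. *)
Lemma flat_bound P : exists2 C : R, 0 <= C & forall x, `|flat P x| <= C * x ^+ 2.
Proof.
have [C C0 hC] := poly_expR_bound ('X^2 * P); exists C => // x.
rewrite /flat; case: ifP => x0; last by rewrite normr0 mulr_ge0 ?sqr_ge0.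
have y0 : 0 <= x^-1 by rewrite invr_ge0 ltW.
have := hC _ y0; rewrite hornerM hornerXn normrM normrX (ger0_norm y0) => h.
rewrite normrM (ger0_norm (expR_ge0 _)) expRN ler_pdivrMr ?expR_gt0//.
have x2 : 0 < x ^+ 2 by rewrite exprn_gt0.
by rewrite mulrAC -ler_pdivrMr// mulrC -exprVn.
Qed.

Lemma is_derive_flat P x : is_derive x (1 : R) (flat P) (flat ('X^2 * (P - P^`())) x).
Proof.
case: (ltgtP x 0) => x0.
- have e0 : \near x, cst 0 x = flat P x.
    near=> y; rewrite /flat ifN// -leNgt ltW//; near: y; exact: lt_nbhsl.
  have -> : flat ('X^2 * (P - P^`())) x = 0 by rewrite /flat ifN// -leNgt ltW.
  apply: (@near_eq_is_derive _ _ _ (cst 0)) => //.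
- pose y := x^-1.
  have x00 : x != 0 by rewrite gt_eqF.
  have dV : is_derive x (1 : R) (fun z : R => z^-1) (- x ^- 2).
    have := is_deriveV (f := id) x00 (is_derive_id x (1 : R)).
    by move=> h; apply: is_derive_eq; rewrite /GRing.scale /= mulr1.
  have dP : is_derive (x^-1) (1 : R) (fun z : R => P.[z]) (P^`().[x^-1]).
    exact: is_derive_poly.
  have d1 := is_derive1_comp dP dV.
  have dN : is_derive x (1 : R) (fun z : R => - z^-1) (- - x ^- 2) := is_deriveN dV.
  have d2 := @is_derive1_comp _ _ (fun z : R => - z^-1) _ _ _ (is_derive_expR (- x^-1)) dN.
  have d3 := is_deriveM d1 d2.
  have e0 : \near x, ((fun z : R => P.[z^-1]) \* (expR \o (fun z : R => - z^-1))) x = flat P x.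
    near=> z; rewrite /flat ifT//; near: z; exact: lt_nbhsr.
  apply: (near_eq_is_derive e0); apply: is_derive_eq; rewrite /flat x0 hornerM hornerXn hornerD hornerN /GRing.scale /= exprVn; ring.
- have -> : flat ('X^2 * (P - P^`())) x = 0 by rewrite /flat x0 ltxx.
  have [C C0 hC] := flat_bound P.
  have f0 : flat P 0 = 0 by rewrite /flat ltxx.
  have cv : (fun h : R => h^-1 *: (flat P (h *: (1 : R) + x) - flat P x)) @ 0^' --> (0 : R).
    rewrite x0 f0; apply/cvgrPdist_le => e e0.
    near=> z; rewrite sub0r normrN subr0 addr0 /GRing.scale /= mulr1 normrM.
    have z0 : z != 0 by near: z; exact: nbhs_dnbhs_neq.
    have z1 : `|z| <= e / (C + 1).
      near: z; apply: dnbhs0_le; rewrite divr_gt0//; lra.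
    rewrite normfV mulrC ler_pdivrMr ?normr_gt0//; apply: (le_trans (hC z)).
    rewrite -[z ^+ 2]ger0_norm ?sqr_ge0// normrX expr2 mulrA ler_wpM2r//.
    have := normr_ge0 z; move: z1; rewrite ler_pdivlMr; [nra|lra].
  apply: DeriveDef; first by apply/cvg_ex; exists 0.
  exact: cvg_lim.
Unshelve. all: by end_near.
Qed.

Fixpoint smo (n : nat) h : Prop :=
  if n is m.+1 then (forall x, derivable h x 1) /\ smo m (derive1 h) else True.

Lemma smoS n h : smo n.+1 h -> smo n h.
Proof. by elim: n h => [//|n IH] h [h1 h2]; split => //; exact: IH. Qed.
Lemma derive1_is h h' : (forall x, is_derive x (1 : R) h (h' x)) -> derive1 h = h'.
Proof. by move=> d; apply/funext => x; rewrite derive1E; apply: derive_val. Qed.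
Lemma derivable_is h x : derivable h x 1 -> is_derive x (1 : R) h (derive1 h x).
Proof. by move=> d; rewrite derive1E; exact: derivableP. Qed.
Lemma smoS_is n h h' : (forall x, is_derive x (1 : R) h (h' x)) -> smo n h' -> smo n.+1 h.
Proof. by move=> d hn /=; rewrite (derive1_is d); split=> // x; have [] := d x. Qed.
Lemma smoD n g h : smo n g -> smo n h -> smo n (fun x => g x + h x).
Proof.
elim: n g h => [//|n IH] g h [g1 g2] [h1 h2].
apply: (@smoS_is _ _ (fun x => derive1 g x + derive1 h x)); last exact: IH.
move=> x; have p1 := derivable_is (g1 x); have p2 := derivable_is (h1 x).
exact: (is_deriveD p1 p2).
Qed.
Lemma smoM n g h : smo n g -> smo n h -> smo n (fun x => g x * h x).
Proof.
elim: n g h => [//|n IH] g h hg hh; have [g1 g2] := hg; have [h1 h2] := hh.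
apply: (@smoS_is _ _ (fun x => g x * derive1 h x + h x * derive1 g x)); last first.
  by apply: smoD; apply: IH => //; exact: smoS.
move=> x; have p1 := derivable_is (g1 x); have p2 := derivable_is (h1 x).
exact: (is_deriveM p1 p2).
Qed.
Lemma smo_cst n c : smo n (fun=> c).
Proof.
elim: n c => [//|n IH] c; apply: (@smoS_is _ _ (fun=> 0)) => // x; exact: is_derive_cst.
Qed.
Lemma is_derive_affine (a b x : R) : is_derive x (1 : R) (fun t => a * t + b) a.
Proof.
have h := is_deriveD (is_deriveZ a (is_derive_id x (1 : R))) (is_derive_cst b x (1 : R)).
by apply: is_derive_eq; rewrite /GRing.scale /= mulr1 addr0.
Qed.
Lemma smo_comp n h (a b : R) : smo n h -> smo n (fun t => h (a * t + b)).
Proof.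
elim: n h => [//|n IH] h [h1 h2].
apply: (@smoS_is _ _ (fun x => derive1 h (a * x + b) * a)).
  move=> x; exact: is_derive1_comp (derivable_is (h1 _)) (is_derive_affine a b x).
by apply: smoM; [exact: IH|exact: smo_cst].
Qed.
Lemma smo_flat n P : smo n (flat P).
Proof. by elim: n P => [//|n IH] P; apply: smoS_is (IH _) => x; exact: is_derive_flat. Qed.
Lemma smo_trig n (a b : R) : smo n (fun x => a * cos x + b * sin x).
Proof.
elim: n a b => [//|n IH] a b; apply: smoS_is (IH b (- a)) => x.
have h := is_deriveD (is_deriveZ a (is_derive_cos x)) (is_deriveZ b (is_derive_sin x)).
by apply: is_derive_eq; rewrite /GRing.scale /=; ring.
Qed.
Lemma smo_cosw n (a : R) : smo n (fun x => cos (a * x)).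
Proof.
have := smo_comp a 0 (smo_trig n 1 0).
by under eq_fun do rewrite mul1r mul0r !addr0.
Qed.
Lemma smo_sinw n (a : R) : smo n (fun x => sin (a * x)).
Proof.
have := smo_comp a 0 (smo_trig n 0 1).
by under eq_fun do rewrite mul1r mul0r add0r addr0.
Qed.
Lemma smo_expR n (a : R) : smo n (fun x => expR (a * x)).
Proof.
have h : smo n (@expR R) by elim: n => [//|n IH]; apply: smoS_is IH => x; exact: is_derive_expR.
by have := smo_comp a 0 h; under eq_fun do rewrite addr0.
Qed.
Lemma smo_continuous h : smo 1 h -> continuous h.
Proof.
by move=> [d _] x; apply: differentiable_continuous; apply/derivable1_diffP.
Qed.

(** The real and imaginary parts of the test functions are sums of two such products, so joint
    smoothness reduces to one variable. *)
Lemma class_C_prod n (A B : R -> R) : (forall m, smo m A) -> (forall m, smo m B) ->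
  class_C n (fun t x => A t * B x).
Proof.
elim: n A B => [|n IH] A B hA hB.
all: have cAB : continuous (fun p : R * R => A p.1 * B p.2).
1,3: move=> p; apply: cvgM;
  [apply: (@continuous_comp _ _ _ fst A); [exact: cvg_fst|exact: (smo_continuous (hA 1%N))]
  |apply: (@continuous_comp _ _ _ snd B); [exact: cvg_snd|exact: (smo_continuous (hB 1%N))]].
  by split.
have dA t := (hA 1%N).1 t; have dB t := (hB 1%N).1 t.
have hA' m : smo m (derive1 A) by have [] := hA m.+1.
have hB' m : smo m (derive1 B) by have [] := hB m.+1.
have iA x t : is_derive t (1 : R) (fun t => A t * B x) (derive1 A t * B x).
  have h := is_deriveM (derivable_is (dA t)) (is_derive_cst (B x) t (1 : R)).
  by apply: is_derive_eq; rewrite /GRing.scale /= mulr0 add0r mulrC.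
have iB t x : is_derive x (1 : R) (fun x => A t * B x) (A t * derive1 B x).
  exact: is_deriveZ (derivable_is (dB x)).
split; first by [].
split.
- by move=> t x; split; [have [] := iA x t|have [] := iB t x].
- rewrite (_ : (fun t x => _) = (fun t x => derive1 A t * B x)); first exact: IH.
  by apply/funext => t; apply/funext => x; rewrite (derive1_is (iA x)).
- rewrite (_ : (fun t x => _) = (fun t x => A t * derive1 B x)); first exact: IH.
  by apply/funext => t; apply/funext => x; rewrite (derive1_is (iB t)).
Qed.

Lemma class_CD n (f g : R -> R -> R) : class_C n f -> class_C n g ->
  class_C n (fun t x => f t x + g t x).
Proof.
elim: n f g => [|n IH] f g [cf hf] [cg hg].
  by split => // p; apply: cvgD; [exact: cf|exact: cg].
split; first by move=> p; apply: cvgD; [exact: cf|exact: cg].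
case: hf hg => [df f1 f2] [dg g1 g2].
have i1 x t : is_derive t (1 : R) (fun t => f t x + g t x) (derive1 (f ^~ x) t + derive1 (g ^~ x) t).
  exact: is_deriveD (derivable_is (df t x).1) (derivable_is (dg t x).1).
have i2 t x : is_derive x (1 : R) (fun x => f t x + g t x) (derive1 (f t) x + derive1 (g t) x).
  exact: is_deriveD (derivable_is (df t x).2) (derivable_is (dg t x).2).
split.
- by move=> t x; split; [have [] := i1 x t|have [] := i2 t x].
- rewrite (_ : (fun t x => _) = (fun t x => derive1 (f ^~ x) t + derive1 (g ^~ x) t)); first exact: IH.
  by apply/funext => t; apply/funext => x; rewrite (derive1_is (i1 x)).
- rewrite (_ : (fun t x => _) = (fun t x => derive1 (f t) x + derive1 (g t) x)); first exact: IH.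
  by apply/funext => t; apply/funext => x; rewrite (derive1_is (i2 t)).
Qed.

(** The factor in x extracts the k-th Fourier coefficient, [E l] is an integrating factor with a
    rate still to be chosen, and [th] truncates in time. *)
Definition tfun (th : R -> R) (l : R[i]) (k : int) (t x : R) : R[i] :=
  (th t)%:C * E l t * cexp (- (k%:~R * x)).

Lemma smooth_tfun (th : R -> R) l k : (forall n, smo n th) -> smooth_periodic2 (tfun th l k).
Proof.
move=> hth; split=> [t x|n].
  by rewrite /tfun -!mulNr -mulrNz cexpZ2pi.
have hc m : smo m (fun t => th t * expR (Re l * t) * cos (Im l * t)).
  by apply: smoM; [apply: smoM => //; exact: smo_expR|exact: smo_cosw].
have hs m : smo m (fun t => th t * expR (Re l * t) * sin (Im l * t)).
  by apply: smoM; [apply: smoM => //; exact: smo_expR|exact: smo_sinw].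
have hs' m : smo m (fun t => (-1) * (th t * expR (Re l * t) * cos (Im l * t))).
  by apply: smoM => //; exact: smo_cst.
have e1 : (fun t x => Re (tfun th l k t x)) =
   (fun t x => (th t * expR (Re l * t) * cos (Im l * t)) * cos (k%:~R * x) +
               (th t * expR (Re l * t) * sin (Im l * t)) * sin (k%:~R * x)).
  by apply/funext => t; apply/funext => x; rewrite /tfun /E !reimE /= cosN sinN; ring.
have e2 : (fun t x => Im (tfun th l k t x)) =
   (fun t x => (th t * expR (Re l * t) * sin (Im l * t)) * cos (k%:~R * x) +
               ((-1) * (th t * expR (Re l * t) * cos (Im l * t))) * sin (k%:~R * x)).
  by apply/funext => t; apply/funext => x; rewrite /tfun /E !reimE /= cosN sinN; ring.
rewrite e1 e2; split; apply: class_CD; apply: class_C_prod => // m;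
  by [exact: smo_cosw|exact: smo_sinw].
Qed.

Lemma dt_tfun (th th' : R -> R) l k t x : (forall t, is_derive t (1 : R) th (th' t)) ->
  dt (tfun th l k) t x = ((th' t)%:C + l * (th t)%:C) * E l t * cexp (- (k%:~R * x)).
Proof.
move=> dth.
have dE : is_derive t (1 : R) (fun t => expR (Re l * t)) (Re l * expR (Re l * t)).
  have h := is_derive1_comp (is_derive_expR (Re l * t)) (is_deriveZ (Re l) (is_derive_id t (1 : R))).
  by apply: is_derive_eq; rewrite /GRing.scale /= mulr1 mulrC.
have dC := is_derive_cosw (Im l) t; have dS := is_derive_sinw (Im l) t.
have d0 : is_derive t (1 : R) (fun t => th t * expR (Re l * t))
    ((th' t + Re l * th t) * expR (Re l * t)).
  have h := is_deriveM (dth t) dE.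
  by apply: is_derive_eq; rewrite /GRing.scale /=; ring.
have p1 : is_derive t (1 : R) (fun t => th t * expR (Re l * t) * cos (Im l * t))
    ((th' t + Re l * th t) * expR (Re l * t) * cos (Im l * t) - Im l * th t * expR (Re l * t) * sin (Im l * t)).
  have h := is_deriveM d0 dC.
  by apply: is_derive_eq; rewrite /GRing.scale /=; ring.
have p2 : is_derive t (1 : R) (fun t => th t * expR (Re l * t) * sin (Im l * t))
    ((th' t + Re l * th t) * expR (Re l * t) * sin (Im l * t) + Im l * th t * expR (Re l * t) * cos (Im l * t)).
  have h := is_deriveM d0 dS.
  by apply: is_derive_eq; rewrite /GRing.scale /=; ring.
have q1 := is_deriveD (is_deriveZ (cos (k%:~R * x)) p1) (is_deriveZ (sin (k%:~R * x)) p2).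
have q2 := is_deriveB (is_deriveZ (cos (k%:~R * x)) p2) (is_deriveZ (sin (k%:~R * x)) p1).
rewrite /dt /cderive; apply: complexP; rewrite [LHS]/=.
- rewrite (_ : (fun y => _) = (cos (k%:~R * x) \*: (fun t => th t * expR (Re l * t) * cos (Im l * t)))
     \+ (sin (k%:~R * x) \*: (fun t => th t * expR (Re l * t) * sin (Im l * t)))).
    rewrite derive1E; have /@derive_val -> := q1.
    by rewrite /E !reimE /= cosN sinN /GRing.scale /=; ring.
  by apply/funext => y; rewrite /= cosN sinN /GRing.scale /=; ring.
- rewrite (_ : (fun y => _) = (cos (k%:~R * x) \*: (fun t => th t * expR (Re l * t) * sin (Im l * t)))
     \- (sin (k%:~R * x) \*: (fun t => th t * expR (Re l * t) * cos (Im l * t)))).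
    rewrite derive1E; have /@derive_val -> := q2.
    by rewrite /E !reimE /= cosN sinN /GRing.scale /=; ring.
  by apply/funext => y; rewrite /= cosN sinN /GRing.scale /=; ring.
Qed.

(** Only the frequency -k is present, so the partial sums are stationary from n = |k| on. *)
Lemma Dalpha_tfun alpha (th : R -> R) l k t x :
  Dalpha alpha (tfun th l k t) x = (`|k%:~R : R| `^ alpha)%:C * tfun th l k t x.
Proof.
rewrite /Dalpha -/(clim (fun n => Dalpha_partial alpha (tfun th l k t) n x)).
apply: ccvg_lim; apply: (@ccvg_near _ _ _ (absz k)) => n kn.
rewrite /Dalpha_partial -(big_zl n (fun j => (`|j%:~R : R| `^ alpha)%:C * fourier (tfun th l k t) j * cexp (j%:~R * x))).
have hf j : fourier (tfun th l k t) j = (th t)%:C * E l t * (j == - k)%:R.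
  rewrite -(fourier_cexp (- k) j) -fourierZ; last exact: L1T_cexp.
  by congr (fourier _ j); apply/funext => y; rewrite /tfun mulrNz mulNr.
rewrite (bigD1_seq (- k)) ?zl_uniq ?mem_zl ?abszN//= big1 => [|j jk].
  by rewrite addr0 hf eqxx mulr1 mulrNz normrN mulNr /tfun; ring.
by rewrite hf (negbTE jk) !mulr0 mul0r.
Qed.

End FlatFunction.

(** * Continuity in time and removal of the cutoff *)

Section TimeIntegrals.
Context {R : realType}.
Implicit Types (X Y : R -> R[i]) (a b c t T : R).
Local Notation mu := (@lebesgue_measure R).

Definition ccont a b X := forall t0, t0 \in `[a, b] -> forall e : R, 0 < e ->
  exists2 d : R, 0 < d & forall t, t \in `[a, b] -> `|t - t0| < d -> nc (X t - X t0) <= e.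

Lemma ccont_within a b X : ccont a b X ->
  {within `[a, b], continuous (fun t => Re (X t))} /\
  {within `[a, b], continuous (fun t => Im (X t))}.
Proof.
move=> h; split; apply/subspace_continuousP => t0 /= t0ab; apply/cvgrPdist_le => e e0;
  have [d d0 hd] := h _ t0ab _ e0; near=> t.
- have tab : t \in `[a, b] by near: t; exact: withinT.
  have td : `|t - t0| < d.
    rewrite distrC; near: t; apply: cvg_within; apply/nbhs_normP; exists d => //.
  have := hd _ tab td; apply: le_trans; rewrite distrC -cReN -cReD; exact: Re_le_nc.
- have tab : t \in `[a, b] by near: t; exact: withinT.
  have td : `|t - t0| < d.
    rewrite distrC; near: t; apply: cvg_within; apply/nbhs_normP; exists d => //.
  have := hd _ tab td; apply: le_trans; rewrite distrC -cImN -cImD; exact: Im_le_nc.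
Unshelve. all: by end_near.
Qed.
Lemma ccont_cintg a b X : ccont a b X -> cintg a b X.
Proof. by move=> /ccont_within[h1 h2]; split; exact: rintg_continuous. Qed.
Lemma ccont_bounded a b X : a <= b -> ccont a b X ->
  exists2 B : R, 0 <= B & forall t, t \in `[a, b] -> nc (X t) <= B.
Proof.
move=> ab /ccont_within[h1 h2].
have [t1 _ m1] := EVT_max ab h1; have [t2 _ m2] := EVT_min ab h1.
have [t3 _ m3] := EVT_max ab h2; have [t4 _ m4] := EVT_min ab h2.
exists (`|Re (X t1)| + `|Re (X t2)| + (`|Im (X t3)| + `|Im (X t4)|)).
  by rewrite !addr_ge0.
move=> t tab; apply: (le_trans (nc_le_ReIm _)).
have := m1 _ tab; have := m2 _ tab; have := m3 _ tab; have := m4 _ tab.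
have := ler_norm (Re (X t1)); have := ler_normr (- `|Re (X t2)|) (Re (X t2)).
have := lerNnormlW (lexx `|Re (X t2)|); have := lerNnormlW (lexx `|Im (X t4)|).
have := ler_norm (Im (X t3)).
have n1 := normr_ge0 (Re (X t1)); have n2 := normr_ge0 (Re (X t2)).
have n3 := normr_ge0 (Im (X t3)); have n4 := normr_ge0 (Im (X t4)).
move=> a1 a2 a3 _ a5 a6 a7 a8 a9.
apply: lerD; rewrite ler_norml; apply/andP; split; lra.
Qed.
Lemma ccontS a b a' b' X : a <= a' -> b' <= b -> ccont a b X -> ccont a' b' X.
Proof.
move=> aa bb h; have sub t : t \in `[a', b'] -> t \in `[a, b].
  by rewrite !in_itv /= => /andP[h1 h2]; rewrite (le_trans aa)//= (le_trans h2).
move=> t0 /sub h0 e e0; have [d d0 hd] := h _ h0 _ e0.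
by exists d => // t /sub; exact: hd.
Qed.
Lemma ccontD a b X Y : ccont a b X -> ccont a b Y -> ccont a b (fun t => X t + Y t).
Proof.
move=> hX hY t0 h0 e e0; have e2 : 0 < e / 2 by rewrite divr_gt0.
have [d1 d10 h1] := hX _ h0 _ e2; have [d2 d20 h2] := hY _ h0 _ e2.
exists (Num.min d1 d2); first by rewrite lt_min d10.
move=> t tab; rewrite lt_min => /andP[t1 t2].
have -> : X t + Y t - (X t0 + Y t0) = (X t - X t0) + (Y t - Y t0) by ring.
apply: (le_trans (ncD _ _)); have := h1 _ tab t1; have := h2 _ tab t2; lra.
Qed.
Lemma ccontM a b X Y : a <= b -> ccont a b X -> ccont a b Y -> ccont a b (fun t => X t * Y t).
Proof.
move=> ab hX hY t0 h0 e e0.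
have [B B0 hB] := ccont_bounded ab hX.
have p1 : 0 < e / 2 / (B + 1) by rewrite !divr_gt0//; lra.
have y0 := nc_ge0 (Y t0).
have p2 : 0 < e / 2 / (nc (Y t0) + 1) by rewrite !divr_gt0//; lra.
have [d1 d10 h1] := hX _ h0 _ p2; have [d2 d20 h2] := hY _ h0 _ p1.
exists (Num.min d1 d2); first by rewrite lt_min d10.
move=> t tab; rewrite lt_min => /andP[t1 t2].
have -> : X t * Y t - X t0 * Y t0 = X t * (Y t - Y t0) + (X t - X t0) * Y t0 by ring.
apply: (le_trans (ncD _ _)); rewrite !ncM.
have b1 := hB _ tab; have b2 := nc_ge0 (X t).
have c1 := nc_ge0 (Y t - Y t0); have c2 := nc_ge0 (X t - X t0).
have := h2 _ tab t2; rewrite ler_pdivlMr; last by lra.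
have := h1 _ tab t1; rewrite ler_pdivlMr; last by lra.
move=> k1 k2.
have : nc (X t) * nc (Y t - Y t0) <= nc (Y t - Y t0) * (B + 1) by nra.
have : nc (X t - X t0) * nc (Y t0) <= nc (X t - X t0) * (nc (Y t0) + 1) by nra.
lra.
Qed.
Lemma ccont_cst a b (z : R[i]) : ccont a b (fun=> z).
Proof. by move=> t0 _ e e0; exists 1 => // t _ _; rewrite subrr nc0 ltW. Qed.
Lemma ccont_lip a b X (L : R) : 0 <= L -> (forall t u, t \in `[a, b] -> u \in `[a, b] ->
  nc (X t - X u) <= L * `|t - u|) -> ccont a b X.
Proof.
move=> L0 h t0 h0 e e0; have L1 : 0 < L + 1 by lra.
exists (e / (L + 1)); first by rewrite divr_gt0.
move=> t tab; rewrite ltr_pdivlMr// => ht; apply: (le_trans (h _ _ tab h0)).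
have := normr_ge0 (t - t0); nra.
Qed.
Lemma ccont_real a b (h : R -> R) : continuous h -> ccont a b (fun t => (h t)%:C).
Proof.
move=> ch t0 _ e e0; have /cvgrPdist_le /(_ _ e0) /nbhs_normP [d /= d0 hd] := ch t0.
exists d => // t _ td; rewrite -rmorphB /= nc_real distrC; apply: hd => /=.
by rewrite distrC.
Qed.
Lemma ccont_E a b (l : R[i]) : ccont a b (E l).
Proof.
have h : ccont a b (fun t => (expR (Re l * t) * cos (Im l * t))%:C + 'i * (expR (Re l * t) * sin (Im l * t))%:C).
  have c1 : continuous (fun t => expR (Re l * t)) := smo_continuous (smo_expR 1 _).
  have c2 := @continuous_cosw R (Im l); have c3 := @continuous_sinw R (Im l).
  have cM (u v : R -> R) : continuous u -> continuous v -> continuous (fun x => u x * v x).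
    by move=> hu hv x; apply: cvgM; [exact: hu|exact: hv].
  have ii : ccont a b (fun t => 'i * (expR (Re l * t) * sin (Im l * t))%:C).
    have h := ccont_real (a := a) (b := b) (cM _ _ c1 c3).
    move=> t0 h0 e e0; have [d d0 hd] := h _ h0 _ e0; exists d => // t tab td.
    by rewrite -mulrBr ncM nc_i mul1r hd.
  by apply: ccontD => //; apply: ccont_real; exact: cM.
move=> t0 h0 e e0; have [d d0 hd] := h _ h0 _ e0; exists d => // t tab td.
have eE u : E l u = (expR (Re l * u) * cos (Im l * u))%:C + 'i * (expR (Re l * u) * sin (Im l * u))%:C.
  by apply: complexP; rewrite /E !reimE /=; ring.
by rewrite !eE; exact: hd.
Qed.
Lemma eq_ccont a b X Y : (forall t, t \in `[a, b] -> X t = Y t) -> ccont a b X -> ccont a b Y.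
Proof.
move=> XY h t0 h0 e e0; have [d d0 hd] := h _ h0 _ e0; exists d => // t tab td.
by rewrite -!XY//; exact: hd.
Qed.

(** A smooth approximation of the indicator of t < c: it equals exp(-1/((n+1)(c-t))) before c and 0
    from c on. Its derivative is never positive and tends to minus a unit mass at c. *)
Definition cutoff c n t : R := flat 1 (n.+1%:R * (c - t)).
Definition cutoff' c n t : R := - (n.+1%:R * flat 'X^2 (n.+1%:R * (c - t))).

Lemma is_derive_cutoff c n t : is_derive t (1 : R) (cutoff c n) (cutoff' c n t).
Proof.
have h := @is_derive1_comp _ (flat 1) (fun u => - n.+1%:R * u + n.+1%:R * c) _ _ _ (is_derive_flat 1 (- n.+1%:R * t + n.+1%:R * c)) (is_derive_affine (- n.+1%:R) (n.+1%:R * c) t).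
have e u : - n.+1%:R * u + n.+1%:R * c = n.+1%:R * (c - u) by ring.
rewrite (_ : cutoff c n = flat 1 \o (fun u => - n.+1%:R * u + n.+1%:R * c)).
  by apply: is_derive_eq; rewrite /cutoff' e derivC subr0 mulr1; ring.
by apply/funext => u; rewrite /cutoff /= e.
Qed.
Lemma smo_cutoff c n m : smo m (cutoff c n).
Proof.
rewrite (_ : cutoff c n = fun u => flat 1 (- n.+1%:R * u + n.+1%:R * c)).
  exact: smo_comp (smo_flat _ _).
by apply/funext => u; rewrite /cutoff; congr flat; ring.
Qed.
Lemma cutoff_eq0 c n t : c <= t -> cutoff c n t = 0 /\ cutoff' c n t = 0.
Proof.
move=> ct; have h : (0 < n.+1%:R * (c - t)) = false by rewrite pmulr_rgt0// subr_gt0 ltNge ct.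
by rewrite /cutoff /cutoff' /flat h mulr0 oppr0.
Qed.
Lemma cutoff'_le0 c n t : cutoff' c n t <= 0.
Proof.
rewrite /cutoff' oppr_le0 mulr_ge0// /flat; case: ifP => // h.
by rewrite hornerXn mulr_ge0 ?expR_ge0// exprn_ge0// invr_ge0 ltW.
Qed.
Lemma cutoff_bound c n t : 0 <= cutoff c n t <= 1.
Proof.
rewrite /cutoff /flat; case: ifP => h; last by rewrite lexx ler01.
rewrite hornerC mul1r; apply/andP; split; first exact: expR_ge0.
by rewrite -[leRHS]expR0 ler_expR oppr_le0 invr_ge0 ltW.
Qed.
Lemma cutoff_ge c n t : t < c -> 1 - (n.+1%:R * (c - t))^-1 <= cutoff c n t.
Proof.
move=> ct; rewrite /cutoff /flat pmulr_rgt0// subr_gt0 ct hornerC mul1r.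
exact: expR_ge1Dx.
Qed.

(** As n grows, minus the derivative of the cutoff is a weight of mass close to 1 concentrated just
    before c, so the first integral tends to -X(c) while the cutoff in the other terms tends to
    1. *)
Lemma cutoff_limit T c X Y (p : R[i]) : 0 < c < T -> ccont 0 T X -> ccont 0 T Y ->
  (forall n, - cint 0 T (fun t => (cutoff' c n t)%:C * X t) - (cutoff c n 0)%:C * p =
             cint 0 T (fun t => (cutoff c n t)%:C * Y t)) ->
  X c - p = cint 0 c Y.
Proof.
move=> /andP[c0 cT] hX hY h; have T0 : 0 <= T by lra.
have [B B0 hB] := ccont_bounded T0 hX; have [D D0 hD] := ccont_bounded T0 hY.
have dc n := is_derive_cutoff c n.
have ccut n : continuous (cutoff c n) := smo_continuous (smo_cutoff c n 1).
have ccut' n : continuous (cutoff' c n).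
  have [_ s1] := smo_cutoff c n 2; rewrite (derive1_is (dc n)) in s1.
  exact: smo_continuous.
have Xcut n a b : 0 <= a -> b <= T -> cintg a b (fun t => (cutoff' c n t)%:C * X t).
  move=> a0 bT; apply: cintgS a0 bT _; apply: ccont_cintg; apply: ccontM => //; exact: ccont_real.
have Ycut n a b : 0 <= a -> b <= T -> cintg a b (fun t => (cutoff c n t)%:C * Y t).
  move=> a0 bT; apply: cintgS a0 bT _; apply: ccont_cintg; apply: ccontM => //; exact: ccont_real.
have rcut' n a b : rintg a b (cutoff' c n).
  by apply: rintg_continuous; exact: continuous_subspaceT.
have icut a b n : a < b -> \int[mu]_(t in `[a, b]) cutoff' c n t = cutoff c n b - cutoff c n a.
  by move=> ab; apply: rint_derive.
have cT0 n (Z : R -> R[i]) : cint c T (fun t => (cutoff' c n t)%:C * Z t) = 0 /\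
    cint c T (fun t => (cutoff c n t)%:C * Z t) = 0.
  have z a b : cint a b (fun=> 0 : R[i]) = 0.
    by apply: complexP; rewrite /= Rintegral_cst// mul0r.
  by split; rewrite -(z c T); apply: eq_cint => t; rewrite in_itv /= => /andP[/(@cutoff_eq0 c n t)[h1 h2] _];
    rewrite ?h1 ?h2 mul0r.
suff : nc (X c - p - cint 0 c Y) <= 0.
  move=> h0; apply/eqP; rewrite -subr_eq0; apply/eqP/nc_eq0/le_anti.
  by rewrite h0 nc_ge0.
(* The three errors below are at most e times 4 B + 2, B + nc p and 2 D (c + 1); K exceeds their
   sum. *)
pose K := 6 * B + 2 + nc p + 2 * D * (c + 1).
have K0 : 0 < K.
  have := nc_ge0 p; have : 0 <= D * (c + 1) by rewrite mulr_ge0//; lra.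
  rewrite /K; lra.
apply/ler_addgt0Pr => e' e'0; rewrite add0r.
pose e : R := e' / K; have e0 : 0 < e by rewrite divr_gt0.
have eK : e' = K * e by rewrite /e mulrC divfK// gt_eqF.
have cin : c \in `[0, T] by rewrite in_itv /=; lra.
have [d1 d10 hd1] := hX _ cin _ e0.
pose d : R := Num.min (d1 / 2) (Num.min e (c / 2)).
have d0 : 0 < d by rewrite !lt_min; apply/and3P; split; lra.
have dd1 : d <= d1 / 2 by rewrite ge_min lexx.
have de : d <= e by rewrite ge_min ge_min lexx orbT.
have dc2 : d <= c / 2 by rewrite !ge_min lexx !orbT.
(* Then (n + 1) d e > 1, so the cutoff is at least 1 - e before c - d; after c - d, X differs from
   X(c) by at most e. *)
pose n := Num.truncn (d * e)^-1.
have hn : (n.+1%:R * d)^-1 <= e.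
  have de0 : 0 < d * e by rewrite mulr_gt0.
  have : (d * e)^-1 < n.+1%:R by exact: truncnS_gt.
  rewrite -[(d * e)^-1]mul1r ltr_pdivrMr// => h1.
  by rewrite -[leLHS]mul1r ler_pdivrMr ?mulr_gt0//; lra.
clearbody n d e.
pose m := cutoff c n.
have m_ge t : t <= c - d -> 1 - e <= m t.
  move=> tc; have tc' : t < c by lra.
  apply: le_trans (cutoff_ge n tc'); rewrite lerD2l lerN2; apply: le_trans hn.
  have p1 : 0 < n.+1%:R :> R by rewrite ltr0n.
  rewrite lef_pV2 ?posrE ?mulr_gt0// ?subr_gt0//.
  by rewrite ler_pM2l//; lra.
have m_cd : 1 - e <= m (c - d) by exact: m_ge.
have m_0 : 1 - e <= m 0 by apply: m_ge; lra.
have mb t := cutoff_bound c n t.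
have s1 : cint 0 T (fun t => (cutoff' c n t)%:C * X t) = cint 0 c (fun t => (cutoff' c n t)%:C * X t).
  rewrite (cint_split (ltW c0) (ltW cT)); last exact: Xcut.
  by rewrite (cT0 n X).1 addr0.
have s2 : cint 0 T (fun t => (cutoff c n t)%:C * Y t) = cint 0 c (fun t => (cutoff c n t)%:C * Y t).
  rewrite (cint_split (ltW c0) (ltW cT)); last exact: Ycut.
  by rewrite (cT0 n Y).2 addr0.
have := h n; rewrite s1 s2 => hn'.
have cY a b : 0 <= a -> b <= T -> cintg a b Y by move=> a0 bT; apply: cintgS a0 bT _; exact: ccont_cintg.
(* Before c - d the weight has mass at most e, and there X - X(c) is at most 2 B; on [c - d, c] the
   mass is at most 1 and X - X(c) is at most e. *)
have key1 : nc (X c * (m 0)%:C + cint 0 c (fun t => (cutoff' c n t)%:C * X t)) <= 4 * B * e + 2 * e.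
  have -> : X c * (m 0)%:C + cint 0 c (fun t => (cutoff' c n t)%:C * X t) =
     cint 0 c (fun t => (cutoff' c n t)%:C * (X t - X c)).
    have i1 : cintg 0 c (fun t => X c * (cutoff' c n t)%:C).
      by apply: cintgZ; split; [exact: rcut'|exact: rintg_cst].
    have -> : cint 0 c (fun t => (cutoff' c n t)%:C * (X t - X c)) =
       cint 0 c (fun t => (cutoff' c n t)%:C * X t - X c * (cutoff' c n t)%:C).
      by congr cint; apply/funext => t; ring.
    rewrite cintB//; last by apply: Xcut => //; lra.
    rewrite cintZ; last by split; [exact: rcut'|exact: rintg_cst].
    have -> : cint 0 c (fun t => (cutoff' c n t)%:C) = (- m 0)%:C.
      apply: complexP => /=; last by rewrite Rintegral_cst// mul0r.
      by rewrite icut// (cutoff_eq0 n (lexx c)).1 sub0r.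
    rewrite rmorphN /=; ring.
  have i2 a b : 0 <= a -> b <= T -> cintg a b (fun t => (cutoff' c n t)%:C * (X t - X c)).
    move=> a0 bT; apply: cintgS a0 bT _; apply: ccont_cintg; apply: ccontM => //.
      exact: ccont_real.
    by apply: ccontD => //; exact: ccont_cst.
  rewrite (@cint_split _ 0 c (c - d)); [|lra|lra|by apply: i2; lra].
  apply: (le_trans (ncD _ _)); apply: lerD.
  - apply: (le_trans (nc_cint (G := fun t => - (2 * B) * cutoff' c n t) _ _ _)).
    + by apply: i2; lra.
    + exact: rintgZ.
    + move=> t; rewrite in_itv /= => /andP[t0 tc].
      rewrite ncM nc_real ler0_norm ?cutoff'_le0//.
      have -> : - (2 * B) * cutoff' c n t = - cutoff' c n t * (2 * B) by ring.
      rewrite ler_wpM2l ?oppr_ge0 ?cutoff'_le0//; apply: (le_trans (ncB _ _)).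
      have := hB t ltac:(rewrite in_itv /=; lra); have := hB c cin; lra.
    + rewrite RintegralZl//; last exact: rcut'.
      rewrite icut; last by lra.
      rewrite -/m; have := mb 0; rewrite -/m; nra.
  - apply: (le_trans (nc_cint (G := fun t => - e * cutoff' c n t) _ _ _)).
    + by apply: i2; lra.
    + exact: rintgZ.
    + move=> t; rewrite in_itv /= => /andP[t0 tc].
      rewrite ncM nc_real ler0_norm ?cutoff'_le0//.
      have -> : - (e) * cutoff' c n t = - cutoff' c n t * (e) by ring.
      rewrite ler_wpM2l ?oppr_ge0 ?cutoff'_le0//; apply: hd1; first by rewrite in_itv /=; lra.
      by rewrite ltr_distl; lra.
    + rewrite RintegralZl//; last exact: rcut'.
      rewrite icut; last by lra.
      rewrite (cutoff_eq0 n (lexx c)).1 -/m; have := mb (c - d); rewrite -/m; nra.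
(* The cutoff is within e of 1 before c - d, and the remaining interval has length d <= e. *)
have key2 : nc (cint 0 c (fun t => (cutoff c n t)%:C * Y t) - cint 0 c Y) <= 2 * D * (c + 1) * e.
  have i3 a b : 0 <= a -> b <= T -> cintg a b (fun t => (cutoff c n t)%:C * Y t - Y t).
    by move=> a0 bT; apply: cintgB; [exact: Ycut|exact: cY].
  rewrite -cintB; [|by apply: Ycut; lra|by apply: cY; lra].
  have eqf t : (cutoff c n t)%:C * Y t - Y t = (cutoff c n t - 1)%:C * Y t by rewrite rmorphB /=; ring.
  have nD t : t \in `[0, T] -> 0 <= nc (Y t) <= D by move=> tT; rewrite nc_ge0 hD.
  rewrite (@cint_split _ 0 c (c - d)); [|lra|lra|by apply: i3; lra].
  apply: (le_trans (ncD _ _)).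
  apply: (@le_trans _ _ (2 * (D * e) * (c - d - 0) + 2 * D * (c - (c - d)))); last first.
    have : 0 <= D * (e - d) by rewrite mulr_ge0//; lra.
    have : 0 <= (D * e) * d by rewrite !mulr_ge0// ltW.
    lra.
  apply: lerD; apply: nc_cint_cst; try lra; try (apply: i3; lra).
  - move=> t; rewrite in_itv /= => /andP[t0 tc].
    have tT : t \in `[0, T] by rewrite in_itv /=; lra.
    rewrite eqf ncM nc_real ler0_norm; last by have := mb t; lra.
    have := m_ge t tc; have := nD _ tT; have := mb t; rewrite -/m => h1 h2 h3.
    rewrite mulrC; apply: ler_pM => //; lra.
  - move=> t; rewrite in_itv /= => /andP[t0 tc].
    have tT : t \in `[0, T] by rewrite in_itv /=; lra.
    rewrite eqf ncM nc_real ler0_norm; last by have := mb t; lra.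
    have := nD _ tT; have := mb t; rewrite -/m; nra.
have -> : X c - p - cint 0 c Y =
   (X c * (m 0)%:C + cint 0 c (fun t => (cutoff' c n t)%:C * X t)) +
   (X c - p) * (1 - m 0)%:C +
   (cint 0 c (fun t => (cutoff c n t)%:C * Y t) - cint 0 c Y).
  rewrite -hn' -/m rmorphB /=; ring.
apply: (le_trans (ncD _ _)); apply: (le_trans (lerD (ncD _ _) (lexx _))).
have key3 : nc ((X c - p) * (1 - m 0)%:C) <= (B + nc p) * e.
  rewrite ncM nc_real ger0_norm; last by have := mb 0; rewrite -/m; lra.
  apply: ler_pM; rewrite ?nc_ge0//; last by lra.
    by have := mb 0; rewrite -/m; lra.
  by apply: (le_trans (ncB _ _)); rewrite lerD2r hB.
apply: (le_trans (lerD (lerD key1 key3) key2)).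
rewrite eK.
rewrite /K; have : 0 <= B * e by rewrite mulr_ge0// ltW.
have := nc_ge0 p; nra.
Qed.

End TimeIntegrals.

(** * From weak solutions to integral identities for Fourier coefficients *)

Section Trajectories.
Context {R : realType}.
Implicit Types (f g : R -> R[i]) (u v : R -> R -> R[i]) (a b c t T s alpha M : R) (k j : int).
Local Notation mu := (@lebesgue_measure R).
Local Notation pi := (@pi R).
Local Notation poly4 := (mpoly.mpoly 4 R[i]).

Lemma L2T_sq f : L2T f -> rintg (- pi) pi (fun x => nc (f x) ^+ 2).
Proof.
move=> [_ m1 m2 h]; apply/integrableP; split.
  apply/measurable_EFinP; apply: measurable_funTS.
  by apply: measurable_funX; exact: cmeas_nc.
apply: le_lt_trans h; rewrite le_eqVlt; apply/orP; left; apply/eqP.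
by apply: eq_integral => x _ /=; rewrite ger0_norm// sqr_ge0.
Qed.
Lemma L2T_comb f g (a : R[i]) : L2T f -> L2T g -> L2T (fun x => f x + a * g x).
Proof.
move=> hf hg; have [pf mf1 mf2 _] := hf; have [pg mg1 mg2 _] := hg.
have [m1 m2] : cmeas (fun x => f x + a * g x).
  by apply: cmeasD => //; apply: cmeasM => //; exact: cmeas_cst.
split=> //; first by move=> x; rewrite pf pg.
have h := rintgD (rintgZ 2 (L2T_sq hf)) (rintgZ (2 * nc a ^+ 2) (L2T_sq hg)).
have : rintg (- pi) pi (fun x => nc (f x + a * g x) ^+ 2).
  apply: (rintg_le _ h).
    by apply: measurable_funTS; apply: measurable_funX; exact: cmeas_nc.
  move=> x _; rewrite ger0_norm ?sqr_ge0//.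
  have h1 := ncD (f x) (a * g x); rewrite ncM in h1.
  have h2 := nc_ge0 (f x + a * g x).
  apply: (@le_trans _ _ ((nc (f x) + nc a * nc (g x)) ^+ 2)).
    by rewrite ler_pXn2r ?nnegrE// (le_trans h2).
  have := sqr_ge0 (nc (f x) - nc a * nc (g x)); lra.
move=> /integrableP[_]; apply: le_lt_trans; rewrite le_eqVlt; apply/orP; left; apply/eqP.
by apply: eq_integral => x _ /=; rewrite ger0_norm// sqr_ge0.
Qed.
Lemma Hs_comb s f g (a : R[i]) : 0 <= s -> Hs s f -> Hs s g -> Hs s (fun x => f x + a * g x).
Proof.
move=> s0 hf hg; apply: (Hbd_Hs s0); first by apply: L2T_comb; [case: hf|case: hg].
by apply: HbdD; [exact: Hs_Hbd|apply: HbdZ; exact: Hs_Hbd].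
Qed.
Lemma Hs_sub s f g : 0 <= s -> Hs s f -> Hs s g -> Hs s (f \- g).
Proof.
move=> s0 hf hg; have := Hs_comb (-1) s0 hf hg.
by rewrite (_ : (fun x => _) = f \- g)//; apply/funext => x; rewrite mulN1r.
Qed.

Lemma C_Hs_coef s a b u : 0 <= s -> C_Hs s a b u -> forall t0, t0 \in `[a, b] ->
  forall e : R, 0 < e -> exists2 d : R, 0 < d & forall t, t \in `[a, b] -> `|t - t0| < d ->
    Hbd s (u t \- u t0) e.
Proof.
move=> s0 h t0 t0ab e e0; have [hu0 cv] := h _ t0ab.
have p0 : 0 < 2 `^ (s / 2) :> R by rewrite powR_gt0.
have e1 : 0 < e / 2 `^ (s / 2) by rewrite divr_gt0.
have /cvgrPdist_le /(_ _ e1) := cv.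
rewrite near_withinE => /nbhs_normP [d /= d0 hd]; exists d => // t tab td.
have hut : Hs s (u t) by have [] := h _ tab.
have := Hs_Hbd s0 (Hs_sub s0 hut hu0); apply: Hbd_mono => //.
rewrite mulrC -ler_pdivlMr//.
have := hd t; rewrite /= distrC => /(_ td tab); rewrite sub0r normrN.
by apply: le_trans; exact: ler_norm.
Qed.

(** What the rest of the proof retains of a solution: an H^s bound, equicontinuity of the weighted
    coefficients, and the Duhamel identity with a free complex rate l. A backward solution becomes
    one with sg = -1 after reversal of time. *)
Definition trajectory s alpha (F : poly4) (sg : R[i]) M T (phi : int -> R[i]) v := [/\
  forall t, t \in `[0, T] -> Hbd s (v t) M,
  forall t0, t0 \in `[0, T] -> forall e : R, 0 < e -> exists2 d : R, 0 < d &
    forall t, t \in `[0, T] -> `|t - t0| < d ->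
      forall j, nc (fourier (v t) j - fourier (v t0) j) <= e * w j `^ (- s) &
  forall k (l : R[i]) c, 0 < c < T ->
    fourier (v c) k * E l c - phi k = cint 0 c (fun t => E l t *
      ((l - sg * 'i * (`|k%:~R : R| `^ alpha)%:C) * fourier (v t) k + sg * fourier (nonlin F (v t)) k))].

Lemma cint_zero_ext a b a' b' X : a <= a' -> b' <= b ->
  (forall t, t \in `[a, b] -> t \notin `[a', b'] -> X t = 0) ->
  cint a b X = cint a' b' X.
Proof.
move=> aa bb h.
have key (g : R -> R) : (forall t, t \in `[a, b] -> t \notin `[a', b'] -> g t = 0) ->
    \int[mu]_(t in `[a, b]) g t = \int[mu]_(t in `[a', b']) g t.
  move=> hg; rewrite Rintegral_mkcond [RHS]Rintegral_mkcond; congr Rintegral.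
  apply/funext => t; rewrite !patchE.
  have e1 (x y : R) : (t \in (`[x, y]%classic : set R)) = (t \in `[x, y]).
    by apply/idP/idP => [/set_mem|/mem_set].
  rewrite !e1; case: (boolP (t \in `[a', b'])) => h1.
    by rewrite ifT//; move: h1; rewrite !in_itv /= => /andP[h1 h2]; rewrite (le_trans aa)//= (le_trans h2).
  by case: ifPn => // h2; rewrite hg.
by apply: complexP => /=; apply: key => t h1 h2; rewrite h.
Qed.

Lemma cint_opp T X : 0 <= T -> ccont 0 T X -> cint (- T) 0 (fun t => X (- t)) = cint 0 T X.
Proof.
move=> T0 /ccont_within [c1 c2].
have key (g : R -> R) : {within `[0, T], continuous g} ->
    \int[mu]_(t in `[- T, 0]) g (- t) = \int[mu]_(t in `[0, T]) g t.
  move=> cg; rewrite /Rintegral; congr fine.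
  have NT0 : - T <= 0 by lra.
  have := @integration_by_substitution_oppr R g (- T) 0 NT0.
  by rewrite oppr0 opprK => ->.
by apply: complexP => /=; exact: key.
Qed.

Lemma eq_ccont_E a b (l : R[i]) X : a <= b -> ccont a b X -> ccont a b (fun t => E l t * X t).
Proof. by move=> ab h; apply: ccontM => //; exact: ccont_E. Qed.

Lemma ccont_trajectory s M T v (F : poly4) k : 5/2 < s -> 
  (forall t, t \in `[0, T] -> Hbd s (v t) M) ->
  (forall t0, t0 \in `[0, T] -> forall e : R, 0 < e -> exists2 d : R, 0 < d &
    forall t, t \in `[0, T] -> `|t - t0| < d ->
      forall j, nc (fourier (v t) j - fourier (v t0) j) <= e * w j `^ (- s)) ->
  ccont 0 T (fun t => fourier (v t) k) /\ ccont 0 T (fun t => fourier (nonlin F (v t)) k).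
Proof.
move=> s52 hM hc; split=> t0 h0 e e0.
  have [d d0 hd] := hc _ h0 _ e0; exists d => // t tT td.
  apply: (le_trans (hd _ tT td k)); rewrite ler_piMr ?(ltW e0)//.
  by rewrite -(powRr0 (w k)); apply: wX_mono; lra.
have [C C0 hC] := nonlin_cont M F s52.
have C1 : 0 < C + 1 by lra.
have e1 : 0 < e / (C + 1) by rewrite divr_gt0.
have [d d0 hd] := hc _ h0 _ e1; exists d => // t tT td.
apply: (le_trans (hC _ _ (hM _ tT) (hM _ h0) _ (ltW e1) (hd _ tT td) k)).
by rewrite mulrA ler_pdivrMr// mulrC ler_wpM2l ?ltW//; lra.
Qed.

Lemma L1T_nonlin s M (F : poly4) f : 5/2 < s -> Hbd s f M -> L1T (nonlin F f).
Proof.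
move=> s52 hf; have [K _ [h _]] := @poly_lip R (s - 1) ltac:(lra) F M.
by have [] := h (Jet f) (fun i => Hbd_Jet s52 hf i).
Qed.

Lemma intT0 : intT (fun=> 0) = 0 :> R[i].
Proof. by rewrite -fourier0 fourier_cst mul0r. Qed.

Lemma intT_tfun f (z : R[i]) k : L1T f -> intT (fun x => f x * (z * cexp (- (k%:~R * x)))) = z * fourier f k.
Proof.
move=> lf; rewrite /fourier -intTZ; last exact: L1T_ftest.
by congr intT; apply/funext => x; rewrite mulrCA.
Qed.

Lemma Dalpha_tfunE alpha (th : R -> R) (l : R[i]) k t x :
  Dalpha alpha (tfun th l k t) x =
  (`|k%:~R : R| `^ alpha)%:C * ((th t)%:C * E l t) * cexp (- (k%:~R * x)).
Proof. by rewrite Dalpha_tfun /tfun mulrA. Qed.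

(** Testing with [tfun (cutoff c n) l k] and letting n tend to infinity by [cutoff_limit]. Since c <
    T0, the test function vanishes from c on, so only [0, T0], where the H^s bound holds,
    contributes. *)
Lemma solution_fwd_trajectory s alpha (F : poly4) T T0 M phi u : 5/2 < s -> 0 < T0 < T -> L1T phi ->
  (forall t, t \in `[0, T0] -> Hbd s (u t) M) -> C_Hs s 0 T u ->
  solution_fwd alpha F s T phi u -> trajectory s alpha F 1 M T0 (fourier phi) u.
Proof.
move=> s52 /andP[T00 T0T] lphi hM hC [_ hw].
have s0 : 0 <= s by lra.
have cont t0 : t0 \in `[0, T0] -> forall e : R, 0 < e -> exists2 d : R, 0 < d &
    forall t, t \in `[0, T0] -> `|t - t0| < d ->
      forall j, nc (fourier (u t) j - fourier (u t0) j) <= e * w j `^ (- s).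
  have sub t : t \in `[0, T0] -> t \in `[0, T] by rewrite !in_itv /=; lra.
  move=> h0 e e0; have [d d0 hd] := C_Hs_coef s0 hC (sub _ h0) e0.
  exists d => // t tT td j; have := Hbd_pt j (hd _ (sub _ tT) td).
  by rewrite fourierB//; [have [] := hM _ tT|have [] := hM _ h0].
split=> // k l c /andP[c0 cT0].
have [cU cN] := ccont_trajectory F k s52 hM cont.
have T0' := ltW T00.
set A := `|k%:~R : R| `^ alpha.
have cX : ccont 0 T0 (fun t => fourier (u t) k * E l t).
  by apply: ccontM => //; exact: ccont_E.
have cEN : ccont 0 T0 (fun t => E l t * fourier (nonlin F (u t)) k) by exact: eq_ccont_E.
have cY : ccont 0 T0 (fun t => E l t * ((l - 1 * 'i * A%:C) * fourier (u t) k + 1 * fourier (nonlin F (u t)) k)).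
  apply: eq_ccont_E => //; apply: ccontD; apply: ccontM => //; exact: ccont_cst.
apply: (cutoff_limit (T := T0) (X := fun t => fourier (u t) k * E l t)) => //; first by rewrite c0.
move=> n; pose th := cutoff c n; pose th' := cutoff' c n.
have dth t : is_derive t (1 : R) th (th' t) by exact: is_derive_cutoff.
have test : test_fwd T (tfun th l k).
  split; first by apply: smooth_tfun => m; exact: smo_cutoff.
  exists c; first by lra.
  move=> t x ct; rewrite /tfun /th (cutoff_eq0 n (ltW ct)).1 rmorph0; ring.
have := hw _ test; rewrite /weak_identity.
have z t : t \in `[0, T] -> t \notin `[0, T0] -> c <= t.
  by rewrite !in_itv /= => /andP[-> tT] /=; rewrite -ltNge => h; lra.
have t0T : 0 <= 0 :> R by [].
rewrite !(@cint_zero_ext 0 T 0 T0) ?(ltW T0T)//; last 3 first.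
- move=> t tT /(z _ tT) ct; rewrite -[RHS]intT0; congr intT; apply/funext => x.
  by rewrite /tfun /th (cutoff_eq0 n ct).1 rmorph0; ring.
- move=> t tT /(z _ tT) ct; rewrite -[RHS]intT0; congr intT; apply/funext => x.
  by rewrite Dalpha_tfun /tfun /th (cutoff_eq0 n ct).1 rmorph0; ring.
- move=> t tT /(z _ tT) ct; rewrite -[RHS]intT0; congr intT; apply/funext => x.
  by rewrite (dt_tfun _ _ _ _ dth) /th (cutoff_eq0 n ct).1 /th' (cutoff_eq0 n ct).2 rmorph0; ring.
have lu t : t \in `[0, T0] -> L1T (u t) by move=> /hM [].
have r1 : cint 0 T0 (fun t => intT (fun x => u t x * dt (tfun th l k) t x)) =
    cint 0 T0 (fun t => (th' t)%:C * (fourier (u t) k * E l t) + l * ((th t)%:C * (fourier (u t) k * E l t))).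
  apply: eq_cint => t tT; under [in LHS]eq_fun do rewrite (dt_tfun _ _ _ _ dth).
  rewrite intT_tfun; last exact: lu.
  by move: (fourier _ _) (E l t) ((th t)%:C) ((th' t)%:C) => z1 z2 z3 z4; ring.
have r2 : cint 0 T0 (fun t => intT (fun x => u t x * Dalpha alpha (tfun th l k t) x)) =
    cint 0 T0 (fun t => A%:C * ((th t)%:C * (fourier (u t) k * E l t))).
  apply: eq_cint => t tT; under [in LHS]eq_fun do rewrite Dalpha_tfunE.
  rewrite intT_tfun; last exact: lu.
  by move: (fourier _ _) (E l t) ((th t)%:C) => z1 z2 z3; ring.
have r3 : cint 0 T0 (fun t => intT (fun x => nonlin F (u t) x * tfun th l k t x)) =
    cint 0 T0 (fun t => (th t)%:C * (E l t * fourier (nonlin F (u t)) k)).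
  apply: eq_cint => t tT; rewrite /tfun intT_tfun; first by ring.
  exact: L1T_nonlin s52 (hM _ tT).
have r4 : intT (fun x => phi x * tfun th l k 0 x) = (th 0)%:C * fourier phi k.
  by rewrite /tfun intT_tfun// E0 mulr1.
have ccth : ccont 0 T0 (fun t => (th t)%:C) by apply: ccont_real; exact: smo_continuous (smo_cutoff c n 1).
have ccth' : ccont 0 T0 (fun t => (th' t)%:C).
  apply: ccont_real; have [_ s1] := smo_cutoff c n 2; rewrite (derive1_is dth) in s1.
  exact: smo_continuous.
have i1 : cintg 0 T0 (fun t => (th' t)%:C * (fourier (u t) k * E l t)).
  by apply: ccont_cintg; exact: ccontM.
have i2 : cintg 0 T0 (fun t => (th t)%:C * (fourier (u t) k * E l t)).
  by apply: ccont_cintg; exact: ccontM.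
have i3 : cintg 0 T0 (fun t => (th t)%:C * (E l t * fourier (nonlin F (u t)) k)).
  by apply: ccont_cintg; exact: ccontM.
have il := cintgZ l i2.
rewrite r1 r2 r3 r4 (cintD i1 il) (cintZ l i2) (cintZ A%:C i2).
have -> : cint 0 T0 (fun t => (cutoff c n t)%:C * (E l t * ((l - 1 * 'i * A%:C) * fourier (u t) k + 1 * fourier (nonlin F (u t)) k))) =
   cint 0 T0 (fun t => (l - 'i * A%:C) * ((th t)%:C * (fourier (u t) k * E l t)) + (th t)%:C * (E l t * fourier (nonlin F (u t)) k)).
  by apply: eq_cint => t _; rewrite /th; ring.
rewrite cintD ?cintZ//; last exact: cintgZ.
rewrite -/th -/th'; move: (cint _ _ _) (cint _ _ _) (cint _ _ _) => a1 a2 a3 h.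
rewrite -h; ring.
Qed.

(** The same test functions reflected in time: the cutoff is taken at -t and the rate is -l, so that
    [E (- l) t] is [E l (- t)] and the integrals over [-T0, 0] are carried to [0, T0]. *)
Lemma solution_bwd_trajectory s alpha (F : poly4) T T0 M phi u : 5/2 < s -> 0 < T0 < T -> L1T phi ->
  (forall t, t \in `[0, T0] -> Hbd s (u (- t)) M) -> C_Hs s (- T) 0 u ->
  solution_bwd alpha F s T phi u -> trajectory s alpha F (-1) M T0 (fourier phi) (fun t => u (- t)).
Proof.
move=> s52 /andP[T00 T0T] lphi hM hC [_ hw].
have s0 : 0 <= s by lra.
have cont t0 : t0 \in `[0, T0] -> forall e : R, 0 < e -> exists2 d : R, 0 < d &
    forall t, t \in `[0, T0] -> `|t - t0| < d ->
      forall j, nc (fourier (u (- t)) j - fourier (u (- t0)) j) <= e * w j `^ (- s).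
  have sub t : t \in `[0, T0] -> - t \in `[- T, 0] by rewrite !in_itv /=; lra.
  move=> h0 e e0; have [d d0 hd] := C_Hs_coef s0 hC (sub _ h0) e0.
  exists d => // t tT td j.
  have td' : `|- t - - t0| < d by rewrite -opprD normrN.
  have := Hbd_pt j (hd _ (sub _ tT) td').
  by rewrite fourierB//; [have [] := hM _ tT|have [] := hM _ h0].
split=> // k l c /andP[c0 cT0].
have [cU cN] := ccont_trajectory F k s52 hM cont.
have T0' := ltW T00.
set A := `|k%:~R : R| `^ alpha.
have cX : ccont 0 T0 (fun t => fourier (u (- t)) k * E l t).
  by apply: ccontM => //; exact: ccont_E.
have cEN : ccont 0 T0 (fun t => E l t * fourier (nonlin F (u (- t))) k) by exact: eq_ccont_E.
have cY : ccont 0 T0 (fun t => E l t * ((l - -1 * 'i * A%:C) * fourier (u (- t)) k + -1 * fourier (nonlin F (u (- t))) k)).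
  apply: eq_ccont_E => //; apply: ccontD; apply: ccontM => //; exact: ccont_cst.
apply: (cutoff_limit (T := T0) (X := fun t => fourier (u (- t)) k * E l t)) => //; first by rewrite c0.
move=> n; pose th t := cutoff c n (- t); pose th' t := - cutoff' c n (- t).
have dth t : is_derive t (1 : R) th (th' t).
  have h := @is_derive1_comp _ (cutoff c n) (fun u : R => - u) _ _ _ (is_derive_cutoff c n (- t))
    (is_deriveN (is_derive_id t (1 : R))).
  by apply: is_derive_eq; rewrite /th' mulrN1.
have smth m : smo m th.
  have := smo_comp (-1) 0 (smo_cutoff c n m).
  by under eq_fun do rewrite addr0 mulN1r.
have test : test_bwd T (tfun th (- l) k).
  split; first exact: smooth_tfun.
  exists (- c); first by lra.
  move=> t x ct; have ct' : c <= - t by lra.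
  rewrite /tfun /th (cutoff_eq0 n ct').1 rmorph0; ring.
have := hw _ test; rewrite /weak_identity.
have z t : t \in `[- T, 0] -> t \notin `[- T0, 0] -> c <= - t.
  by rewrite !in_itv /= => /andP[tT ->]; rewrite andbT -ltNge => h; lra.
have NT0T : - T <= - T0 by lra.
rewrite !(@cint_zero_ext (- T) 0 (- T0) 0)//; last 3 first.
- move=> t tT /(z _ tT) ct; rewrite -[RHS]intT0; congr intT; apply/funext => x.
  by rewrite /tfun /th (cutoff_eq0 n ct).1 rmorph0; ring.
- move=> t tT /(z _ tT) ct; rewrite -[RHS]intT0; congr intT; apply/funext => x.
  by rewrite Dalpha_tfun /tfun /th (cutoff_eq0 n ct).1 rmorph0; ring.
- move=> t tT /(z _ tT) ct; rewrite -[RHS]intT0; congr intT; apply/funext => x.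
  by rewrite (dt_tfun _ _ _ _ dth) /th (cutoff_eq0 n ct).1 /th' (cutoff_eq0 n ct).2 oppr0 rmorph0; ring.
have lu t : t \in `[0, T0] -> L1T (u (- t)) by move=> /hM [].
have opp_itv t : t \in `[- T0, 0] -> - t \in `[0, T0] by rewrite !in_itv /=; lra.
have EN t : E (- l) t = E l (- t) by rewrite /E cReN cImN !mulrN !mulNr.
pose X t := fourier (u (- t)) k * E l t.
pose Y t := E l t * fourier (nonlin F (u (- t))) k.
pose m t := cutoff c n t; pose m' t := cutoff' c n t.
have ccm : ccont 0 T0 (fun t => (m t)%:C) by apply: ccont_real; exact: smo_continuous (smo_cutoff c n 1).
have ccm' : ccont 0 T0 (fun t => (m' t)%:C).
  apply: ccont_real; have [_ s1] := smo_cutoff c n 2; rewrite (derive1_is (is_derive_cutoff c n)) in s1.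
  exact: smo_continuous.
have mX : ccont 0 T0 (fun t => (m t)%:C * X t) by exact: ccontM.
have m'X : ccont 0 T0 (fun t => (m' t)%:C * X t) by exact: ccontM.
have mY : ccont 0 T0 (fun t => (m t)%:C * Y t) by exact: ccontM.
have cz (z0 : R[i]) Z : ccont 0 T0 Z -> ccont 0 T0 (fun t => z0 * Z t).
  by move=> hZ; apply: ccontM => //; exact: ccont_cst.
have r1 : cint (- T0) 0 (fun t => intT (fun x => u t x * dt (tfun th (- l) k) t x)) =
    cint 0 T0 (fun t => (-1) * ((m' t)%:C * X t) + (- l) * ((m t)%:C * X t)).
  rewrite -cint_opp//; last by apply: ccontD; exact: cz.
  apply: eq_cint => t /opp_itv tT; under [in LHS]eq_fun do rewrite (dt_tfun _ _ _ _ dth).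
  rewrite intT_tfun; last by move: (lu _ tT); rewrite opprK; apply.
  rewrite /X opprK EN /th /th' /m /m' rmorphN /=; ring.
have r2 : cint (- T0) 0 (fun t => intT (fun x => u t x * Dalpha alpha (tfun th (- l) k t) x)) =
    cint 0 T0 (fun t => A%:C * ((m t)%:C * X t)).
  rewrite -cint_opp//; last exact: cz.
  apply: eq_cint => t /opp_itv tT; under [in LHS]eq_fun do rewrite Dalpha_tfunE.
  rewrite intT_tfun; last by move: (lu _ tT); rewrite opprK; apply.
  rewrite /X opprK EN /th /m; ring.
have r3 : cint (- T0) 0 (fun t => intT (fun x => nonlin F (u t) x * tfun th (- l) k t x)) =
    cint 0 T0 (fun t => (m t)%:C * Y t).
  rewrite -cint_opp//.
  apply: eq_cint => t /opp_itv tT; rewrite /tfun intT_tfun; last first.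
    by move: (hM _ tT); rewrite opprK => hMt; exact: L1T_nonlin s52 hMt.
  rewrite /Y opprK EN /th /m; ring.
have r4 : intT (fun x => phi x * tfun th (- l) k 0 x) = (m 0)%:C * fourier phi k.
  by rewrite /tfun intT_tfun// E0 mulr1 /th oppr0.
have i1 := ccont_cintg m'X; have i2 := ccont_cintg mX; have i3 := ccont_cintg mY.
have j1 := cintgZ (-1) i1; have j2 := cintgZ (- l) i2.
rewrite r1 r2 r3 r4 (cintD j1 j2) !cintZ//.
have -> : cint 0 T0 (fun t => (cutoff c n t)%:C * (E l t * ((l - -1 * 'i * A%:C) * fourier (u (- t)) k + -1 * fourier (nonlin F (u (- t))) k))) =
   cint 0 T0 (fun t => (l + 'i * A%:C) * ((m t)%:C * X t) + (-1) * ((m t)%:C * Y t)).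
  by apply: eq_cint => t _; rewrite /m /X /Y; ring.
rewrite cintD ?cintZ//; try exact: cintgZ.
rewrite -/(m 0); move: (cint _ _ _) (cint _ _ _) (cint _ _ _) => a1 a2 a3 h.
by apply: oppr_inj; rewrite !opprD !mulNr !opprK mul1r -h; ring.
Qed.

End Trajectories.

(** * Smoothing of non-resonant interactions *)

Section TrajectoryRegularity.
Context {R : realType}.
Implicit Types (f g : R -> R[i]) (v : R -> R -> R[i]) (a b c t T s alpha M p : R) (k j l : int).
Local Notation mu := (@lebesgue_measure R).
Local Notation poly4 := (mpoly.mpoly 4 R[i]).

Lemma nonlin_Hbd s M (F : poly4) : 5/2 < s -> exists2 K, 0 <= K &
  forall f, Hbd s f M -> Hbd (s - 1) (nonlin F f) K.
Proof.
move=> s52; have [K K0 [h _]] := @poly_lip R (s - 1) ltac:(lra) F M.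
by exists K => // f hf; apply: (h (Jet f)) => i; exact: Hbd_Jet.
Qed.

(** An integral form of the triangle inequality: a weighted sum bounded at each time yields the same
    for the sum of integrals. It turns bounds on time derivatives into bounds on increments, summed
    over frequencies. *)
Lemma sum_nc_cint I (r : seq I) (c : I -> R) (Z : I -> R -> R[i]) a b (K : R) : a <= b ->
  (forall i, 0 <= c i) -> (forall i, ccont a b (Z i)) ->
  (forall t, t \in `[a, b] -> \sum_(i <- r) c i * nc (Z i t) <= K) ->
  \sum_(i <- r) c i * nc (cint a b (Z i)) <= 2 * K * (b - a).
Proof.
move=> ab c0 hZ hK.
have iRe i : rintg a b (fun t => `|Re (Z i t)|) by apply: rintg_abs; have [] := ccont_cintg (hZ i).
have iIm i : rintg a b (fun t => `|Im (Z i t)|) by apply: rintg_abs; have [] := ccont_cintg (hZ i).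
have isum : forall (q : seq I), rintg a b (fun t => \sum_(i <- q) c i * (`|Re (Z i t)| + `|Im (Z i t)|)) /\
   \sum_(i <- q) c i * nc (cint a b (Z i)) <= \int[mu]_(t in `[a, b]) (\sum_(i <- q) c i * (`|Re (Z i t)| + `|Im (Z i t)|)).
  elim=> [|i q [IH1 IH2]].
    rewrite big_nil; have -> : (fun t => \sum_(i <- [::]) c i * (`|Re (Z i t)| + `|Im (Z i t)|)) = cst 0.
      by apply/funext => t; rewrite big_nil.
    by split; [exact: rintg_cst|rewrite rint_cst// mul0r].
  have i1 : rintg a b (fun t => c i * (`|Re (Z i t)| + `|Im (Z i t)|)).
    by apply: rintgZ; exact: rintgD.
  have -> : (fun t => \sum_(i <- i :: q) c i * (`|Re (Z i t)| + `|Im (Z i t)|)) =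
      (fun t => c i * (`|Re (Z i t)| + `|Im (Z i t)|) + \sum_(i <- q) c i * (`|Re (Z i t)| + `|Im (Z i t)|)).
    by apply/funext => t; rewrite big_cons.
  split; first exact: rintgD.
  rewrite big_cons RintegralD//; apply: lerD => //.
  rewrite RintegralZl//; last exact: rintgD.
  rewrite ler_wpM2l//; rewrite RintegralD; [|by []|exact: iRe|exact: iIm]; have [z1 z2] := ccont_cintg (hZ i); apply: (@le_trans _ _ _ _ _ (nc_le_ReIm (cint a b (Z i)))).
  by apply: lerD; exact: le_normr_Rintegral.
have [i1 h1] := isum r; apply: (le_trans h1).
rewrite -(rint_cst (2 * K) ab); apply: rint_le => //; first exact: rintg_cst.
move=> t tab; apply: (@le_trans _ _ (2 * \sum_(i <- r) c i * nc (Z i t))); last first.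
  by rewrite ler_wpM2l// hK.
rewrite mulr_sumr; apply: ler_sum => i _; rewrite mulrCA ler_wpM2l//.
have := Re_le_nc (Z i t); have := Im_le_nc (Z i t); lra.
Qed.

Lemma cint_shift a b d X : a <= b -> ccont (a + d) (b + d) X ->
  cint (a + d) (b + d) X = cint a b (fun t => X (t + d)).
Proof.
move=> ab /ccont_within [c1 c2].
have key (g : R -> R) : {within `[a + d, b + d], continuous g} ->
    \int[mu]_(t in `[a + d, b + d]) g t = \int[mu]_(t in `[a, b]) g (t + d).
  move=> cg; rewrite /Rintegral; congr fine.
  have dF (x : R) : is_derive x (1 : R) (fun x : R => x + d) 1.
    have := is_derive_affine 1 d x; by under eq_fun do rewrite mul1r.
  have dE : derive1 (fun x : R => x + d) = cst 1 by exact: derive1_is dF.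
  have cF : continuous (fun x : R => x + d).
    by move=> x; apply: cvgD; [exact: cvg_id|exact: cvg_cst].
  rewrite (@integration_by_substitution_increasing R (fun x : R => x + d) g a b ab).
  - by apply: eq_integral => x _; rewrite dE /= mulr1.
  - by move=> x y _ _ xy; rewrite ltrD2r.
  - by rewrite dE => x _; exact: cvg_cst.
  - by rewrite dE; apply/cvg_ex; exists 1; exact: cvg_cst.
  - by rewrite dE; apply/cvg_ex; exists 1; exact: cvg_cst.
  - split; [by move=> x _; have [] := dF x| |].
    + by apply: cvg_at_right_filter; exact: cF.
    + by apply: cvg_at_left_filter; exact: cF.
  - exact: cg.
by apply: complexP => /=; exact: key.
Qed.

Lemma rint_expN (r : R) T : 0 < r -> 0 <= T -> \int[mu]_(t in `[0, T]) expR (- r * t) <= r^-1.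
Proof.
move=> r0 T0; have [->|Tn0] := eqVneq T 0.
  by rewrite set_itv1 Rintegral_set1 invr_ge0 ltW.
have T00 : 0 < T by rewrite lt_neqAle eq_sym Tn0.
have d1 (t : R) : is_derive t (1 : R) (fun t => - r^-1 * expR (- r * t)) (expR (- r * t)).
  have h := is_derive1_comp (is_derive_expR (- r * t)) (is_deriveZ (- r) (is_derive_id t (1 : R))).
  have h2 := is_deriveZ (- r^-1) h.
  apply: is_derive_eq; rewrite /GRing.scale /= mulr1.
  have rr : r^-1 * r = 1 by rewrite mulVf// gt_eqF.
  have -> : - r^-1 * (expR (- r * t) * - r) = (r^-1 * r) * expR (- r * t) by ring.
  by rewrite rr mul1r.
rewrite (rint_derive T00 d1); last exact: smo_continuous (smo_expR 1 _).
rewrite mulr0 expR0; have := expR_gt0 (- r * T); have : 0 < r^-1 by rewrite invr_gt0.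
nra.
Qed.

(* Shifting t by the half period pi / |Im l| changes the sign of e^{lt}, which turns the
   integral into one of the increments of X. *)
Lemma osc_bound (l : R[i]) X T (B L : R) : 0 <= B -> 0 <= L -> Re l < 0 -> Im l != 0 -> pi / `|Im l| <= T ->
  (forall t, t \in `[0, T] -> nc (X t) <= B) ->
  (forall t t', t \in `[0, T] -> t' \in `[0, T] -> nc (X t - X t') <= L * `|t - t'|) ->
  nc (cint 0 T (fun t => E l t * X t)) <= pi / `|Im l| * (4 * B + 2 * L / - Re l).
Proof.
move=> B0 L0 l0 li dT hB hL.
set d := pi / `|Im l| in dT *.
have d0 : 0 < d by rewrite divr_gt0 ?pi_gt0 ?normr_gt0.
have T0 : 0 <= T by lra.
have cX : ccont 0 T X by exact: ccont_lip hL.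
have cEX : ccont 0 T (fun t => E l t * X t) by apply: ccontM => //; exact: ccont_E.
have iEX a b : 0 <= a -> b <= T -> cintg a b (fun t => E l t * X t).
  by move=> a0 bT; apply: cintgS a0 bT _; exact: ccont_cintg.
pose q := expR (Re l * d).
have q01 : 0 <= q <= 1.
  by rewrite expR_ge0 /q -[leRHS]expR0 ler_expR mulr_le0_ge0// ltW.
(* The shift d is half a period, so the phase of e^(ld) is pi or -pi. *)
have Ed : E l d = (- q)%:C.
  have : Im l * d = pi \/ Im l * d = - pi.
    rewrite /d mulrCA; case: (ltrgt0P (Im l)) li => [i0 _|i0 _|//].
      by left; rewrite divff ?mulr1// gt_eqF.
    by right; rewrite invrN mulrN divff ?mulrN1// lt_eqF.
  by rewrite /E -/q => -[->|->]; apply: complexP; rewrite !reimE /= ?cosN ?sinN cospi sinpi; ring.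
have nE t : 0 <= t -> nc (E l t) <= 1.
  by move=> t0; rewrite nc_E -[leRHS]expR0 ler_expR mulr_le0_ge0// ltW.
set I := cint 0 T _.
have e1 : I = cint 0 d (fun t => E l t * X t) + (- q)%:C * cint 0 (T - d) (fun t => E l t * X (t + d)).
  rewrite /I (cint_split (ltW d0) dT); last exact: iEX.
  congr (_ + _).
  have cs : ccont (0 + d) (T - d + d) (fun t => E l t * X t).
    by apply: ccontS cEX; lra.
  have := cint_shift (ltac:(lra) : 0 <= T - d) cs; rewrite add0r subrK => ->.
  rewrite -cintZ; last first.
    apply: ccont_cintg; apply: ccontM; [lra|exact: ccont_E|].
    apply: (ccont_lip L0) => t t'; rewrite !in_itv /= => ht ht'.
    have -> : t - t' = (t + d) - (t' + d) by ring.
    by apply: hL; rewrite in_itv /=; lra.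
  by apply: eq_cint => t _; rewrite E_Dt Ed; ring.
have e2 : I = cint 0 (T - d) (fun t => E l t * X t) + cint (T - d) T (fun t => E l t * X t).
  by rewrite /I -cint_split//; [lra|lra|exact: iEX].
have cXd : ccont 0 (T - d) (fun t => X (t + d)).
  apply: (ccont_lip L0) => t t'; rewrite !in_itv /= => ht ht'.
  have -> : t - t' = (t + d) - (t' + d) by ring.
  by apply: hL; rewrite in_itv /=; lra.
have i3 : cintg 0 (T - d) (fun t => E l t * X (t + d)).
  by apply: ccont_cintg; apply: ccontM => //; [lra|exact: ccont_E].
have e3 : (1 + q)%:C * I = cint 0 d (fun t => E l t * X t) + q%:C * cint (T - d) T (fun t => E l t * X t) +
    q%:C * cint 0 (T - d) (fun t => E l t * (X t - X (t + d))).
  have -> : cint 0 (T - d) (fun t => E l t * (X t - X (t + d))) =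
     cint 0 (T - d) (fun t => E l t * X t) - cint 0 (T - d) (fun t => E l t * X (t + d)).
    rewrite -cintB//; last by apply: iEX; lra.
    by apply: eq_cint => t _; ring.
  rewrite rmorphD rmorph1 mulrDl mul1r {1}e1 e2 rmorphN /=; ring.
have b1 : nc (cint 0 d (fun t => E l t * X t)) <= 2 * B * (d - 0).
  apply: nc_cint_cst; [lra|exact: iEX|] => t; rewrite in_itv /= => ht.
  rewrite ncM -[B]mul1r; apply: ler_pM; rewrite ?nc_ge0//; first by apply: nE; lra.
  by apply: hB; rewrite in_itv /=; lra.
have b2 : nc (cint (T - d) T (fun t => E l t * X t)) <= 2 * B * (T - (T - d)).
  apply: nc_cint_cst; [lra|by apply: iEX; lra|] => t; rewrite in_itv /= => ht.
  rewrite ncM -[B]mul1r; apply: ler_pM; rewrite ?nc_ge0//; first by apply: nE; lra.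
  by apply: hB; rewrite in_itv /=; lra.
have b3 : nc (cint 0 (T - d) (fun t => E l t * (X t - X (t + d)))) <= 2 * (L * d * (- Re l)^-1).
  have r0 : 0 < - Re l by rewrite oppr_gt0.
  have ie : rintg 0 (T - d) (fun t => expR (- (- Re l) * t)).
    apply: rintg_continuous; apply: continuous_subspaceT; exact: smo_continuous (smo_expR 1 _).
  apply: (le_trans (nc_cint (G := fun t => (L * d) * expR (- (- Re l) * t)) _ _ _)).
  - apply: ccont_cintg; apply: ccontM; [lra|exact: ccont_E|].
    have Td2 : T - d <= T by lra.
    have Td1 : 0 <= T - d by lra.
    have h := ccontD (ccontS (lexx 0) Td2 cX) (ccontM Td1 (@ccont_cst R 0 (T - d) (-1)) cXd).
    by apply: eq_ccont h => t _; rewrite mulN1r.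
  - exact: rintgZ.
  - move=> t; rewrite in_itv /= => ht; rewrite ncM nc_E opprK mulrC ler_wpM2r ?expR_ge0//.
    have := hL t (t + d) ltac:(rewrite in_itv /=; lra) ltac:(rewrite in_itv /=; lra).
    have -> : t - (t + d) = - d by ring.
    by rewrite normrN (ger0_norm (ltW d0)).
  - rewrite ler_wpM2l// RintegralZl//; have Ld : 0 <= L * d by exact: mulr_ge0 L0 (ltW d0).
    rewrite (ler_wpM2l Ld)//.
    have Td1 : 0 <= T - d by lra.
    exact: rint_expN r0 Td1.
have nI : nc I <= nc ((1 + q)%:C * I).
  by rewrite ncM nc_real ger0_norm ?ler_peMl ?nc_ge0//; lra.
apply: (le_trans nI); rewrite e3; apply: (le_trans (ncD _ _)).
have nq z : nc (q%:C * z) <= nc z.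
  by rewrite ncM nc_real ger0_norm ?ler_piMl ?nc_ge0//; lra.
apply: (le_trans (lerD (le_trans (ncD _ _) (lerD b1 (le_trans (nq _) b2))) (le_trans (nq _) b3))).
apply: eqW; ring.
Qed.

Section Traj.
Variables (s alpha : R) (F : poly4) (sg : R[i]) (M T : R) (phi : int -> R[i]) (v : R -> R -> R[i]).

(** The identity of a trajectory is only given for 0 < c < T. Letting c tend to 0 identifies the
    value at time 0 with phi, and subtraction then gives the identity on any [t', t]. *)
Lemma traj_diff0 : 5/2 < s -> 0 < T -> trajectory s alpha F sg M T phi v ->
  (forall k, fourier (v 0) k = phi k) /\
  (forall k (l : R[i]) t t', 0 <= t' -> t' <= t -> t < T ->
    fourier (v t) k * E l t - fourier (v t') k * E l t' = cint t' t (fun t => E l t *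
      ((l - sg * 'i * (`|k%:~R : R| `^ alpha)%:C) * fourier (v t) k + sg * fourier (nonlin F (v t)) k))).
Proof.
move=> s52 T0 [hM hc hid].
have cY k (l : R[i]) : ccont 0 T (fun t => E l t *
      ((l - sg * 'i * (`|k%:~R : R| `^ alpha)%:C) * fourier (v t) k + sg * fourier (nonlin F (v t)) k)).
  have [cU cN] := ccont_trajectory F k s52 hM hc; have T0' := ltW T0.
  by apply: eq_ccont_E => //; apply: ccontD; apply: ccontM => //; exact: ccont_cst.
have h0 k : fourier (v 0) k = phi k.
  suff : nc (fourier (v 0) k - phi k) <= 0.
    by move=> h; apply/eqP; rewrite -subr_eq0; apply/eqP/nc_eq0/le_anti; rewrite h nc_ge0.
  apply/ler_addgt0Pr => e e0; rewrite add0r.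
  have [B B0 hB] := ccont_bounded (ltW T0) (cY k 0).
  have i0 : 0 \in `[0, T] by rewrite in_itv /= lexx ltW.
  have e20 : 0 < (e : R) / 2 by rewrite divr_gt0.
  have [d d0 hd] := hc _ i0 _ e20.
  have B1 : 0 < 2 * B + 1 by lra.
  pose c : R := Num.min (d / 2) (Num.min (T / 2) (e / 2 / (2 * B + 1))).
  have c0 : 0 < c by rewrite !lt_min !divr_gt0.
  have cd : c <= d / 2 by rewrite ge_min lexx.
  have cT : c <= T / 2 by rewrite !ge_min lexx !orbT.
  have ce : c <= e / 2 / (2 * B + 1) by rewrite !ge_min lexx !orbT.
  clearbody c.
  have cin : c \in `[0, T] by rewrite in_itv /=; lra.
  have h1 := hid k 0 c ltac:(lra); rewrite E0l mulr1 in h1.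
  have -> : fourier (v 0) k - phi k = (fourier (v c) k - phi k) - (fourier (v c) k - fourier (v 0) k) by ring.
  apply: (le_trans (ncB _ _)); rewrite h1.
  have h2 : nc (fourier (v c) k - fourier (v 0) k) <= e / 2.
    have := hd _ cin ltac:(by rewrite subr0 ger0_norm; lra) k; move=> /le_trans; apply.
    rewrite ler_piMr ?(ltW e20)// -(powRr0 (w k)); apply: wX_mono; lra.
  have h3 : nc (cint 0 c (fun t => E 0 t * ((0 - sg * 'i * (`|k%:~R : R| `^ alpha)%:C) * fourier (v t) k + sg * fourier (nonlin F (v t)) k))) <= 2 * B * (c - 0).
    apply: nc_cint_cst; first exact: ltW.
      by apply: ccont_cintg; apply: ccontS (cY k 0); lra.
    by move=> t; rewrite in_itv /= => ht; apply: hB; rewrite in_itv /=; lra.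
  have h4 : c * (2 * B + 1) <= e / 2 by rewrite -ler_pdivlMr.
  nra.
split=> // k l t t' t0 tt tT.
have hid' x : 0 <= x -> x < T -> fourier (v x) k * E l x - phi k = cint 0 x (fun t => E l t *
      ((l - sg * 'i * (`|k%:~R : R| `^ alpha)%:C) * fourier (v t) k + sg * fourier (nonlin F (v t)) k)).
  rewrite le_eqVlt => /predU1P[<- _|x0 xT]; last by apply: hid; rewrite x0.
  by rewrite h0 E0 mulr1 subrr; apply: complexP; rewrite /= set_itv1 Rintegral_set1.
have -> : fourier (v t) k * E l t - fourier (v t') k * E l t' =
  (fourier (v t) k * E l t - phi k) - (fourier (v t') k * E l t' - phi k) by ring.
rewrite !hid'; [|lra|lra|lra|lra].
rewrite (cint_split t0 tt); first by ring.
by apply: ccont_cintg; apply: ccontS (cY k l); lra.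
Qed.

(** The second alternative stands in for a hypothesis alpha >= 0; the caller rules it out. *)
Lemma nc_dispersion z k : nc sg = 1 -> nc (sg * 'i * (`|k%:~R : R| `^ alpha)%:C * z) <= w k `^ alpha * nc z \/ alpha < 0.
Proof.
move=> sg1; case: (ltP alpha 0) => a0; [by right|left].
rewrite !ncM nc_real sg1 nc_i !mul1r ler_wpM2r ?nc_ge0// ger0_norm ?powR_ge0//.
by apply: ge0_ler_powR; rewrite ?nnegrE ?(ltW (w_gt0 _))// abs_w.
Qed.

(* The time derivative of u costs alpha derivatives, of which s - 1 are recovered from the
   decay of the other factor: hence the power p. *)
Lemma traj_coef_lip (G : poly4) p : 5/2 < s -> 1 <= alpha -> nc sg = 1 -> 0 < T ->
  0 <= p -> p <= s - 1 -> 1 + alpha - s <= p -> trajectory s alpha F sg M T phi v ->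
  exists2 C, 0 <= C & forall t t' l, 0 <= t < T -> 0 <= t' < T ->
    nc (fourier (nonlin G (v t)) l - fourier (nonlin G (v t')) l) <= C * w l `^ p * `|t - t'|.
Proof.
move=> s52 a1 sg1 T0 p0 ps ap htr; have [hM hc _] := htr.
have [_ hd] := traj_diff0 s52 T0 htr.
have [K K0 hK] := nonlin_lip M G s52.
have [KN KN0 hKN] := nonlin_Hbd M F s52.
exists (4 * ((K ^+ 2 + M ^+ 2) + (K ^+ 2 + KN ^+ 2))).
  by rewrite mulr_ge0// !addr_ge0 ?sqr_ge0.
move=> t t' l; wlog tt : t t' / t' <= t => [hw|] ht ht'.
  have [h|h] := leP t' t; first exact: hw.
  by rewrite ncBC distrC; apply: hw => //; exact: ltW.
have htM x : 0 <= x < T -> Hbd s (v x) M by move=> hx; apply: hM; rewrite in_itv /=; lra.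
have [gam hgam h] := hK _ _ (htM _ ht) (htM _ ht').
apply: h => r ur.
have [g0 _] := hgam.
pose Y j (x : R) : R[i] := E 0 x * ((0 - sg * 'i * (`|j%:~R : R| `^ alpha)%:C) * fourier (v x) j + sg * fourier (nonlin F (v x)) j).
have cY j : ccont t' t (Y j).
  apply: (@ccontS _ 0 T); [lra|lra|].
  have [cU cN] := ccont_trajectory F j s52 hM hc; have T0' := ltW T0.
  by apply: eq_ccont_E => //; apply: ccontD; apply: ccontM => //; exact: ccont_cst.
have dY j : fourier (v t) j - fourier (v t') j = cint t' t (Y j).
  by rewrite -hd//; [rewrite !E0l !mulr1|lra|lra].
have nY j x : nc (Y j x) <= w j `^ alpha * nc (fourier (v x) j) + nc (fourier (nonlin F (v x)) j).
  rewrite /Y E0l mul1r; apply: (le_trans (ncD _ _)); apply: lerD; last by rewrite ncM sg1 mul1r.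
  rewrite sub0r mulNr ncN; have [//|] := @nc_dispersion (fourier (v x) j) j sg1; lra.
pose D := K ^+ 2 + M ^+ 2 + (K ^+ 2 + KN ^+ 2).
(* The dispersive part of the time derivative is bounded only in the norm with s - alpha
   derivatives; this is the loss that [l2w_conv] balances against gam. *)
have l2U x : 0 <= x < T -> l2w (s - alpha) (fun j => w j `^ alpha * nc (fourier (v x) j)) M.
  move=> hx; have [_ _ Sx] := htM _ hx; split=> [j|]; first by rewrite mulr_ge0 ?wX_ge0 ?nc_ge0.
  by apply: sumle_mono Sx => // j; rewrite mulrA -wXD subrK.
have l2N x : 0 <= x < T -> l2w (s - alpha) (fun j => nc (fourier (nonlin F (v x)) j)) KN.
  move=> hx; have [_ _ Sx] := hKN _ (htM _ hx); split=> [j|]; first exact: nc_ge0.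
  apply: sumle_mono Sx => // j; rewrite ler_pXn2r ?nnegrE ?mulr_ge0 ?wX_ge0 ?nc_ge0//.
  by rewrite ler_wpM2r ?nc_ge0//; apply: wX_mono; lra.
have l2opp (e : int -> R) B : l2w (s - alpha) e B -> l2w (s - alpha) (fun j => e (- j)) B.
  move=> [e0 he]; split=> // q uq; have := sumle_inj (@oppr_inj int) he uq.
  by under eq_bigr do rewrite wN.
have bnd x : 0 <= x < T -> sumle (fun j => gam (l - j) * w j * nc (Y j x)) (D * w l `^ p).
  move=> hx; rewrite mulrDl.
  apply: sumle_mono (sumleD (l2w_conv l p0 ps ap hgam (l2U _ hx)) (l2w_conv l p0 ps ap hgam (l2N _ hx))) => // j.
  by rewrite -!mulrA -!mulrDr ler_wpM2l// ler_wpM2l ?(ltW (w_gt0 _)).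
have bndN x : 0 <= x < T -> sumle (fun j => gam (l - j) * w j * nc (Y (- j) x)) (D * w l `^ p).
  move=> hx; rewrite mulrDl.
  apply: sumle_mono (sumleD (l2w_conv l p0 ps ap hgam (l2opp _ _ (l2U _ hx))) (l2w_conv l p0 ps ap hgam (l2opp _ _ (l2N _ hx)))) => // j.
  by rewrite -!mulrA -!mulrDr ler_wpM2l// ler_wpM2l ?(ltW (w_gt0 _)).
have gw j : 0 <= gam (l - j) * w j by rewrite mulr_ge0 ?(ltW (w_gt0 _)).
have s1 := sum_nc_cint (r := r) (Z := Y) tt gw cY
  (fun x hx => bnd x ltac:(move: hx; rewrite in_itv /=; lra) r ur).
have s2 := sum_nc_cint (r := r) (Z := fun j => Y (- j)) tt gw (fun j => cY (- j))
  (fun x hx => bndN x ltac:(move: hx; rewrite in_itv /=; lra) r ur).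
apply: (@le_trans _ _ (\sum_(j <- r) gam (l - j) * w j * nc (cint t' t (Y j)) +
   \sum_(j <- r) gam (l - j) * w j * nc (cint t' t (Y (- j))))).
  rewrite -big_split; apply: ler_sum => j _ /=.
  by rewrite /symdiff !dY -mulrDr mulrA.
apply: (le_trans (lerD s1 s2)); rewrite ger0_norm ?subr_ge0//.
apply: eqW; rewrite /D; ring.
Qed.

(* Removing the free evolution leaves a profile whose time derivative no longer
   contains |k|^alpha. *)
Lemma traj_profile_lip : 5/2 < s -> nc sg = 1 -> 0 < T -> Re (sg * 'i) = 0 ->
  trajectory s alpha F sg M T phi v ->
  exists2 C, 0 <= C & forall t t' k, 0 <= t < T -> 0 <= t' < T ->
    nc (fourier (v t) k * E (sg * 'i * (`|k%:~R : R| `^ alpha)%:C) t -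
        fourier (v t') k * E (sg * 'i * (`|k%:~R : R| `^ alpha)%:C) t') <=
      C * w k `^ (- (s - 1)) * `|t - t'|.
Proof.
move=> s52 sg1 T0 Rsg htr; have [hM hc _] := htr.
have [_ hd] := traj_diff0 s52 T0 htr.
have [KN KN0 hKN] := nonlin_Hbd M F s52.
exists (2 * KN); first by rewrite mulr_ge0.
move=> t t' k; wlog tt : t t' / t' <= t => [hw|] ht ht'.
  have [h|h] := leP t' t; first exact: hw.
  by rewrite ncBC distrC; apply: hw => //; exact: ltW.
rewrite hd; [|lra|lra|lra].
rewrite [`|t - t'|]ger0_norm ?subr_ge0//.
have -> : 2 * KN * w k `^ (- (s - 1)) = 2 * (KN * w k `^ (- (s - 1))) by rewrite mulrA.
apply: nc_cint_cst => //.
  apply: ccont_cintg; apply: (@ccontS _ 0 T); [lra|lra|].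
  have [cU cN] := ccont_trajectory F k s52 hM hc; have T0' := ltW T0.
  by apply: eq_ccont_E => //; apply: ccontD; apply: ccontM => //; exact: ccont_cst.
move=> x; rewrite in_itv /= => hx.
(* The rate cancels the dispersive term exactly and is purely imaginary, so the exponential has
   modulus 1 and only the nonlinearity remains. *)
rewrite ncM nc_E subrr mul0r add0r ncM sg1 mul1r cReM Rsg mul0r sub0r /= mulr0 oppr0 mul0r expR0 mul1r.
by apply: Hbd_pt; apply: hKN; apply: hM; rewrite in_itv /=; lra.
Qed.

End Traj.

End TrajectoryRegularity.

(** * Lower bounds for the phase and the resulting gain *)

Section NonResonance.
Context {R : realType}.
Implicit Types (f g : R -> R[i]) (v : R -> R -> R[i]) (a b c t T s alpha M p : R) (k j l : int).
Local Notation w := (@w R).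
Local Notation poly4 := (mpoly.mpoly 4 R[i]).

Lemma powR_sub_ge (x y : R) alpha : 0 <= y -> y <= x -> 1 <= alpha ->
  y `^ (alpha - 1) * (x - y) <= x `^ alpha - y `^ alpha.
Proof.
move=> y0 yx a1; have x0 := le_trans y0 yx; have a0 : 0 < alpha by lra.
rewrite -(mulr_powRB1 x0 a0) -(mulr_powRB1 y0 a0).
have : y `^ (alpha - 1) <= x `^ (alpha - 1) by apply: ge0_ler_powR; rewrite ?nnegrE//; lra.
by move: (y `^ _) (x `^ _) => A B AB; nra.
Qed.

(** Since |y| <= |x|/2, the numbers x and x - y have the same sign and modulus at least |x|/2. Their
    moduli thus differ by exactly |y|, and [powR_sub_ge] applies to the larger and the smaller
    one. *)
Lemma phase_gap (x y : R) alpha : 1 <= alpha -> `|y| <= `|x| / 2 ->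
  (`|x| / 2) `^ (alpha - 1) * `|y| <= `| `|x| `^ alpha - `|x - y| `^ alpha |.
Proof.
move=> a1 yx.
have mono (z z' : R) : 0 <= z -> z <= z' -> z `^ (alpha - 1) <= z' `^ (alpha - 1).
  by move=> z0 zz; apply: ge0_ler_powR; rewrite ?nnegrE//; lra.
have x20 : 0 <= `|x| / 2 by have := normr_ge0 x; lra.
have d : `| `|x| - `|x - y| | = `|y|.
  case: (ger0P x) yx => x0; case: (ger0P y) => y0 yx; case: (ger0P (x - y)) => xy;
  case: ger0P => h; lra.
have h2 : `|x| / 2 <= `|x - y| by have := ler_normD (x - y) y; rewrite subrK; lra.
have [h|/ltW h] := leP `|x - y| `|x|.
  have -> : `|y| = `|x| - `|x - y| by rewrite -d ger0_norm// subr_ge0.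
  apply: le_trans (ler_norm _).
  apply: le_trans (powR_sub_ge (normr_ge0 _) h a1).
  by rewrite ler_wpM2r ?subr_ge0// mono.
have -> : `|y| = `|x - y| - `|x| by rewrite -d ler0_norm ?opprB// subr_le0.
rewrite [leRHS]distrC; apply: le_trans (ler_norm _).
apply: le_trans (powR_sub_ge (normr_ge0 _) h a1).
rewrite ler_wpM2r ?subr_ge0// mono//; have := normr_ge0 x; lra.
Qed.

Lemma w_powR_large (e B : R) : 0 < e -> exists K0 : R, forall k, K0 <= w k -> B <= w k `^ e.
Proof.
move=> e0; exists ((Num.max 1 B) `^ e^-1) => k hk.
have B1 : 0 < Num.max 1 B by rewrite lt_max ltr01.
apply: (@le_trans _ _ (Num.max 1 B)); first by rewrite le_max lexx orbT.
have : (Num.max 1 B `^ e^-1) `^ e <= w k `^ e.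
  by apply: ge0_ler_powR; rewrite ?nnegrE ?powR_ge0 ?(ltW (w_gt0 _)) ?(ltW e0).
by rewrite -powRrM mulVf ?gt_eqF// powRr1// ltW.
Qed.

Lemma w_le_abs k : k != 0 -> w k <= 2 * `|k%:~R| :> R.
Proof.
move=> k0; rewrite /w; suff : 1 <= `|k%:~R| :> R by lra.
have : (1 <= `|k|)%R by lia.
by rewrite -intr_norm -(ler_int R).
Qed.

Lemma abs_half k l : l \in zl (absz k)./2 -> `|l%:~R| <= `|k%:~R| / 2 :> R.
Proof.
rewrite mem_zl => h; rewrite ler_pdivlMr// -!intr_norm.
have : (`|l| * 2 <= `|k|)%R by lia.
by rewrite -(ler_int R) intrM.
Qed.

(** The term k m is O(w(k)), of lower order than w(k)^(alpha-1) since alpha > 2, so for large k it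
    costs only half of the constant. The second phase, which belongs to the conjugate terms, is a
    sum of two nonnegative powers up to k m, so l = 0 needs no exception there. *)
Lemma phase_bounds alpha (m : R) : 2 < alpha -> exists2 c, 0 < c & exists K0 : R, forall k l,
  K0 <= w k -> l \in zl (absz k)./2 ->
  (l != 0 -> c * (w k `^ (alpha - 1) * w l) <=
     `| `|k%:~R| `^ alpha - k%:~R * m - `|(k - l)%:~R| `^ alpha|) /\
  c * (w k `^ (alpha - 1) * w l) <= `| `|k%:~R| `^ alpha - k%:~R * m + `|(k - l)%:~R| `^ alpha|.
Proof.
(* The base 1/4 comes from |k|/2 >= w(k)/4, and the division by 2 from |l| >= w(l)/2 for nonzero
   l. *)
move=> a2; pose c2 : R := 4^-1 `^ (alpha - 1) / 2.
have c20 : 0 < c2 by rewrite divr_gt0 ?powR_gt0.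
exists (c2 / 2); first by rewrite divr_gt0.
have a20 : 0 < alpha - 2 by lra.
have [K0 hK0] := w_powR_large (2 * `|m| / c2) a20.
exists (Num.max 2 K0) => k l; rewrite ge_max => /andP[k2 kK] hl.
have k0 : k != 0 by apply/eqP => k0; move: k2; rewrite k0 /w mulr0z normr0 addr0; lra.
have hw := w_le_abs k0.
have hwk := w_gt0 (R := R) k.
have hlk := abs_half hl.
have hm : `|k%:~R * m| <= c2 / 2 * w k `^ (alpha - 1).
  have -> : w k `^ (alpha - 1) = w k * w k `^ (alpha - 2) :> R.
    by rewrite -{2}(wX1 k) -wXD; congr (_ `^ _); ring.
  have h1 := hK0 k kK; rewrite ler_pdivrMr// in h1.
  rewrite normrM; apply: (@le_trans _ _ (w k * `|m|)).
    by rewrite ler_wpM2r ?abs_w.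
  rewrite [leRHS]mulrCA ler_wpM2l ?(ltW hwk)//; lra.
have wl1 := w_ge1 (R := R) l.
have wl2 : w l <= w k :> R by rewrite /w lerD2l; have := normr_ge0 (k%:~R : R); lra.
have q1 : 4^-1 `^ (alpha - 1) * w k `^ (alpha - 1) <= (`|k%:~R| / 2) `^ (alpha - 1).
  rewrite -powRM ?invr_ge0 ?(ltW hwk)//.
  apply: ge0_ler_powR; rewrite ?nnegrE ?mulr_ge0 ?invr_ge0 ?(ltW hwk) ?normr_ge0//; lra.
have X0 : 0 < w k `^ (alpha - 1) :> R by exact: wX_gt0.
have main (x z : R) : c2 * (w k `^ (alpha - 1) * w l) <= `|x| -> z = x - k%:~R * m ->
    c2 / 2 * (w k `^ (alpha - 1) * w l) <= `|z|.
  move=> hx ->; have h1 := lerB_dist x (k%:~R * m).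
  have : w k `^ (alpha - 1) <= w k `^ (alpha - 1) * w l by rewrite ler_peMr// ltW.
  move: (w k `^ (alpha - 1) * w l) (w k `^ (alpha - 1)) hm hx h1 => A B h1 h2 h3 h4.
  have := ler_wpM2l (ltW c20) h4; lra.
split=> [l0|].
  apply: (main (`|k%:~R| `^ alpha - `|(k - l)%:~R| `^ alpha)); [|by ring].
  have := phase_gap (ltac:(lra) : 1 <= alpha) hlk; rewrite -intrB; apply: le_trans.
  have hwl := w_le_abs l0.
  have -> : c2 * (w k `^ (alpha - 1) * w l) = (4^-1 `^ (alpha - 1) * w k `^ (alpha - 1)) * (w l / 2).
    by rewrite /c2; field.
  apply: ler_pM => //; rewrite ?mulr_ge0 ?powR_ge0//; lra.
apply: (main (`|k%:~R| `^ alpha + `|(k - l)%:~R| `^ alpha)); [|by ring].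
rewrite ger0_norm ?addr_ge0 ?powR_ge0//; apply: (@le_trans _ _ (`|k%:~R| `^ alpha)); last first.
  by rewrite lerDl powR_ge0.
have a0 : 0 < alpha by lra.
rewrite -(mulr_powRB1 (normr_ge0 _) a0).
have -> : c2 * (w k `^ (alpha - 1) * w l) = (w l / 2) * (4^-1 `^ (alpha - 1) * w k `^ (alpha - 1)).
  by rewrite /c2; field.
apply: ler_pM; rewrite ?mulr_ge0 ?powR_ge0//; [lra|lra|].
apply: (le_trans q1); apply: ge0_ler_powR; rewrite ?nnegrE//; have := normr_ge0 (k%:~R : R); lra.
Qed.

(** [osc_bound] for the product a Y, with B and L from the product rule. The profile Y has a
    Lipschitz constant one power of w(k) larger than its size, and the damping rate, at least c1
    w(k), gives exactly this power back. *)
Lemma osc_term s alpha p (A c c1 T : R) k l (lam : R[i]) (a Y : R -> R[i]) :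
  0 <= A -> 0 < c -> 0 < c1 -> pi / (c * w k `^ (alpha - 1)) <= T ->
  Re lam <= - (c1 * w k) -> c * (w k `^ (alpha - 1) * w l) <= `|Im lam| ->
  (forall t, t \in `[0, T] -> nc (a t) <= A * w l `^ (- (s - 1))) ->
  (forall t t', t \in `[0, T] -> t' \in `[0, T] -> nc (a t - a t') <= A * w l `^ p * `|t - t'|) ->
  (forall t, t \in `[0, T] -> nc (Y t) <= A * w k `^ (- s)) ->
  (forall t t', t \in `[0, T] -> t' \in `[0, T] -> nc (Y t - Y t') <= A * w k `^ (- (s - 1)) * `|t - t'|) ->
  nc (cint 0 T (fun t => E lam t * (a t * Y t))) <= pi * A ^+ 2 / c * (4 + 2 / c1) *
    (w l `^ (- s) * w k `^ (- (alpha - 1 + s)) + w l `^ (p - 1) * w k `^ (- (alpha + s))).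
Proof.
move=> A0 c0 c10 hT hr hi ha la hY lY.
have wk0 := w_gt0 (R := R) k; have wl0 := w_gt0 (R := R) l.
have X0 : 0 < w k `^ (alpha - 1) by exact: wX_gt0.
have G0 : 0 < c * (w k `^ (alpha - 1) * w l) by rewrite !mulr_gt0.
have r0 : 0 < c1 * w k by rewrite mulr_gt0.
have hi0 : 0 < `|Im lam| := lt_le_trans G0 hi.
have pi0 : 0 < pi :> R := pi_gt0 R.
have dT : pi / `|Im lam| <= T.
  apply: le_trans hT; rewrite ler_wpM2l ?(ltW pi0)// lef_pV2 ?posrE ?mulr_gt0//.
  apply: le_trans hi; rewrite ler_wpM2l ?(ltW c0)// ler_peMr ?(ltW X0)//; exact: w_ge1.
pose B := A ^+ 2 * (w l `^ (- (s - 1)) * w k `^ (- s)).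
pose L := A ^+ 2 * (w l `^ p * w k `^ (- s) + w l `^ (- (s - 1)) * w k `^ (- (s - 1))).
have A20 : 0 <= A ^+ 2 := sqr_ge0 A.
have B0 : 0 <= B by rewrite !mulr_ge0 ?wX_ge0.
have L0 : 0 <= L by rewrite mulr_ge0 ?addr_ge0 ?mulr_ge0 ?wX_ge0.
apply: (le_trans (osc_bound B0 L0 _ _ dT _ _)).
- by apply: (le_lt_trans hr); rewrite oppr_lt0.
- by rewrite -normr_gt0.
- move=> t ht; rewrite ncM; apply: (le_trans (ler_pM (nc_ge0 _) (nc_ge0 _) (ha _ ht) (hY _ ht))).
  by apply: eqW; rewrite /B; ring.
- move=> t t' ht ht'.
  have -> : a t * Y t - a t' * Y t' = (a t - a t') * Y t + a t' * (Y t - Y t') by ring.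
  apply: (le_trans (ncD _ _)); rewrite !ncM.
  apply: (le_trans (lerD (ler_pM (nc_ge0 _) (nc_ge0 _) (la _ _ ht ht') (hY _ ht))
     (ler_pM (nc_ge0 _) (nc_ge0 _) (ha _ ht') (lY _ _ ht ht')))).
  by apply: eqW; rewrite /L; ring.
have i1 : pi / `|Im lam| <= pi / c * (w k `^ (- (alpha - 1)) * w l `^ (- 1)).
  have -> : pi / c * (w k `^ (- (alpha - 1)) * w l `^ (- 1)) = pi / (c * (w k `^ (alpha - 1) * w l)).
    by rewrite !powRN powRr1 ?(ltW wl0)// !invfM; ring.
  by rewrite ler_wpM2l ?(ltW pi0)// lef_pV2 ?posrE.
have i2 : 2 * L / - Re lam <= 2 * L * (c1^-1 * w k `^ (- 1)).
  rewrite powRN powRr1 ?(ltW wk0)// -invfM; have L20 : 0 <= 2 * L by exact: mulr_ge0.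
  rewrite (ler_wpM2l L20)// lef_pV2 ?posrE//; lra.
have s1 : 0 <= 2 * L / - Re lam by apply: divr_ge0; [exact: mulr_ge0|lra].
have s2 : 0 <= pi / `|Im lam| by rewrite divr_ge0 ?(ltW pi0).
apply: (le_trans (ler_pM s2 (addr_ge0 (mulr_ge0 (ler0n _ 4) B0) s1) i1 (lerD (lexx (4 * B)) i2))).
have -> : w l `^ (- s) = w l `^ (- 1) * w l `^ (- (s - 1)) by rewrite -wXD; congr (_ `^ _); ring.
have -> : w l `^ (p - 1) = w l `^ (- 1) * w l `^ p by rewrite -wXD; congr (_ `^ _); ring.
have -> : w k `^ (- (alpha - 1 + s)) = w k `^ (- (alpha - 1)) * w k `^ (- s) by rewrite -wXD; congr (_ `^ _); ring.
have -> : w k `^ (- (alpha + s)) = w k `^ (- (alpha - 1)) * (w k `^ (- 1) * w k `^ (- s)).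
  by rewrite -!wXD; congr (_ `^ _); ring.
have e5 : w k `^ (- s) = w k `^ (- 1) * w k `^ (- (s - 1)) by rewrite -wXD; congr (_ `^ _); ring.
have e6 : w k `^ (- 1) * w k `^ (- (s - 1)) = w k `^ (- s) by [].
rewrite /B /L.
have k1 := wX_ge0 (R := R) k (- (alpha - 1)); have k2 := wX_ge0 (R := R) k (- 1); have k3 := wX_ge0 (R := R) k (- (s - 1)).
have l1 := wX_ge0 (R := R) l (- 1); have l2 := wX_ge0 (R := R) l (- (s - 1)); have l3 := wX_ge0 (R := R) l p.
have ks := wX_ge0 (R := R) k (- s).
have ci := ltW (ltac:(by rewrite invr_gt0) : 0 < c1^-1).
rewrite -subr_ge0.
set a1 := w k `^ (- (alpha - 1)) in k1 *; set a2 := w k `^ (- 1) in e6 k2 *.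
set a3 := w k `^ (- (s - 1)) in e6 k3 *; set b1 := w l `^ (- 1) in l1 *.
set b2 := w l `^ (- (s - 1)) in l2 *; set b3 := w l `^ p in l3 *; set a4 := w k `^ (- s) in e6 ks *.
have -> : pi * A ^+ 2 / c * (4 + 2 / c1) * (b1 * b2 * (a1 * a4) + b1 * b3 * (a1 * (a2 * a4))) -
  pi / c * (a1 * b1) * (4 * (A ^+ 2 * (b2 * a4)) + 2 * (A ^+ 2 * (b3 * a4 + b2 * a3)) * (c1^-1 * a2)) =
  4 * (pi / c * A ^+ 2 * (b1 * b3 * (a1 * (a2 * a4)))) +
  2 * (pi / c * A ^+ 2 * (b1 * b2 * a1) / c1 * (a4 - a2 * a3)) by ring.
rewrite e6 subrr mulr0 mulr0 addr0.
by rewrite !mulr_ge0// ?invr_ge0 ltW.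
Qed.

(** There are at most w(k) summands, each at most w(k)^q. *)
Lemma sum_zl_powR k (q : R) : 0 <= q -> \sum_(l <- zl (absz k)./2) w l `^ q <= w k * w k `^ q.
Proof.
move=> q0; apply: (@le_trans _ _ (\sum_(l <- zl (absz k)./2) w k `^ q)).
  rewrite big_seq [leRHS]big_seq; apply: ler_sum => l hl.
  apply: ge0_ler_powR; rewrite ?nnegrE ?(ltW (w_gt0 _))//.
  by rewrite /w lerD2l; have := abs_half hl; have := normr_ge0 (k%:~R : R); lra.
rewrite big_const_seq count_predT iter_addr_0 size_map size_iota -mulr_natl ler_wpM2r ?wX_ge0//.
rewrite /w -intr_norm -natr_absz [leRHS]addrC natr1 ler_nat; lia.
Qed.

(** After summation over l the two parts of [osc_term] are of order w(k)^(-(alpha-1+s)) and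
    w(k)^(p-alpha-s). They are O(w(k)^(-(s+eps+1))) precisely under eps <= alpha - 2 and p <= alpha
    - 1 - eps. *)
Lemma osc_sum s alpha p eps (A c c1 Z T : R) k (P : pred int) (lam : int -> R[i]) (a Y : int -> R -> R[i]) :
  0 <= A -> 0 < c -> 0 < c1 -> 0 <= s -> 1 <= p -> eps <= alpha - 2 -> p <= alpha - 1 - eps ->
  sumle (fun l => w l `^ (- s)) Z -> pi / (c * w k `^ (alpha - 1)) <= T ->
  (forall l, l \in zl (absz k)./2 -> P l ->
     Re (lam l) <= - (c1 * w k) /\ c * (w k `^ (alpha - 1) * w l) <= `|Im (lam l)|) ->
  (forall l t, t \in `[0, T] -> nc (a l t) <= A * w l `^ (- (s - 1))) ->
  (forall l t t', t \in `[0, T] -> t' \in `[0, T] -> nc (a l t - a l t') <= A * w l `^ p * `|t - t'|) ->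
  (forall l t, l \in zl (absz k)./2 -> t \in `[0, T] -> nc (Y l t) <= A * w k `^ (- s)) ->
  (forall l t t', l \in zl (absz k)./2 -> t \in `[0, T] -> t' \in `[0, T] ->
     nc (Y l t - Y l t') <= A * w k `^ (- (s - 1)) * `|t - t'|) ->
  \sum_(l <- zl (absz k)./2 | P l) nc (cint 0 T (fun t => E (lam l) t * (a l t * Y l t))) <=
    pi * A ^+ 2 / c * (4 + 2 / c1) * (Z + 1) * w k `^ (- (s + eps + 1)).
Proof.
move=> A0 c0 c10 s0 p1 ea pa hZ hT hl la la' hY lY.
have D0 : 0 <= pi * A ^+ 2 / c * (4 + 2 / c1).
  apply: mulr_ge0; last by rewrite addr_ge0// divr_ge0// ltW.
  by rewrite divr_ge0 ?(ltW c0)// mulr_ge0 ?sqr_ge0// pi_ge0.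
apply: (@le_trans _ _ (\sum_(l <- zl (absz k)./2) pi * A ^+ 2 / c * (4 + 2 / c1) *
    (w l `^ (- s) * w k `^ (- (alpha - 1 + s)) + w l `^ (p - 1) * w k `^ (- (alpha + s))))).
  rewrite big_mkcond big_seq [leRHS]big_seq; apply: ler_sum => l lz; case: ifP => Pl; last first.
    by rewrite mulr_ge0// addr_ge0// mulr_ge0// wX_ge0.
  have [h1 h2] := hl l lz Pl.
  apply: (osc_term A0 c0 c10 hT h1 h2 (la l) (la' l)) => [t|t t']; [exact: hY|exact: lY].
rewrite -mulr_sumr -[leRHS]mulrA (ler_wpM2l D0)// big_split /= -!mulr_suml mulrDl mul1r; apply: lerD.
  apply: ler_pM; rewrite ?wX_ge0//.
  - by apply: sumr_ge0 => l _; exact: wX_ge0.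
  - exact: hZ (zl_uniq _).
  - by apply: wX_mono; lra.
apply: (@le_trans _ _ (w k * w k `^ (p - 1) * w k `^ (- (alpha + s)))).
  by rewrite ler_wpM2r ?wX_ge0// sum_zl_powR//; lra.
by rewrite -{1}(wX1 k) -!wXD; apply: wX_mono; lra.
Qed.

End NonResonance.

(** * Decay of the initial datum *)

Section Decay.
Context {R : realType}.
Implicit Types (f g : R -> R[i]) (v : R -> R -> R[i]) (a b c t T s alpha M p eps : R) (k j l : int).
Local Notation poly4 := (mpoly.mpoly 4 R[i]).
Local Notation w := (@w R).

Lemma nc_cint_exp (r B T : R) f : 0 < r -> 0 <= B -> 0 <= T -> cintg 0 T f ->
  (forall t, t \in `[0, T] -> nc (f t) <= B * expR (- r * t)) -> nc (cint 0 T f) <= 2 * B / r.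
Proof.
move=> r0 B0 T0 cf hf.
have ie : rintg 0 T (fun t => expR (- r * t)).
  apply: rintg_continuous; apply: continuous_subspaceT; exact: smo_continuous (smo_expR 1 _).
apply: (le_trans (nc_cint (G := fun t => B * expR (- r * t)) cf _ hf)); first exact: rintgZ.
by rewrite RintegralZl// -mulrA ler_wpM2l// ler_wpM2l// rint_expN.
Qed.

(** Half of the exponential absorbs the factor t, because t e^(-rt/2) <= 2/r; the other half is
    integrated. *)
Lemma nc_cint_texp (r B T : R) f : 0 < r -> 0 <= B -> 0 <= T -> cintg 0 T f ->
  (forall t, t \in `[0, T] -> nc (f t) <= B * t * expR (- r * t)) -> nc (cint 0 T f) <= 8 * B / r ^+ 2.
Proof.
move=> r0 B0 T0 cf hf; have r20 : 0 < r / 2 by rewrite divr_gt0.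
have B1 : 0 <= B * (2 / r) by rewrite mulr_ge0// divr_ge0// ltW.
apply: (le_trans (nc_cint_exp r20 B1 T0 cf _)).
  move=> t ht; apply: (le_trans (hf _ ht)).
  have -> : - r * t = - (r / 2) * t + - (r / 2 * t) by field.
  have h2 : t * expR (- (r / 2 * t)) <= 2 / r.
    have h1 : r / 2 * t <= expR (r / 2 * t) by apply: le_trans (expR_ge1Dx _); rewrite lerDr.
    rewrite expRN ler_pdivrMr ?expR_gt0//.
    rewrite -(ler_pM2l r20) mulrA (_ : r / 2 * (2 / r) = 1) ?mul1r//.
    by field; rewrite gt_eqF.
  rewrite expRD; have -> : B * t * (expR (- (r / 2) * t) * expR (- (r / 2 * t))) =
    B * (t * expR (- (r / 2 * t))) * expR (- (r / 2) * t) by ring.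
  by rewrite ler_wpM2r ?expR_ge0// ler_wpM2l.
by apply: eqW; field; rewrite gt_eqF.
Qed.

Section Duhamel.
Variables (s alpha sg M T : R) (F : poly4) (phi : int -> R[i]) (v : R -> R -> R[i]) (m : R[i]).

Definition pfreq k : R := `|k%:~R| `^ alpha.
(* The rate of the k-th mode once the resonant term i k m, m being the mean of F_omega at
   the initial time, is put on the linear side. Its real part is sg * k * Im m. *)
Definition drate k : R[i] := sg%:C * ('i * (pfreq k)%:C - 'i * k%:~R * m).
Definition ik_sqr k l : R[i] := ('i * (k - l)%:~R) * ('i * (k - l)%:~R).
Definition acoef l t := fourier (nonlin (mpoly.mderiv (@Ordinal 4 1 isT) F) (v t)) l.
Definition bcoef l t := fourier (nonlin (mpoly.mderiv (@Ordinal 4 3 isT) F) (v t)) l.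
Definition duhamel_a k l t := E (drate k) t * (acoef l t * fourier (v t) (k - l)).
Definition duhamel_b k l t := E (drate k) t * (bcoef l t * (fourier (v t) (- (k - l)))^*).
(** The l = 0 term once m has been moved into the rate: only the drift of the mean away from its
    initial value is left. *)
Definition duhamel_main k t :=
  E (drate k) t * ((acoef 0 t - m) * (('i * k%:~R) * ('i * k%:~R) * fourier (v t) k)).
Definition sum_a k t := \sum_(l <- zl (absz k)./2) acoef l t * (ik_sqr k l * fourier (v t) (k - l)).
Definition sum_b k t := \sum_(l <- zl (absz k)./2) bcoef l t * (ik_sqr k l * (fourier (v t) (- (k - l)))^*).
(** The error of the linearisation, estimated by [nonlin_linearized]. *)
Definition duhamel_rem k t :=
  E (drate k) t * ('i * k%:~R * fourier (nonlin F (v t)) k - (sum_a k t + sum_b k t)).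

Lemma sum_a_split k t : E (drate k) t * sum_a k t =
  E (drate k) t * (acoef 0 t * (('i * k%:~R) * ('i * k%:~R) * fourier (v t) k)) +
  \sum_(l <- zl (absz k)./2 | l != 0) ik_sqr k l * duhamel_a k l t.
Proof.
rewrite /sum_a mulr_sumr (bigD1_seq 0) ?zl_uniq ?mem_zl//=; congr (_ + _).
  by rewrite /ik_sqr subr0.
by apply: eq_bigr => l _; rewrite /duhamel_a; ring.
Qed.

Lemma sum_b_split k t : E (drate k) t * sum_b k t = \sum_(l <- zl (absz k)./2) ik_sqr k l * duhamel_b k l t.
Proof. by rewrite /sum_b mulr_sumr; apply: eq_bigr => l _; rewrite /duhamel_b; ring. Qed.

(** The factor ik brings in the linearised nonlinearity. The part -ikm of the rate then contributes
    -m (ik)^2 u_k, which cancels m inside the l = 0 term. *)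
Lemma duhamel_integrand k t :
  'i * k%:~R * (E (drate k) t * ((drate k - sg%:C * 'i * (pfreq k)%:C) * fourier (v t) k +
     sg%:C * fourier (nonlin F (v t)) k)) =
  sg%:C * (duhamel_main k t + (\sum_(l <- zl (absz k)./2 | l != 0) ik_sqr k l * duhamel_a k l t +
    (\sum_(l <- zl (absz k)./2) ik_sqr k l * duhamel_b k l t + duhamel_rem k t))).
Proof.
rewrite -sum_b_split.
have -> : \sum_(l <- zl (absz k)./2 | l != 0) ik_sqr k l * duhamel_a k l t =
  E (drate k) t * sum_a k t - E (drate k) t * (acoef 0 t * (('i * k%:~R) * ('i * k%:~R) * fourier (v t) k)).
  by rewrite sum_a_split addrC addKr.
rewrite /duhamel_main /duhamel_rem; move: (E _ t) (sum_a k t) (sum_b k t) (acoef 0 t) (fourier _ k) (fourier _ k) => x1 x2 x3 x4 x5 x6.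
rewrite /drate; move: (pfreq k)%:C sg%:C (k%:~R : R[i]) => x7 x8 x9; ring.
Qed.

Lemma traj_cont : 5/2 < s -> trajectory s alpha F sg%:C M T phi v ->
  forall T1, 0 <= T1 <= T -> [/\ forall j, ccont 0 T1 (fun t => fourier (v t) j),
    forall j, ccont 0 T1 (fun t => (fourier (v t) j)^*) &
    forall (G : poly4) j, ccont 0 T1 (fun t => fourier (nonlin G (v t)) j)].
Proof.
move=> s52 [hM hc _] T1 /andP[T10 T1T].
have cU j : ccont 0 T1 (fun t => fourier (v t) j).
  by apply: ccontS (proj1 (ccont_trajectory F j s52 hM hc)).
split=> // [j t ht e e0|G j].
  have [d d0 hd1] := cU j _ ht _ e0; exists d => // t' ht' dt'.
  by rewrite -rmorphB ncJ; exact: hd1.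
by apply: ccontS (proj2 (ccont_trajectory G j s52 hM hc)).
Qed.

Lemma duhamel_cont : 5/2 < s -> trajectory s alpha F sg%:C M T phi v ->
  forall T1, 0 <= T1 <= T -> forall k, [/\ forall l, ccont 0 T1 (duhamel_a k l), forall l, ccont 0 T1 (duhamel_b k l),
    ccont 0 T1 (duhamel_main k) & cintg 0 T1 (duhamel_rem k)].
Proof.
move=> s52 htr T1 T1T k; have [cU cJ cG] := traj_cont s52 htr T1T.
have T10 : 0 <= T1 by case/andP: T1T.
have cE : ccont 0 T1 (E (drate k)) := @ccont_E R 0 T1 _.
have cA l : ccont 0 T1 (duhamel_a k l) := ccontM T10 cE (ccontM T10 (cG _ l) (cU (k - l))).
have cB l : ccont 0 T1 (duhamel_b k l) := ccontM T10 cE (ccontM T10 (cG _ l) (cJ (- (k - l)))).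
have cM : ccont 0 T1 (duhamel_main k).
  exact: (ccontM T10 cE (ccontM T10 (ccontD (cG _ 0) (@ccont_cst R 0 T1 (- m)))
    (ccontM T10 (@ccont_cst R 0 T1 _) (cU k)))).
split=> //.
have iA : cintg 0 T1 (fun t => \sum_(l <- zl (absz k)./2 | l != 0) ik_sqr k l * duhamel_a k l t).
  have h := @cintg_sum R 0 T1 _ [seq l <- zl (absz k)./2 | l != 0] (fun l t => ik_sqr k l * duhamel_a k l t)
    (fun l => cintgZ (ik_sqr k l) (ccont_cintg (cA l))).
  by apply: eq_cintg h => t _; rewrite big_filter.
have iB : cintg 0 T1 (fun t => \sum_(l <- zl (absz k)./2) ik_sqr k l * duhamel_b k l t).
  exact: (@cintg_sum R 0 T1 _ (zl (absz k)./2) (fun l t => ik_sqr k l * duhamel_b k l t)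
    (fun l => cintgZ (ik_sqr k l) (ccont_cintg (cB l)))).
have iN : cintg 0 T1 (fun t => E (drate k) t * ('i * k%:~R * fourier (nonlin F (v t)) k)).
  exact: (ccont_cintg (ccontM T10 cE (ccontM T10 (@ccont_cst R 0 T1 _) (cG _ k)))).
have i0 : cintg 0 T1 (fun t => E (drate k) t * (acoef 0 t * (('i * k%:~R) * ('i * k%:~R) * fourier (v t) k))).
  exact: (ccont_cintg (ccontM T10 cE (ccontM T10 (cG _ 0)
    (ccontM T10 (@ccont_cst R 0 T1 _) (cU k))))).
apply: (eq_cintg _ (cintgB iN (cintgD (cintgD i0 iA) iB))) => t _.
rewrite -sum_a_split -sum_b_split /duhamel_rem -mulrDr -mulrBr; reflexivity.
Qed.

Lemma duhamel_split : 5/2 < s -> trajectory s alpha F sg%:C M T phi v ->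
  forall T1, 0 < T1 < T -> forall k,
  'i * k%:~R * (fourier (v T1) k * E (drate k) T1 - phi k) =
   sg%:C * (cint 0 T1 (duhamel_main k) + (\sum_(l <- zl (absz k)./2 | l != 0) ik_sqr k l * cint 0 T1 (duhamel_a k l) +
     (\sum_(l <- zl (absz k)./2) ik_sqr k l * cint 0 T1 (duhamel_b k l) + cint 0 T1 (duhamel_rem k)))).
Proof.
move=> s52 htr T1 /andP[T10 T1T] k.
have T1T' : 0 <= T1 <= T by rewrite !ltW.
have [cA cB cM iR] := duhamel_cont s52 htr T1T' k.
have [cU cJ cG] := traj_cont s52 htr T1T'.
have [hd0 hd] := traj_diff0 s52 (lt_trans T10 T1T) htr.
have T10' := ltW T10.
pose SA t := \sum_(l <- zl (absz k)./2 | l != 0) ik_sqr k l * duhamel_a k l t.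
pose SB t := \sum_(l <- zl (absz k)./2) ik_sqr k l * duhamel_b k l t.
have iA0 l : cintg 0 T1 (fun t => ik_sqr k l * duhamel_a k l t) by apply: cintgZ; exact: ccont_cintg.
have iB0 l : cintg 0 T1 (fun t => ik_sqr k l * duhamel_b k l t) by apply: cintgZ; exact: ccont_cintg.
have iA : cintg 0 T1 SA.
  have h := @cintg_sum R 0 T1 _ [seq l <- zl (absz k)./2 | l != 0] _ iA0.
  by apply: eq_cintg h => t _; rewrite big_filter.
have iB : cintg 0 T1 SB := @cintg_sum R 0 T1 _ (zl (absz k)./2) _ iB0.
have eA : \sum_(l <- zl (absz k)./2 | l != 0) ik_sqr k l * cint 0 T1 (duhamel_a k l) = cint 0 T1 SA.
  rewrite -big_filter; transitivity (cint 0 T1 (fun t => \sum_(l <- [seq l <- zl (absz k)./2 | l != 0]) ik_sqr k l * duhamel_a k l t)).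
    rewrite (cint_sum _ iA0).
    by apply: eq_bigr => l _; rewrite cintZ//; exact: ccont_cintg.
  by apply: eq_cint => t _; rewrite big_filter.
have eB : \sum_(l <- zl (absz k)./2) ik_sqr k l * cint 0 T1 (duhamel_b k l) = cint 0 T1 SB.
  rewrite (cint_sum _ iB0).
  by apply: eq_bigr => l _; rewrite cintZ//; exact: ccont_cintg.
have iM := ccont_cintg cM.
transitivity (sg%:C * (cint 0 T1 (duhamel_main k) + (cint 0 T1 SA + (cint 0 T1 SB + cint 0 T1 (duhamel_rem k))))); last first.
  by congr (_ * (_ + (_ + (_ + _)))); [exact: esym eA|exact: esym eB].
have e1 := cintD iB iR; have e2 := cintD iA (cintgD iB iR); have e3 := cintD iM (cintgD iA (cintgD iB iR)).
transitivity (sg%:C * cint 0 T1 (fun t => duhamel_main k t + (SA t + (SB t + duhamel_rem k t)))); last first.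
  by congr (_ * _); exact: etrans e3 (congr1 _ (etrans e2 (congr1 _ e1))).
have e4 := cintZ sg%:C (cintgD iM (cintgD iA (cintgD iB iR))).
apply: (etrans _ e4).
have h := hd k (drate k) T1 0 (lexx 0) T10' T1T; rewrite E0 mulr1 hd0 in h.
rewrite h -cintZ; last first.
  exact: (ccont_cintg (ccontM T10' (@ccont_E R 0 T1 _)
    (ccontD (ccontM T10' (@ccont_cst R 0 T1 _) (cU k)) (ccontM T10' (@ccont_cst R 0 T1 _) (cG _ k))))).
by apply: eq_cint => t _; exact: duhamel_integrand.
Qed.

Lemma Re_drate k : Re (drate k) = sg * k%:~R * Im m.
Proof.
have intC : (k%:~R : R[i]) = (k%:~R)%:C by rewrite rmorph_int.
by rewrite /drate intC !reimE /=; ring.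
Qed.

Lemma Im_drate k : Im (drate k) = sg * (pfreq k - k%:~R * Re m).
Proof.
have intC : (k%:~R : R[i]) = (k%:~R)%:C by rewrite rmorph_int.
by rewrite /drate intC !reimE /=; ring.
Qed.

(** The coefficient with its free evolution removed; its modulus is unchanged, while its time
    derivative loses the dispersive term. *)
Definition profile j t : R[i] := fourier (v t) j * E (sg%:C * 'i * (pfreq j)%:C) t.

Lemma profile_conj j t : ((profile (- j) t)^*)%R =
  (fourier (v t) (- j))^* * E (- (sg%:C * 'i * (pfreq j)%:C)) t.
Proof.
rewrite /profile rmorphM /pfreq mulrNz normrN; congr (_ * _).
apply: (etrans (E_J _ _)); congr (E _ t).
by apply: complexP; rewrite !reimE /=; ring.
Qed.

(** All fast oscillation is moved into the exponential, whose frequency is sg times the first phase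
    of [phase_bounds]. In [duhamel_b_profile] conjugation reverses the free phase, which yields the
    second one. *)
Lemma duhamel_a_profile k l t : duhamel_a k l t =
  E (drate k - sg%:C * 'i * (pfreq (k - l))%:C) t * (acoef l t * profile (k - l) t).
Proof.
rewrite /duhamel_a /profile; set x := _ * _ * _%:C.
have -> : E (drate k) t = E (drate k - x) t * E x t by rewrite -E_D subrK.
by move: (E _ t) (E _ t) (acoef l t) (fourier _ _) => x1 x2 x3 x4; ring.
Qed.

Lemma duhamel_b_profile k l t : duhamel_b k l t =
  E (drate k + sg%:C * 'i * (pfreq (k - l))%:C) t * (bcoef l t * ((profile (- (k - l)) t)^*)%R).
Proof.
rewrite /duhamel_b profile_conj; set x := _ * _ * _%:C.
have -> : E (drate k) t = E (drate k + x) t * E (- x) t by rewrite -E_D addrK.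
by move: (E _ t) (E _ t) (bcoef l t) ((_^*)%R) => x1 x2 x3 x4; ring.
Qed.

(** For |l| <= |k|/2 one has w(k) <= 2 w(k - l), so bounds on the profile at k - l become bounds in
    w(k) at the cost of 2^s. The constant A dominates all sizes and Lipschitz constants at once, as
    [osc_sum] demands. *)
Lemma osc_sums (A c c1 Z CV T1 p eps : R) k : sg = 1 \/ sg = -1 -> 1 <= s -> 1 <= p -> 0 <= A -> 0 < c -> 0 < c1 ->
  eps <= alpha - 2 -> p <= alpha - 1 - eps ->
  sumle (fun l => w l `^ (- s)) Z -> pi / (c * w k `^ (alpha - 1)) <= T1 -> 0 <= T1 < T ->
  Re (drate k) <= - (c1 * w k) ->
  (forall l, l \in zl (absz k)./2 ->
    (l != 0 -> c * (w k `^ (alpha - 1) * w l) <= `| pfreq k - k%:~R * Re m - pfreq (k - l)|) /\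
    c * (w k `^ (alpha - 1) * w l) <= `| pfreq k - k%:~R * Re m + pfreq (k - l)|) ->
  (forall l t, 0 <= t < T -> nc (acoef l t) <= A * w l `^ (- (s - 1))) ->
  (forall l t t', 0 <= t < T -> 0 <= t' < T -> nc (acoef l t - acoef l t') <= A * w l `^ p * `|t - t'|) ->
  (forall l t, 0 <= t < T -> nc (bcoef l t) <= A * w l `^ (- (s - 1))) ->
  (forall l t t', 0 <= t < T -> 0 <= t' < T -> nc (bcoef l t - bcoef l t') <= A * w l `^ p * `|t - t'|) ->
  (forall l t, 0 <= t < T -> nc (fourier (v t) l) <= M * w l `^ (- s)) ->
  (forall l t t', 0 <= t < T -> 0 <= t' < T -> nc (profile l t - profile l t') <= CV * w l `^ (- (s - 1)) * `|t - t'|) ->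
  0 <= M -> 0 <= CV -> 2 `^ s * M <= A -> 2 `^ s * CV <= A ->
  \sum_(l <- zl (absz k)./2 | l != 0) nc (cint 0 T1 (duhamel_a k l)) <=
    pi * A ^+ 2 / c * (4 + 2 / c1) * (Z + 1) * w k `^ (- (s + eps + 1)) /\
  \sum_(l <- zl (absz k)./2) nc (cint 0 T1 (duhamel_b k l)) <=
    pi * A ^+ 2 / c * (4 + 2 / c1) * (Z + 1) * w k `^ (- (s + eps + 1)).
Proof.
move=> hsg s1 p1 A0 c0 c10 ea pa hZ hT /andP[T10 T1T] hr hph ha la hb lb hU lV M0 CV0 AM AV.
have s0 : 0 <= s := le_trans ler01 s1.
have s10 : 0 <= s - 1 by rewrite subr_ge0.
have Rsg j : Re (sg%:C * 'i * (pfreq j)%:C) = 0 by rewrite !reimE /=; ring.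
have Isg j : Im (sg%:C * 'i * (pfreq j)%:C) = sg * pfreq j by rewrite !reimE /=; ring.
have asg (x : R) : `|sg * x| = `|x|.
  by rewrite normrM; case: hsg => ->; rewrite ?normrN normr1 mul1r.
have tin t : t \in `[0, T1] -> 0 <= t < T.
  by rewrite in_itv /= => /andP[-> h]; exact: le_lt_trans h T1T.
have wkl l : l \in zl (absz k)./2 -> w k <= 2 * w (k - l).
  move=> hl; have := abs_half (R := R) hl; rewrite /w intrB => h.
  have := ler_normD (k%:~R - l%:~R : R) l%:~R; rewrite subrK => h2.
  by move: (`|_|) (`|_|) (`|_|) h h2 => x y z h h2; lra.
have nprof j t : nc (profile j t) = nc (fourier (v t) j).
  by rewrite /profile ncM nc_E Rsg mul0r expR0 mulr1.
have bV l t : l \in zl (absz k)./2 -> 0 <= t < T -> nc (profile (k - l) t) <= A * w k `^ (- s).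
  move=> hl ht; rewrite nprof; apply: (le_trans (hU _ _ ht)).
  apply: (le_trans (ler_wpM2l M0 (wX_half s0 (wkl _ hl)))).
  by rewrite mulrA ler_wpM2r ?wX_ge0// mulrC.
have bVN l t : l \in zl (absz k)./2 -> 0 <= t < T -> nc (profile (- (k - l)) t) <= A * w k `^ (- s).
  move=> hl ht; rewrite nprof; apply: (le_trans (hU _ _ ht)); rewrite wN.
  apply: (le_trans (ler_wpM2l M0 (wX_half s0 (wkl _ hl)))).
  by rewrite mulrA ler_wpM2r ?wX_ge0// mulrC.
have X12 : 2 `^ (s - 1) <= 2 `^ s :> R by apply: ler_powR; [rewrite ler1n|rewrite gerBl].
have lVk l : l \in zl (absz k)./2 -> CV * w (k - l) `^ (- (s - 1)) <= A * w k `^ (- (s - 1)).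
  move=> hl; apply: (le_trans (ler_wpM2l CV0 (wX_half s10 (wkl _ hl)))).
  rewrite mulrA ler_wpM2r ?wX_ge0//; apply: le_trans AV.
  by rewrite mulrC ler_wpM2r.
split.
  rewrite (eq_bigr (fun l => nc (cint 0 T1 (fun t => E (drate k - sg%:C * 'i * (pfreq (k - l))%:C) t *
      (acoef l t * profile (k - l) t))))); last first.
    by move=> l _; congr nc; apply: eq_cint => t _; exact: duhamel_a_profile.
  apply: (osc_sum A0 c0 c10 s0 p1 ea pa hZ hT).
  - move=> l hl l0; have [h1 _] := hph l hl; split.
      by rewrite cReD cReN Rsg subr0.
    have -> : Im (drate k - sg%:C * 'i * (pfreq (k - l))%:C) = sg * (pfreq k - k%:~R * Re m - pfreq (k - l)).
      by rewrite cImD cImN Im_drate Isg; ring.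
    by rewrite asg; exact: h1.
  - by move=> l t /tin; exact: ha.
  - by move=> l t t' /tin h1 /tin h2; exact: la.
  - by move=> l t hl /tin; exact: bV.
  - move=> l t t' hl /tin h1 /tin h2; apply: (le_trans (lV _ _ _ h1 h2)).
    rewrite ler_wpM2r//; exact: lVk.
rewrite (eq_bigr (fun l => nc (cint 0 T1 (fun t => E (drate k + sg%:C * 'i * (pfreq (k - l))%:C) t *
    (bcoef l t * (profile (- (k - l)) t)^*))))); last first.
  by move=> l _; congr nc; apply: eq_cint => t _; exact: duhamel_b_profile.
apply: (osc_sum A0 c0 c10 s0 p1 ea pa hZ hT).
- move=> l hl l0; have [_ h1] := hph l hl; split.
    by rewrite cReD Rsg addr0.
  have -> : Im (drate k + sg%:C * 'i * (pfreq (k - l))%:C) = sg * (pfreq k - k%:~R * Re m + pfreq (k - l)).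
    by rewrite cImD Im_drate Isg; ring.
  by rewrite asg; exact: h1.
- by move=> l t /tin; exact: hb.
- by move=> l t t' /tin h1 /tin h2; exact: lb.
- by move=> l t hl /tin h1; rewrite ncJ; exact: bVN.
- move=> l t t' hl /tin h1 /tin h2; rewrite -rmorphB ncJ; apply: (le_trans (lV _ _ _ h1 h2)).
  by rewrite ler_wpM2r// wN; exact: lVk.
Qed.

End Duhamel.

(** As m is the mean at time 0, the drift is at most CA t. Integrated against the decaying
    exponential it gives the square of the inverse rate, which pays for the two derivatives on
    u_k. *)
Lemma duhamel_main_bound (s alpha sg M T CA T1 : R) (F : poly4) phi v k (m := fourier (nonlin (F_omega F) (v 0)) 0) :
  5/2 < s -> trajectory s alpha F sg%:C M T phi v -> 0 < T1 < T -> 0 <= CA -> Re (drate alpha sg m k) < 0 ->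
  (forall t t', 0 <= t < T -> 0 <= t' < T -> nc (acoef F v 0 t - acoef F v 0 t') <= CA * `|t - t'|) ->
  nc (cint 0 T1 (duhamel_main alpha sg F v m k)) <= 8 * (CA * (w k ^+ 2 * (M * w k `^ (- s)))) / (- Re (drate alpha sg m k)) ^+ 2.
Proof.
move=> s52 htr /andP[T10 T1T] CA0 r0 hA; have [hM _ _] := htr.
have T1T' : 0 <= T1 <= T by rewrite !ltW.
have i0 : 0 \in `[0, T] by rewrite in_itv /= lexx ltW//; exact: lt_trans T1T.
have M0 : 0 <= M by have [] := hM _ i0.
have [_ _ cM _] := duhamel_cont m s52 htr T1T' k.
apply: nc_cint_texp => //; first by rewrite oppr_gt0.
- by apply: mulr_ge0 => //; apply: mulr_ge0; [exact: sqr_ge0|rewrite mulr_ge0 ?wX_ge0].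
- exact: ltW.
- exact: ccont_cintg.
move=> t; rewrite in_itv /= => /andP[t0 t1].
have tT : t < T := le_lt_trans t1 T1T.
rewrite /duhamel_main ncM nc_E opprK mulrC ler_wpM2r ?expR_ge0// ncM.
have h1 : nc (acoef F v 0 t - m) <= CA * t.
  have := hA t 0; rewrite t0 tT lexx (lt_trans T10 T1T) subr0 ger0_norm// => h; exact: h.
have h2 : nc ('i * k%:~R * ('i * k%:~R) * fourier (v t) k) <= w k ^+ 2 * (M * w k `^ (- s)).
  rewrite ncM ncM nc_ik; apply: ler_pM; rewrite ?mulr_ge0 ?nc_ge0//.
    by apply: ler_pM => //; exact: abs_w.
  by apply: Hbd_pt; apply: hM; rewrite in_itv /= t0 ltW.
apply: (le_trans (ler_pM (nc_ge0 _) (nc_ge0 _) h1 h2)).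
by apply: eqW; ring.
Qed.

Lemma duhamel_rem_bound (s alpha sg M T C0 T1 : R) (F : poly4) phi v k m :
  5/2 < s -> trajectory s alpha F sg%:C M T phi v -> 0 < T1 < T -> 0 <= C0 -> Re (drate alpha sg m k) < 0 ->
  (forall f, Hbd s f M -> nc ('i * k%:~R * fourier (nonlin F f) k -
      (\sum_(l <- zl (absz k)./2) fourier (nonlin (mpoly.mderiv (@Ordinal 4 1 isT) F) f) l *
         (('i * (k - l)%:~R) * ('i * (k - l)%:~R) * fourier f (k - l)) +
       \sum_(l <- zl (absz k)./2) fourier (nonlin (mpoly.mderiv (@Ordinal 4 3 isT) F) f) l *
         (('i * (k - l)%:~R) * ('i * (k - l)%:~R) * (fourier f (- (k - l)))^*)))
   <= C0 * w k `^ (- (s - 1))) ->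
  nc (cint 0 T1 (duhamel_rem alpha sg F v m k)) <= 2 * (C0 * w k `^ (- (s - 1))) / - Re (drate alpha sg m k).
Proof.
move=> s52 htr /andP[T10 T1T] C00 r0 hC; have [hM _ _] := htr.
have T1T' : 0 <= T1 <= T by rewrite !ltW.
have [_ _ _ iR] := duhamel_cont m s52 htr T1T' k.
apply: nc_cint_exp => //; first by rewrite oppr_gt0.
- by rewrite mulr_ge0 ?wX_ge0.
- exact: ltW.
move=> t; rewrite in_itv /= => /andP[t0 t1].
rewrite /duhamel_rem ncM nc_E opprK mulrC ler_wpM2r ?expR_ge0//.
by apply: hC; apply: hM; rewrite in_itv /= t0 (le_trans t1)// ltW.
Qed.

(** The arithmetic of [core_estimate] with all powers made opaque: W is w(k), p1, p2, p3 are its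
    powers -s, -(s-1), -(s+eps), K is |k|, r the damping rate, nE the boundary term at T1 and S the
    oscillating sums. Every contribution is at most a constant times W p3, and division by K >= W/2
    gives the claim. *)
Lemma decay_algebra (W p1 p2 p3 c1 T1 CA M C0 D nphi K r nE S : R) :
  0 < W -> 0 < c1 -> 0 < T1 -> 0 <= CA -> 0 <= M -> 0 <= C0 -> 0 <= D -> 0 <= p1 -> c1 * W <= r ->
  W * p1 = p2 -> p1 <= W * p3 -> 2 * K >= W -> K <= W ->
  nE <= M * p1 / (r * T1) ->
  K * nphi <= K * nE + (8 * (CA * (W ^+ 2 * (M * p1))) / r ^+ 2 + (S + 2 * (C0 * p2) / r)) ->
  S <= 8 * D * (W * p3) ->
  nphi <= (2 * (M / (c1 * T1) + 8 * (CA * M) / c1 ^+ 2 + 2 * C0 / c1) + 16 * D) * p3.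
Proof.
move=> W0 c10 T10 CA0 M0 C00 D0 p10 hr hp2 hp3 K1 K2 hE h1 hS.
have cW : 0 < c1 * W by rewrite mulr_gt0.
have r0 : 0 < r := lt_le_trans cW hr.
have ri : r^-1 <= (c1 * W)^-1 by rewrite lef_pV2 ?posrE.
have WV : W / W = 1 by rewrite divff ?gt_eqF.
have p30 : 0 <= p3 by rewrite -(pmulr_rge0 _ W0); exact: le_trans hp3.
have b1 : K * nE <= M / (c1 * T1) * p1.
  apply: (@le_trans _ _ (W * (M * p1 / (c1 * W * T1)))); last first.
    by apply: eqW; field; rewrite !gt_eqF.
  have e1 : nE <= M * p1 / (c1 * W * T1).
    apply: (le_trans hE); rewrite ler_wpM2l ?mulr_ge0//.
    by rewrite lef_pV2 ?posrE ?mulr_gt0// ler_wpM2r// ltW.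
  have e2 : 0 <= M * p1 / (c1 * W * T1) by rewrite divr_ge0 ?mulr_ge0// ltW// mulr_gt0.
  have K0 : 0 <= K by lra.
  by apply: (le_trans (ler_wpM2l K0 e1)); rewrite ler_wpM2r.
have b2 : 8 * (CA * (W ^+ 2 * (M * p1))) / r ^+ 2 <= 8 * (CA * M) / c1 ^+ 2 * p1.
  apply: (@le_trans _ _ (8 * (CA * (W ^+ 2 * (M * p1))) / (c1 * W) ^+ 2)); last first.
    by apply: eqW; field; rewrite !gt_eqF.
  rewrite ler_wpM2l ?mulr_ge0 ?sqr_ge0 ?(ltW W0)//.
  by rewrite lef_pV2 ?posrE ?exprn_gt0// ler_pXn2r ?nnegrE// ltW.
have b3 : 2 * (C0 * p2) / r <= 2 * C0 / c1 * p1.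
  apply: (@le_trans _ _ (2 * (C0 * p2) / (c1 * W))); last first.
    by apply: eqW; rewrite -hp2; field; rewrite !gt_eqF.
  by rewrite ler_wpM2l// mulr_ge0// mulr_ge0// -hp2 mulr_ge0// ltW.
pose Q := M / (c1 * T1) + 8 * (CA * M) / c1 ^+ 2 + 2 * C0 / c1.
have Q0 : 0 <= Q.
  by rewrite /Q !addr_ge0// divr_ge0 ?mulr_ge0 ?sqr_ge0// ltW// mulr_gt0.
have h2 : K * nphi <= Q * p1 + 8 * D * (W * p3).
  apply: (le_trans h1).
  have -> : Q * p1 = M / (c1 * T1) * p1 + 8 * (CA * M) / c1 ^+ 2 * p1 + 2 * C0 / c1 * p1 by rewrite /Q; ring.
  by move: (lerD b1 (lerD b2 (lerD hS b3))) => /le_trans; apply; apply: eqW; ring.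
have h3 : K * nphi <= W * ((Q + 8 * D) * p3).
  apply: (le_trans h2); have := ler_wpM2l Q0 hp3 => h; have -> : W * ((Q + 8 * D) * p3) = Q * (W * p3) + 8 * D * (W * p3) by ring.
  by rewrite lerD2r.
have -> : 2 * (M / (c1 * T1) + 8 * (CA * M) / c1 ^+ 2 + 2 * C0 / c1) + 16 * D = 2 * (Q + 8 * D) by rewrite /Q; ring.
have QD : 0 <= (Q + 8 * D) * p3 by rewrite mulr_ge0// addr_ge0// mulr_ge0.
clear - K1 h3 QD W0.
have [n0|n0] := leP nphi 0; first by rewrite -mulrA (le_trans n0)// mulr_ge0.
have h4 : W * (nphi / 2) <= W * ((Q + 8 * D) * p3) by apply: le_trans h3; nra.
by rewrite (ler_pM2l W0) in h4; move: h4; rewrite -mulrA; move: (_ * p3) => x; lra.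
Qed.

Lemma nc_ik_sqr k l : l \in zl (absz k)./2 -> nc (ik_sqr k l : R[i]) <= 4 * w k ^+ 2.
Proof.
move=> hl; rewrite /ik_sqr ncM nc_ik -expr2.
have h : `|(k - l)%:~R| <= 2 * w k.
  have := abs_half (R := R) hl; have := abs_w (R := R) k; rewrite intrB.
  have := ler_normB (k%:~R : R) l%:~R; have := w_gt0 (R := R) k; lra.
have -> : 4 * w k ^+ 2 = (2 * w k) ^+ 2 by rewrite exprMn; congr (_ * _); rewrite expr2 -natrM.
by rewrite ler_pXn2r ?nnegrE ?mulr_ge0// ltW// w_gt0.
Qed.

Lemma nc_sum_ik_sqr k (P : pred int) (X : int -> R[i]) (B : R) :
  \sum_(l <- zl (absz k)./2 | P l) nc (X l) <= B ->
  nc (\sum_(l <- zl (absz k)./2 | P l) ik_sqr k l * X l) <= 4 * w k ^+ 2 * B.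
Proof.
move=> hB; apply: (le_trans (nc_sum _ _ _)).
have W0 : 0 <= 4 * w k ^+ 2 by rewrite mulr_ge0// sqr_ge0.
apply: le_trans (ler_wpM2l W0 hB); rewrite mulr_sumr big_seq_cond [leRHS]big_seq_cond.
by apply: ler_sum => l /andP[hl _]; rewrite ncM ler_wpM2r ?nc_ge0// nc_ik_sqr.
Qed.

Lemma core_estimate s alpha eps (F : poly4) (sg M T : R) phi v :
  2 < alpha -> alpha / 2 + 1 < s -> 5 / 2 < s -> 0 <= eps -> eps <= alpha - 2 -> eps <= 1/2 ->
  sg = 1 \/ sg = -1 -> 0 < T -> trajectory s alpha F sg%:C M T phi v ->
  Im (fourier (nonlin (F_omega F) (v 0)) 0) != 0 ->
  exists C K0 : R, forall k, K0 <= w k ->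
    sg * k%:~R * Im (fourier (nonlin (F_omega F) (v 0)) 0) < 0 ->
    nc (phi k) <= C * w k `^ (- (s + eps)).
Proof.
move=> a2 as2 s52 e0 ea e12 hsg T0 htr.
have sgn : nc sg%:C = 1 by rewrite nc_real; case: hsg => ->; rewrite ?normrN normr1.
have Rsg : Re (sg%:C * 'i) = 0 by rewrite !reimE /= mulr0 mul0r subrr.
set m := fourier _ 0 => m0n.
have [hM hc _] := htr.
pose G1 := mpoly.mderiv (@Ordinal 4 1 isT) F; pose G3 := mpoly.mderiv (@Ordinal 4 3 isT) F.
(* The exponent for [traj_coef_lip], at least 1 for [osc_sum]. That 1 + alpha - s <= s - 1 is the
   hypothesis s > alpha/2 + 1. The bound p <= alpha - 1 - eps is eps <= alpha - 2 if p = 1, and eps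
   <= s - 2 otherwise. *)
have [p [p1 pa2 ps pe]] : exists p : R, [/\ 1 <= p, 1 + alpha - s <= p, p <= s - 1 & p <= alpha - 1 - eps].
  exists (Num.max (1 + alpha - s) 1); rewrite !le_max !lexx orbT !ge_max; split=> //; clear - a2 as2 s52 e0 ea e12; lra.
have p0 : 0 <= p := le_trans ler01 p1.
have a1 : 1 <= alpha by clear - a2; lra.
have s1 : 1 < s by clear - s52; lra.
have [C0 C00 hC0] := @nonlin_linearized R s M F s52.
have [KA KA0 hKA] := @nonlin_Hbd R s M G1 s52.
have [KB KB0 hKB] := @nonlin_Hbd R s M G3 s52.
have [CA CA0 hCA] := traj_coef_lip G1 s52 a1 sgn T0 p0 ps pa2 htr.
have [CB CB0 hCB] := traj_coef_lip G3 s52 a1 sgn T0 p0 ps pa2 htr.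
have [CV CV0 hCV] := traj_profile_lip s52 sgn T0 Rsg htr.
have [Z hZ] := sumle_w s1.
have Z0 : 0 <= Z := sumle_ge0 hZ.
have inT t : 0 <= t < T -> t \in `[0, T] by rewrite in_itv /= => /andP[-> /ltW].
have M0 : 0 <= M by have [] := hM _ (inT 0 ltac:(by rewrite lexx)).
have [A [A0 [AA AB] [AcA AcB] [AM AV]]] : exists A : R, [/\ 0 <= A, KA <= A /\ KB <= A, CA <= A /\ CB <= A &
    2 `^ s * M <= A /\ 2 `^ s * CV <= A].
  have XM : 0 <= 2 `^ s * M by rewrite mulr_ge0 ?powR_ge0.
  have XV : 0 <= 2 `^ s * CV by rewrite mulr_ge0 ?powR_ge0.
  exists (KA + KB + CA + CB + 2 `^ s * M + 2 `^ s * CV).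
  move: (2 `^ s * M) (2 `^ s * CV) XM XV => x y x0 y0; clear - KA0 KB0 CA0 CB0 x0 y0.
  by split; [|split|split|split]; lra.
have [c c0 [K1 hph]] := phase_bounds (Re m) a2.
(* The integral identity is available only at times strictly inside [0, T]. *)
have T10 : 0 < T / 2 by rewrite divr_gt0.
have T1T : T / 2 < T by clear - T0; lra.
move: (T / 2) T10 T1T => T1 T10 T1T.
have a10 : 0 < alpha - 1 by clear - a2; lra.
(* For such k, half a period of every oscillation fits into [0, T1], as [osc_bound] requires. *)
have [K2 hK2] := w_powR_large (pi / (c * T1)) a10.
(* The damping rate is |k Im m|, and |k| >= w(k)/2 for nonzero k. *)
have c10 : 0 < `|Im m| / 2 by rewrite divr_gt0// normr_gt0.
pose c1 := `|Im m| / 2; rewrite -/c1 in c10.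
pose D := pi * A ^+ 2 / c * (4 + 2 / c1) * (Z + 1).
have D0 : 0 <= D.
  apply: mulr_ge0; last by rewrite addr_ge0.
  apply: mulr_ge0; last by rewrite addr_ge0// divr_ge0// ltW.
  by rewrite divr_ge0 ?(ltW c0)// mulr_ge0 ?sqr_ge0// pi_ge0.
exists (2 * (M / (c1 * T1) + 8 * (CA * M) / c1 ^+ 2 + 2 * C0 / c1) + 16 * D), (Num.max 2 (Num.max K1 K2)) => k.
rewrite !ge_max => /and3P[k2 kK1 kK2] hs.
have k0 : k != 0.
  by apply: contraTneq hs => ->; rewrite mulr0z mulr0 mul0r ltxx.
have hw : w k <= 2 * `|k%:~R| := w_le_abs k0.
have wk0 := w_gt0 (R := R) k.
have T1T' : 0 < T1 < T by rewrite T10.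
have Rlam : Re (drate alpha sg m k) = sg * k%:~R * Im m := Re_drate _ _ _ _.
have r0 : Re (drate alpha sg m k) < 0 by rewrite Rlam.
have hr : c1 * w k <= - Re (drate alpha sg m k).
  have <- : `|Re (drate alpha sg m k)| = - Re (drate alpha sg m k) by rewrite ltr0_norm.
  rewrite Rlam !normrM; have -> : `|sg| = 1 by case: hsg => ->; rewrite ?normrN normr1.
  by rewrite mul1r /c1; have := ler_wpM2r (normr_ge0 (Im m)) hw; clear; lra.
have cT : pi / (c * w k `^ (alpha - 1)) <= T1.
  have := hK2 k kK2; rewrite !ler_pdivrMr ?mulr_gt0 ?wX_gt0//; move: (w k `^ _) => x; clear; lra.
have T1T2 : 0 <= T1 < T by rewrite ltW.
have hr' : Re (drate alpha sg m k) <= - (c1 * w k) by move: hr; clear; lra.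
have up (x y z : R) : x <= y -> 0 <= z -> x * z <= y * z by move=> xy z0; rewrite ler_wpM2r.
have [SA SB] : \sum_(l <- zl (absz k)./2 | l != 0) nc (cint 0 T1 (duhamel_a alpha sg F v m k l)) <= D * w k `^ (- (s + eps + 1)) /\
    \sum_(l <- zl (absz k)./2) nc (cint 0 T1 (duhamel_b alpha sg F v m k l)) <= D * w k `^ (- (s + eps + 1)).
  apply: (osc_sums (M := M) (CV := CV) (T := T) hsg (ltW s1) p1 A0 c0 c10 ea pe hZ cT T1T2 hr') => //.
  - by move=> l hl; exact: hph.
  - move=> l t /inT ht; apply: (le_trans (Hbd_pt l (hKA _ (hM _ ht)))).
    by apply: up AA (wX_ge0 _ _).
  - move=> l t t' ht ht'; apply: (le_trans (hCA _ _ _ ht ht')).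
    by apply: (up) => //; apply: up AcA (wX_ge0 _ _).
  - move=> l t /inT ht; apply: (le_trans (Hbd_pt l (hKB _ (hM _ ht)))).
    by apply: up AB (wX_ge0 _ _).
  - move=> l t t' ht ht'; apply: (le_trans (hCB _ _ _ ht ht')).
    by apply: (up) => //; apply: up AcB (wX_ge0 _ _).
  - by move=> l t /inT ht; exact: Hbd_pt (hM _ ht).
  - by move=> l t t' ht ht'; exact: hCV.
have hdM : nc (cint 0 T1 (duhamel_main alpha sg F v m k)) <=
    8 * (CA * (w k ^+ 2 * (M * w k `^ (- s)))) / (- Re (drate alpha sg m k)) ^+ 2.
  apply: (duhamel_main_bound s52 htr T1T' CA0 r0) => t t' ht ht'; apply: (le_trans (hCA _ _ _ ht ht')).
  by rewrite /w mulr0z normr0 addr0 powR1 mulr1.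
have hdR : nc (cint 0 T1 (duhamel_rem alpha sg F v m k)) <= 2 * (C0 * w k `^ (- (s - 1))) / - Re (drate alpha sg m k).
  by apply: (duhamel_rem_bound s52 htr T1T' C00 r0) => f hf; exact: hC0.
have hD := duhamel_split m s52 htr T1T' k.
pose nE := nc (fourier (v T1) k * E (drate alpha sg m k) T1).
pose S := 4 * w k ^+ 2 * (D * w k `^ (- (s + eps + 1))) + 4 * w k ^+ 2 * (D * w k `^ (- (s + eps + 1))).
apply: (@decay_algebra (w k) (w k `^ (- s)) (w k `^ (- (s - 1))) _ c1 T1 CA M C0 D _ `|k%:~R|
   (- Re (drate alpha sg m k)) nE S) => //.
- exact: wX_ge0.
- by rewrite -{1}(wX1 k) -wXD; congr (_ `^ _); ring.
- by rewrite -{2}(wX1 k) -wXD; apply: wX_mono; clear - e12; lra.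
- exact: abs_w.
(* Boundedness of the solution at T1 is used here: e^(-r T1) <= 1/(r T1) makes the boundary term one
   power of w(k) smaller than u_k itself. *)
- rewrite /nE ncM nc_E; have h1 := Hbd_pt k (hM _ (inT _ T1T2)).
  have rT : 0 < - Re (drate alpha sg m k) * T1 by rewrite mulr_gt0// oppr_gt0.
  apply: ler_pM => //; rewrite ?nc_ge0 ?expR_ge0//.
  have -> : Re (drate alpha sg m k) * T1 = - (- Re (drate alpha sg m k) * T1) by ring.
  rewrite expRN lef_pV2 ?posrE ?expR_gt0//; apply: le_trans (expR_ge1Dx _).
  by rewrite lerDr.
- have e1 : `|k%:~R| * nc (phi k) <= `|k%:~R| * nE +
      nc ('i * k%:~R * (fourier (v T1) k * E (drate alpha sg m k) T1 - phi k)).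
    rewrite ncM nc_ik -mulrDr ler_wpM2l// ncBC.
    have := ncD (phi k - fourier (v T1) k * E (drate alpha sg m k) T1) (fourier (v T1) k * E (drate alpha sg m k) T1).
    by rewrite subrK addrC.
  apply: (le_trans e1); rewrite lerD2l hD ncM sgn mul1r.
  apply: (le_trans (ncD _ _)); apply: lerD => //.
  apply: (le_trans (ncD _ _)); rewrite -addrA; apply: lerD; first exact: nc_sum_ik_sqr.
  by apply: (le_trans (ncD _ _)); apply: lerD => //; exact: nc_sum_ik_sqr.
- rewrite /S; have -> : w k `^ (- (s + eps + 1)) = w k `^ (- (s + eps)) * w k `^ (- 1) by rewrite -wXD; congr (_ `^ _); ring.
  rewrite [w k `^ (- 1)]powRN powRr1 ?(ltW wk0)// le_eqVlt; apply/orP; left; apply/eqP; field.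
  by rewrite gt_eqF.
Qed.

End Decay.

(** * A datum without decay *)

Section Lacunary.
Context {R : realType}.
Implicit Types (s eps : R) (k j : int).
Local Notation w := (@w R).

Definition pow2 (n : nat) := n == (2 ^ trunc_log 2 n)%N.
(** Numbers the powers of two and their negatives by distinct integers; the shift by one separates 1
    from -1, whose logarithms are both 0. *)
Definition lacidx k : int :=
  if 0 <= k then (trunc_log 2 (absz k)).+1%:Z else - (trunc_log 2 (absz k)).+1%:Z.
(* Supported on the powers of two, where lacidx k grows like log |k|: enough for square
   summability, and too slow to gain a power. *)
Definition lac s k : R := if pow2 (absz k) then w k `^ (- s) / w (lacidx k) else 0.

Lemma lac_ge0 s k : 0 <= lac s k.
Proof. by rewrite /lac; case: ifP => // _; rewrite divr_ge0 ?wX_ge0// ltW ?w_gt0. Qed.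

Lemma lac_le s k : lac s k <= w k `^ (- s).
Proof.
rewrite /lac; case: ifP => _; last exact: wX_ge0.
by rewrite ler_pdivrMr ?w_gt0// ler_peMr ?wX_ge0// w_ge1.
Qed.

Lemma lacidx_inj k j : pow2 (absz k) -> pow2 (absz j) -> lacidx k = lacidx j -> k = j.
Proof.
rewrite /pow2 /lacidx => /eqP hk /eqP hj h.
have ht : trunc_log 2 (absz k) = trunc_log 2 (absz j).
  by move: (trunc_log 2 _) (trunc_log 2 _) h => x y; case: ifP => _; case: ifP => _; lia.
have kj : absz k = absz j by rewrite hk hj ht.
by move: h; rewrite ht; move: (trunc_log 2 _) kj {hk hj ht} => x kj; do 2!case: ifP; move: kj; clear; lia.
Qed.

(** On its support the weighted square is w(lacidx k)^(-2), and [lacidx] is injective there, so the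
    sum is part of the convergent sum of w(j)^(-2). *)
Lemma lac_sumle s : exists2 B, 0 <= B & sumle (fun k => (w k `^ s * lac s k) ^+ 2) (B ^+ 2).
Proof.
have [Z hZ] := @sumle_w R 2 ltac:(lra).
have Z0 := sumle_ge0 hZ.
exists (Num.sqrt Z); rewrite ?sqrtr_ge0// sqr_sqrtr// => r ur.
have e k : (w k `^ s * lac s k) ^+ 2 = if pow2 (absz k) then w (lacidx k) `^ (- 2) else 0.
  rewrite /lac; case: ifP => _; last by rewrite mulr0 expr0n.
  rewrite mulrA [_ * _ `^ _]mulrC wXN mul1r powRN (powR_mulrn 2) ?(ltW (w_gt0 _))//.
  by rewrite exprVn.
under eq_bigr do rewrite e.
rewrite -big_mkcond -big_filter -(big_map lacidx predT (fun j => w j `^ (- 2))).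
apply: hZ; rewrite map_inj_in_uniq ?filter_uniq// => k j.
by rewrite !mem_filter => /andP[hk _] /andP[hj _]; exact: lacidx_inj.
Qed.

Lemma linear_lt_exp (a C : R) : 0 < a -> exists N : nat, forall n, (N <= n)%N ->
  C * n.+2%:R < expR (a * n%:R).
Proof.
move=> a0; have [b b0 ab] : exists2 b : R, 0 < b & a = b + b.
  by exists (a / 2); [rewrite divr_gt0|field].
have x0 : 0 <= 3 * `|C| / b ^+ 2 by rewrite divr_ge0 ?sqr_ge0// mulr_ge0.
exists (Num.bound (3 * `|C| / b ^+ 2)).+1 => n hn.
have hn2 : 3 * `|C| / b ^+ 2 < n%:R.
  by apply: (lt_le_trans (archi_boundP x0)); rewrite ler_nat ltnW.
have n1 : 1 <= n%:R :> R by rewrite ler1n; case: (n) hn.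
have h1 : 3 * `|C| < n%:R * b ^+ 2 by rewrite -ltr_pdivrMr// exprn_gt0.
have h2 : (b * n%:R) ^+ 2 <= expR (a * n%:R).
  have -> : a * n%:R = b * n%:R + b * n%:R by rewrite ab; ring.
  rewrite expRD -expr2 ler_pXn2r ?nnegrE ?expR_ge0 ?mulr_ge0 ?(ltW b0)//.
  by apply: le_trans (expR_ge1Dx _); rewrite lerDr.
apply: (lt_le_trans _ h2); apply: (@le_lt_trans _ _ (`|C| * (3 * n%:R))).
  apply: (@le_trans _ _ (`|C| * n.+2%:R)); first by rewrite ler_wpM2r// ler_norm.
  by rewrite ler_wpM2l// -addn2 natrD; lra.
have -> : `|C| * (3 * n%:R) = n%:R * (3 * `|C|) by ring.
have -> : (b * n%:R) ^+ 2 = n%:R * (n%:R * b ^+ 2) by ring.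
by rewrite ltr_pM2l//; lra.
Qed.

(** At k = 2^n the series has coefficient w(k)^(-s) / (n + 2), while the gain w(k)^(-eps) is at most
    2^(-n eps), which decreases exponentially in n. *)
Lemma lac_large s eps (C K0 : R) : 0 < eps -> exists k : int, [/\ 0 < k, K0 <= w k &
  C * w k `^ (- (s + eps)) < lac s k /\ C * w k `^ (- (s + eps)) < lac s (- k)].
Proof.
move=> e0; have l2 : 0 < ln 2 :> R by rewrite ln_gt0// ltr1n.
have [N hN] := @linear_lt_exp (eps * ln 2) C (mulr_gt0 e0 l2).
pose n := maxn N (Num.bound `|K0|).
exists (2 ^ n)%:Z.
have wge : (2 ^ n)%:R <= w (2 ^ n)%:Z by rewrite w_nat ler_nat.
have hp : pow2 (absz (2 ^ n)%:Z) by rewrite /pow2 /= trunc_expnK.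
have hl : lac s (2 ^ n)%:Z = w (2 ^ n)%:Z `^ (- s) / n.+2%:R.
  by rewrite /lac hp /lacidx le0z_nat absz_nat trunc_expnK// -(w_nat n.+1).
have hlN : lac s (- (2 ^ n)%:Z) = lac s (2 ^ n)%:Z.
  rewrite /lac abszN wN; congr (if _ then _ / _ else _).
  rewrite /lacidx abszN oppr_ge0; have h0 : (0 < (2 ^ n)%N)%N by rewrite expn_gt0.
  by rewrite le0z_nat; case: leP => hh; [lia|rewrite wN].
split; first by rewrite ltz_nat expn_gt0.
  apply: le_trans wge; apply: (le_trans (ler_norm _)).
  apply: (le_trans (ltW (archi_boundP (normr_ge0 K0)))); rewrite ler_nat.
  by apply: leq_trans (ltnW (ltn_expl _ _)) => //; exact: leq_maxr.
suff h : C * w (2 ^ n)%:Z `^ (- (s + eps)) < lac s (2 ^ n)%:Z by rewrite hlN.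
rewrite hl ltr_pdivlMr ?ltr0n//.
have -> : w (2 ^ n)%:Z `^ (- (s + eps)) = w (2 ^ n)%:Z `^ (- s) * w (2 ^ n)%:Z `^ (- eps).
  by rewrite -wXD; congr (_ `^ _); ring.
set A := w _ `^ (- s); have A0 : 0 < A by exact: wX_gt0.
have -> : C * (A * w (2 ^ n)%:Z `^ (- eps)) * n.+2%:R = A * (C * n.+2%:R * w (2 ^ n)%:Z `^ (- eps)) by ring.
suff h : C * n.+2%:R * w (2 ^ n)%:Z `^ (- eps) < 1.
  by move: h; move: (C * _ * _) => x h; rewrite -[ltRHS]mulr1 ltr_pM2l.
rewrite powRN ltr_pdivrMr ?wX_gt0// mul1r.
apply: (lt_le_trans (hN n (leq_maxl _ _))).
apply: (@le_trans _ _ ((2 ^ n)%:R `^ eps)).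
  rewrite natrX /powR expf_eq0 pnatr_eq0 andbF lnXn// ler_expR -mulr_natr.
  by apply: eqW; ring.
by apply: ge0_ler_powR; rewrite ?nnegrE ?ler0n ?(ltW (w_gt0 _)) ?(ltW e0).
Qed.

End Lacunary.

(** * Decay forced by a solution, and the perturbed datum *)

Section NonExistence.
Context {R : realType}.
Implicit Types (f g : R -> R[i]) (T t s alpha eps M tau : R) (k j : int) (u : R -> R -> R[i]).
Local Notation w := (@w R).
Local Notation poly4 := (mpoly.mpoly 4 R[i]).

(** The sign of tau selects the half line of frequencies; its size is irrelevant. *)
Definition decays s eps tau (c : int -> R[i]) := exists C K0 : R, forall k, K0 <= w k ->
  0 < tau * k%:~R -> nc (c k) <= C * w k `^ (- (s + eps)).

(** If both sequences decayed on the half line, so would their difference, a multiple of the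
    lacunary sequence; [lac_large] forbids this for either sign of the frequency. *)
Lemma lac_not_decays s eps tau (c1 c2 : int -> R[i]) (a : R[i]) : 0 < eps -> tau != 0 -> a != 0 ->
  (forall k, c1 k - c2 k = a * (lac s k)%:C) -> decays s eps tau c1 -> decays s eps tau c2 -> False.
Proof.
move=> e0 t0 a0 hc [C1 [K1 h1]] [C2 [K2 h2]].
have na0 : 0 < nc a.
  by rewrite lt_neqAle nc_ge0 eq_sym andbT; apply: contraNneq a0 => /nc_eq0 ->.
have [k [k0 kK [hk hkN]]] := lac_large s ((C1 + C2) / nc a) (Num.max K1 K2) e0.
have key j : Num.max K1 K2 <= w j -> 0 < tau * j%:~R ->
    lac s j <= (C1 + C2) / nc a * w j `^ (- (s + eps)).
  rewrite ge_max => /andP[j1 j2] jt.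
  have : nc (a * (lac s j)%:C) <= (C1 + C2) * w j `^ (- (s + eps)).
    by rewrite -hc mulrDl; apply: (le_trans (ncB _ _)); apply: lerD; [exact: h1|exact: h2].
  rewrite ncM nc_real ger0_norm ?lac_ge0// mulrAC ler_pdivlMr//.
  by rewrite mulrC.
have kr : 0 < (k%:~R : R) by rewrite ltr0z.
have [tp|tn] := ltP 0 tau.
  by have := key k kK (mulr_gt0 tp kr); rewrite leNgt hk.
have tn' : tau < 0 by rewrite lt_neqAle t0.
have := key (- k); rewrite wN mulrNz mulrN -mulNr => /(_ kK).
by rewrite pmulr_lgt0// oppr_gt0 => /(_ tn'); rewrite -[w k](wN k) leNgt wN hkN.
Qed.

(** A bound near the initial time is enough, since the decay argument can be run on an arbitrarily
    short interval. *)
Lemma C_Hs_local_bound s a b u t0 : 0 <= s -> C_Hs s a b u -> t0 \in `[a, b] ->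
  exists2 d : R, 0 < d & exists M, forall t, t \in `[a, b] -> `|t - t0| < d -> Hbd s (u t) M.
Proof.
move=> s0 hC ht0; have [d d0 hd] := C_Hs_coef s0 hC ht0 ltr01.
exists d => //; have [hu0 _] := hC _ ht0.
exists (2 * (1 + 2 `^ (s / 2) * Hs_norm s (u t0))) => t ht td.
have := HbdD (hd _ ht td) (Hs_Hbd s0 hu0).
by rewrite (_ : (fun x => _) = u t)//; apply/funext => x /=; rewrite subrK.
Qed.

Lemma fwd_trajectory s alpha (F : poly4) T phi u : 5/2 < s -> 0 < T -> Hs s phi -> C_Hs s 0 T u ->
  solution_fwd alpha F s T phi u ->
  exists T0 M, 0 < T0 /\ trajectory s alpha F 1 M T0 (fourier phi) u.
Proof.
move=> s52 T0 hphi hC hsol; have s0 : 0 <= s by lra.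
have i0 : 0 \in `[0, T] by rewrite in_itv /= lexx ltW.
have [d d0 [M hM]] := C_Hs_local_bound s0 hC i0.
have [lphi _ _] := Hs_Hbd s0 hphi.
have [T1 [T10 T1d T1T]] : exists T1 : R, [/\ 0 < T1, T1 < d & T1 < T].
  have [m0 m1 m2] : [/\ 0 < Num.min d T, Num.min d T <= d & Num.min d T <= T].
    by rewrite lt_min d0 T0 !ge_min !lexx orbT.
  by exists (Num.min d T / 2); move: (Num.min d T) m0 m1 m2 => m m0 m1 m2; clear - m0 m1 m2; split; lra.
exists T1, M; split=> //; apply: solution_fwd_trajectory hsol => //; first by rewrite T10.
move=> t; rewrite in_itv /= => ht; apply: hM; first by rewrite in_itv /=; lra.
by rewrite subr0 ger0_norm; lra.
Qed.

Lemma bwd_trajectory s alpha (F : poly4) T phi u : 5/2 < s -> 0 < T -> Hs s phi -> C_Hs s (- T) 0 u ->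
  solution_bwd alpha F s T phi u ->
  exists T0 M, 0 < T0 /\ trajectory s alpha F (-1) M T0 (fourier phi) (fun t => u (- t)).
Proof.
move=> s52 T0 hphi hC hsol; have s0 : 0 <= s by lra.
have i0 : 0 \in `[- T, 0] by rewrite in_itv /= lexx andbT oppr_le0 ltW.
have [d d0 [M hM]] := C_Hs_local_bound s0 hC i0.
have [lphi _ _] := Hs_Hbd s0 hphi.
have [T1 [T10 T1d T1T]] : exists T1 : R, [/\ 0 < T1, T1 < d & T1 < T].
  have [m0 m1 m2] : [/\ 0 < Num.min d T, Num.min d T <= d & Num.min d T <= T].
    by rewrite lt_min d0 T0 !ge_min !lexx orbT.
  by exists (Num.min d T / 2); move: (Num.min d T) m0 m1 m2 => m m0 m1 m2; clear - m0 m1 m2; split; lra.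
exists T1, M; split=> //; apply: solution_bwd_trajectory hsol => //; first by rewrite T10.
move=> t; rewrite in_itv /= => ht; apply: hM; first by rewrite in_itv /=; lra.
by rewrite subr0 normrN ger0_norm; lra.
Qed.

Lemma trajectory_decays s alpha eps (F : poly4) (sg T M : R) phi u :
  2 < alpha -> alpha / 2 + 1 < s -> 5 / 2 < s -> 0 <= eps -> eps <= alpha - 2 -> eps <= 1/2 ->
  sg = 1 \/ sg = -1 -> 0 < T -> Hs s phi -> trajectory s alpha F sg%:C M T (fourier phi) u ->
  Im (fourier (nonlin (F_omega F) phi) 0) != 0 ->
  decays s eps (- sg * Im (fourier (nonlin (F_omega F) phi) 0)) (fourier phi).
Proof.
move=> a2 as2 s52 e0 ea e12 hsg T0 hphi htr hm.
have s0 : 0 <= s by clear - s52; lra.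
have [hM _ _] := htr; have [h0 _] := traj_diff0 s52 T0 htr.
have hphiB := Hs_Hbd s0 hphi.
have hu0 : Hbd s (u 0) M by apply: hM; rewrite in_itv /= lexx ltW.
(* The value u 0 and phi may be different representatives; they have the same coefficients, hence
   the same mean of F_omega. *)
have em : fourier (nonlin (F_omega F) (u 0)) 0 = fourier (nonlin (F_omega F) phi) 0.
  apply: (@eq_nonlin R s (Num.max M (2 `^ (s / 2) * Hs_norm s phi))) => //.
    by apply: Hbd_mono hu0; rewrite ?le_max lexx.
  by apply: Hbd_mono hphiB; rewrite ?le_max lexx ?orbT.
have [C [K0 hC]] := core_estimate a2 as2 s52 e0 ea e12 hsg T0 htr ltac:(by rewrite em).
exists C, K0 => k hk ht; apply: hC; first exact: hk.
rewrite em; move: (fourier _ 0) ht => z ht; rewrite -oppr_gt0.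
have -> // : - (sg * k%:~R * Im z) = - sg * Im z * k%:~R by ring.
Qed.

(** Pigeonhole: if each of three points satisfied P or Q, two of them would share one of these
    properties. *)
Lemma dichotomy3 (P Q : R -> Prop) (x y z : R) : x != y -> x != z -> y != z ->
  (forall a b, a != b -> P a -> P b -> False) -> (forall a b, a != b -> Q a -> Q b -> False) ->
  exists2 a, a \in [:: x; y; z] & ~ P a /\ ~ Q a.
Proof.
move=> xy xz yz hP hQ; apply: contrapT => h.
have PQ a : a \in [:: x; y; z] -> P a \/ Q a.
  move=> ha; apply: contrapT => hn; apply: h; exists a => //.
  by split=> H; apply: hn; [left|right].
have [px|qx] := PQ x (mem_head _ _); have [py|qy] := PQ y ltac:(by rewrite !inE eqxx orbT);
  have [pz|qz] := PQ z ltac:(by rewrite !inE eqxx !orbT);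
  solve [exact: hP xy px py|exact: hP xz px pz|exact: hP yz py pz|
    exact: hQ xy qx qy|exact: hQ xz qx qz|exact: hQ yz qy qz].
Qed.

Lemma Hs_lac s : 1 < s -> Hs s (fser (fun k => (lac s k)%:C : R[i])) /\
  forall k, fourier (fser (fun k => (lac s k)%:C)) k = (lac s k)%:C :> R[i].
Proof.
move=> s1; have [Z hZ] := sumle_w s1.
have hc : asum (fun k => (lac s k)%:C) Z.
  by apply: sumle_mono hZ => // k; rewrite nc_real ger0_norm ?lac_ge0// lac_le.
have hf k := fourier_fser k hc.
split=> //; have [B B0 hB] := lac_sumle (R := R) s.
apply: (@Hbd_Hs R s _ B); [exact: le_trans (ltW s1)|exact: L2T_fser hc|].
split=> //; first exact: L1T_fser hc.
by apply: sumle_mono hB => // k; rewrite hf nc_real ger0_norm ?lac_ge0.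
Qed.

(* For each of the two half lines at most one multiple of the lacunary series can decay. *)
Lemma perturbed_datum s eps (F : poly4) psi : 5/2 < s -> 0 < eps -> Hs s psi ->
  Im (fourier (nonlin (F_omega F) psi) 0) != 0 ->
  exists phi, [/\ Hs s phi, Im (fourier (nonlin (F_omega F) phi) 0) != 0 &
    forall tau, tau != 0 -> ~ decays s eps tau (fourier phi)].
Proof.
move=> s52 e0 hpsi hm; have s0 : 0 <= s by clear - s52; lra.
have s1 : 1 < s by clear - s52; lra.
have [hL fL] := Hs_lac s1; set L := fser _ in hL fL.
have [M1 hpsiB] : exists M1, Hbd s psi M1 := ex_intro _ _ (Hs_Hbd s0 hpsi).
have [M2 hLB] : exists M2, Hbd s L M2 := ex_intro _ _ (Hs_Hbd s0 hL).
have [l1 M10 _] := hpsiB; have [l2 M20 _] := hLB.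
pose ph (th : R) x := psi x + th%:C * L x.
have fph th k : fourier (ph th) k = fourier psi k + th%:C * (lac s k)%:C.
  by rewrite fourierD//; [rewrite fourierZ// fL|exact: L1TZ].
have Hph th : Hs s (ph th) by exact: Hs_comb.
pose M := 2 * (M1 + M2).
have Bph th : 0 <= th <= 1 -> Hbd s (ph th) M.
  move=> /andP[t0 t1]; apply: Hbd_mono (HbdD hpsiB (HbdZ th%:C hLB)) => //.
  have h : nc th%:C * M2 <= M2 by rewrite nc_real ger0_norm// ler_piMl.
  by rewrite /M (ler_wpM2l (ler0n R 2))//; exact: lerD.
have Bpsi : Hbd s psi M by apply: Hbd_mono hpsiB => //; rewrite /M; clear - M10 M20; lra.
have [C C0 hC] := nonlin_cont M (F_omega F) s52.
pose m0 := Im (fourier (nonlin (F_omega F) psi) 0).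
have n0 : 0 < `|m0| by rewrite normr_gt0.
have CM : 0 <= C * M2 by rewrite mulr_ge0.
have close th : 0 <= th <= 1 -> `|Im (fourier (nonlin (F_omega F) (ph th)) 0) - m0| <= C * M2 * th.
  move=> ht; have t0 : 0 <= th by case/andP: ht.
  have h := hC _ _ (Bph th ht) Bpsi (th * M2) (mulr_ge0 t0 M20).
  have -> : C * M2 * th = C * (th * M2) by ring.
  rewrite /m0 -cImN -cImD; apply: (le_trans (Im_le_nc _)); apply: h => j.
  rewrite fph addrAC subrr add0r -fL ncM nc_real ger0_norm// -mulrA ler_wpM2l//.
  exact: Hbd_pt hLB.
(* So small that the imaginary part of the mean moves by less than its modulus and keeps its
   sign. *)
have [t0 [t00 t01 t02]] : exists t0 : R, [/\ 0 < t0, t0 <= 1 & C * M2 * t0 < `|m0|].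
  exists (Num.min 1 (`|m0| / (C * M2 + 1) / 2)).
  have p1 : 0 < C * M2 + 1 by clear - CM; lra.
  split; rewrite ?lt_min ?ltr01 ?divr_gt0// ?ge_min ?lexx//.
  apply: (@le_lt_trans _ _ (C * M2 * (`|m0| / (C * M2 + 1) / 2))).
    by rewrite ler_wpM2l// ge_min lexx orbT.
  have h : `|m0| / (C * M2 + 1) * (C * M2 + 1) = `|m0| by rewrite divfK// gt_eqF.
  have h2 : 0 < `|m0| / (C * M2 + 1) by rewrite divr_gt0.
  move: (C * M2) (`|m0| / (C * M2 + 1)) `|m0| n0 CM h h2 => x y z z0 x0 h y0.
  clear - z0 x0 h y0; nra.
have aux (x y : R) : 0 < `|y| -> `|x - y| < `|y| -> 0 < x * y.
  clear => y0; rewrite ltr_norml; have [h|h] := ltP 0 y.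
    by rewrite gtr0_norm// => /andP[h1 _]; apply: mulr_gt0 => //; lra.
  have {}h : y < 0 by rewrite lt_neqAle h andbT -normr_gt0.
  by rewrite ltr0_norm// => /andP[_ h1]; rewrite nmulr_rgt0//; lra.
have same th : 0 < th <= t0 -> 0 < Im (fourier (nonlin (F_omega F) (ph th)) 0) * m0.
  move=> /andP[th0 th1]; have := close th; rewrite (ltW th0) (le_trans th1 t01) => /(_ isT) h.
  have h2 : `|Im (fourier (nonlin (F_omega F) (ph th)) 0) - m0| < `|m0|.
    by apply: (le_lt_trans h); apply: le_lt_trans t02; rewrite ler_wpM2l.
  exact: aux n0 h2.
have uniqd tau : tau != 0 -> forall a b, a != b -> decays s eps tau (fourier (ph a)) ->
    decays s eps tau (fourier (ph b)) -> False.
  move=> tau0 a b ab; apply: (@lac_not_decays s eps tau _ _ (a - b)%:C) => //.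
    by apply: contraNneq ab => /complexI/eqP; rewrite subr_eq0.
  by move=> k; rewrite !fph rmorphB mulrBl opprD addrACA subrr add0r.
have m00 : m0 != 0 := hm.
(* Two half lines, each allowing decay for at most one multiple, so three small multiples
   suffice. *)
have [th hth [nP nQ]] : exists2 a, a \in [:: t0; t0 / 2; t0 / 3] &
    ~ decays s eps 1 (fourier (ph a)) /\ ~ decays s eps (-1) (fourier (ph a)).
  apply: dichotomy3; [| | |exact: uniqd (oner_neq0 _)|apply: uniqd; rewrite oppr_eq0 oner_neq0//].
  - by rewrite gt_eqF//; clear - t00; lra.
  - by rewrite gt_eqF//; clear - t00; lra.
  - by rewrite gt_eqF//; clear - t00; lra.
have thb : 0 < th <= t0.
  by move: hth; rewrite !inE => /or3P[] /eqP ->; clear - t00; lra.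
have hne : Im (fourier (nonlin (F_omega F) (ph th)) 0) != 0.
  have := same th thb; move: (Im _) => z; apply: contraTneq => ->.
  by rewrite mul0r ltxx.
(* Decay depends only on the sign of tau, so the cases 1 and -1 cover all nonzero values. *)
have dscale tau tau' : 0 < tau * tau' -> decays s eps tau (fourier (ph th)) -> decays s eps tau' (fourier (ph th)).
  move=> tt [C1 [K1 h]]; exists C1, K1 => k hk ht; apply: h => //.
  by move: ht tt; move: (k%:~R) => x; clear; nra.
exists (ph th); split; [exact: Hph|exact: hne|].
move=> tau tau0 hd; have [tp|tn] := ltP 0 tau.
  by apply: nP; apply: dscale hd; rewrite mulr1.
by apply: nQ; apply: dscale hd; rewrite mulrN1 oppr_gt0 lt_neqAle tau0.
Qed.

Lemma RintT_Im f : RintT (fun x => Im (f x)) = Im (fourier f 0).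
Proof. by rewrite fourier0 /RintT /intT cImM /= mul0r addr0. Qed.

End NonExistence.

Theorem theorem1p4 (R : realType) (alpha : R) (F : mpoly.mpoly 4 R[i]) (s : R)
    (halpha : 2 < alpha)
    (hs : Num.max (alpha / 2 + 1) (5 / 2) < s)
    (hpsi : exists psi : R -> R[i],
       Hs s psi /\ RintT (fun x => complex.Im (nonlin (F_omega F) psi x)) <> 0) :
  exists phi : R -> R[i],
    Hs s phi /\
    forall T : R, 0 < T ->
      ~ (exists u : R -> R -> R[i],
           C_Hs s 0 T u /\ solution_fwd alpha F s T phi u) /\
      ~ (exists u : R -> R -> R[i],
           C_Hs s (- T) 0 u /\ solution_bwd alpha F s T phi u).
Proof.
move: hs; rewrite gt_max => /andP[as2 s52].
have [psi [hpsi1 hpsi2]] := hpsi.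
have hm : Im (fourier (nonlin (F_omega F) psi) 0) != 0 by rewrite -RintT_Im; exact/eqP.
have [eps [e0 ea e12]] : exists eps : R, [/\ 0 < eps, eps <= alpha - 2 & eps <= 1/2].
  exists (Num.min (alpha - 2) (1/2)); rewrite lt_min subr_gt0 halpha !ge_min !lexx orbT; split=> //.
  by rewrite divr_gt0.
have [phi [hphi hmphi nd]] := perturbed_datum s52 e0 hpsi1 hm.
exists phi; split=> // T T0; split=> -[u [hC hsol]].
  have [T1 [M [T10 htr]]] := fwd_trajectory s52 T0 hphi hC hsol.
  apply: nd (trajectory_decays halpha as2 s52 (ltW e0) ea e12 (or_introl erefl) T10 hphi htr hmphi).
  by rewrite mulf_neq0// oppr_eq0 oner_neq0.
have [T1 [M [T10 htr]]] := bwd_trajectory s52 T0 hphi hC hsol.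
have htr' : trajectory s alpha F (-1)%:C M T1 (fourier phi) (fun t => u (- t)) by rewrite rmorphN1.
apply: nd (trajectory_decays halpha as2 s52 (ltW e0) ea e12 (or_intror erefl) T10 hphi htr' hmphi).
by rewrite mulf_neq0// opprK oner_neq0.
Qed.
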